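(* Let $\alpha>3/2$, $C_1>0$, $C_2>1$, and suppose the observation times satisfy Assumption 2. Let $\hat f_U$ be the density estimator (defined in the context) computed with the sinc kernel, with parameter $\xi=\xi_n\asymp n^{-\delta_1}$ and bandwidth $h=h_n\asymp n^{-\delta_2}$, where $\delta_1>0$ and $\delta_2>0$ are such that $\delta_1+2\delta_2\le 1$, $\delta_1\ge 1/2$ and $\delta_2\ge (4\alpha-2)^{-1}$. Then there is a constant $C>0$, depending only on $\alpha$, $C_1$ and $C_2$, such that $$\sup_{\mathcal P_1(\alpha,C_1,C_2)}E\big(\|\hat f_U-f_U\|_2^2\big)\le C n^{-1/2}.$$
   Context: Setting. $T>0$ is fixed. For each $n$ there is a deterministic grid $\mathcal G=\{t_0,\dots,t_n\}$ with $0=t_0<t_1<\dots<t_n=T$ (depending on $n$), $\Delta t_j=t_j-t_{j-1}$, and $\max_{1\le j\le n}\Delta t_j\to0$ as $n\to\infty$. The data are $Y_{t_j}=X_{t_j}+U_{t_j}$, $j=0,\dots,n$. The process $(X_t)_{t\in[0,T]}$ satisfies $dX_t=\mu_t\,dt+\sigma_t\,dB_t$, where $\mu_t$ is a locally bounded, progressively measurable process, $\sigma_t$ is a positive, locally bounded It\^o semimartingale, and $B_t$ is a standard Brownian motion. Fourier transform: $f^{\mathrm{Ft}}(s)=\int e^{isx}f(x)\,dx$. Assumption 1: the errors $U_{t_0},\dots,U_{t_n}$ are independent and identically distributed with unknown density $f_U$, and are independent of the process $(X_t)_{t\in[0,T]}$. Assumption 2: as $n\to\infty$, $\min_{1\le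 j\le n}\Delta t_j/\max_{1\le j\le n}\Delta t_j$ is uniformly bounded away from zero and infinity. Assumption 3: $f_U^{\mathrm{Ft}}$ is real-valued and does not vanish at any point of the real line. Classes. $\mathcal X(C_1)$ is the class of processes $(X_t)_{t\in[0,T]}$ satisfying $dX_t=\mu_t\,dt+\sigma_t\,dB_t$, with $\mu_t$ locally bounded and progressively measurable, $\sigma_t$ a positive, locally bounded It\^o semimartingale and $B_t$ a standard Brownian motion, and with $\sup_{0\le t\le T}E(\mu_t^4)\le C_1$ and $\sup_{0\le t\le T}E(\sigma_t^4)\le C_1$. $\mathcal F_1(\alpha,C_2)=\{f: |f^{\mathrm{Ft}}(s)|\le C_2(1+|s|)^{-\alpha}\text{ for all real }s\}$. $\mathcal P_1(\alpha,C_1,C_2)$ is the collection of models for $(Y_t)_{t\in[0,T]}$, $Y_t=X_t+U_t$, with $(X_t)\in\mathcal X(C_1)$, errors satisfying Assumptions 1 and 3, and $f_U\in\mathcal F_1(\alpha,C_2)$. Estimator. For $\xi>0$ let $S_j=\{t_\ell\in\mathcal G:|t_\ell-t_j|\le\xi,\ \ell\ne j\}$ for $j=0,\dots,n$, let $N_j$ be the number of points of $S_j$, and $N(\xi)=\sum_{j=0}^nN_j$. It is understood throughout that $\xi=\xi_n$ is such that $\max_{1\le j\le n}N_j\asymp\min_{1\le j\le n}N_j\asymp n\xi$. Put $$\hat f_{U,1}^{\mathrm{Ft}}(s;\xi)=\Big|\frac1{N(\xi)}\sum_{j=0}^n\sum_{t_\ell\in S_j}\cos\{s(Y_{t_\ell}-Y_{t_j})\}\Big|^{1/2},\qquad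 \hat f_U(x)=\hat f_U(x;\xi)=\frac1{2\pi}\int e^{-isx}\hat f_{U,1}^{\mathrm{Ft}}(s;\xi)\,\mathcal K^{\mathrm{Ft}}(sh)\,ds,$$ where $h=h_n>0$ is a bandwidth with $h\to0$ as $n\to\infty$. The sinc kernel is the kernel $\mathcal K$ with $\mathcal K^{\mathrm{Ft}}(s)=I(|s|\le1)$. Notation: $a_n\asymp b_n$ means $c_1\le a_n/b_n\le c_2$ for all $n\ge1$ for some positive constants $c_1,c_2$; $\|f\|_2=(\int|f|^2)^{1/2}$. The horizon $T$, the sequence of grids (with its bounds in Assumption 2) and the constants in the $\asymp$ relations are regarded as fixed when the dependence of $C$ is described. *)

(* Defs.v *)
From HB Require Import structures.
From mathcomp Require Import all_boot all_order all_algebra.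
From mathcomp Require Import all_classical all_reals all_analysis.
From mathcomp Require Import measurable_realfun complex.

Set Implicit Arguments.
Unset Strict Implicit.
Unset Printing Implicit Defensive.

Import Order.TTheory GRing.Theory Num.Theory.
Import numFieldNormedType.Exports.

Local Open Scope classical_set_scope.
Local Open Scope ring_scope.

(* [f], restricted to [D], is measurable for the sigma-algebra [G] on [D].    *)
Definition measurable_wrt (S : Type) (d : measure_display)
    (S' : measurableType d) (D : set S) (G : set (set S)) (f : S -> S') :=
  forall A : set S', measurable A -> G (D `&` f @^-1` A).

Definition generated_by (I S : Type) (d : measure_display)
    (S' : measurableType d) (D : set I) (Z : I -> S -> S') : set (set S) :=
  <<s \bigcup_(i in D) preimage_set_system setT (Z i) measurable >>.

Section stochastic_calculus.
Context {R : realType} {d : measure_display} {Omega : measurableType d}.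
Context (P : probability Omega R) (T : R).

Local Notation process := (R -> Omega -> R).
Local Notation leb := (@lebesgue_measure R).

(* Processes are indexed by all of [R]; only times in [0, T] matter.          *)

Definition filtration (F : R -> set (set Omega)) :=
  [/\ forall t, 0 <= t <= T -> sigma_algebra setT (F t),
      forall t, 0 <= t <= T -> F t `<=` measurable &
      forall s t, 0 <= s -> s <= t -> t <= T -> F s `<=` F t].

Context (F : R -> set (set Omega)).

Definition adapted (Z : process) :=
  forall t, 0 <= t <= T -> measurable_wrt setT (F t) (Z t).

Definition progressive_sets (t : R) : set (set (Omega * R)) :=
  <<s [set: Omega] `*` `[0, t],
      [set E | exists A : set Omega, exists2 I : set R,
         F t A /\ measurable I & E = A `*` (I `&` `[0, t])] >>.

Definition progressively_measurable (Z : process) :=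
  forall t, 0 <= t <= T ->
    measurable_wrt ([set: Omega] `*` `[0, t]) (progressive_sets t)
      (fun p => Z p.2 p.1).

Definition predictable_sets : set (set (Omega * R)) :=
  <<s [set: Omega] `*` `[0, T],
      [set E | exists2 A : set Omega, F 0 A & E = A `*` [set 0]] `|`
      [set E | exists (A : set Omega) (s t : R),
         [/\ 0 <= s, s <= t, t <= T, F s A & E = A `*` `]s, t]]] >>.

Definition predictable (d' : measure_display) (S : measurableType d')
    (Z : R -> Omega -> S) :=
  measurable_wrt ([set: Omega] `*` `[0, T]) predictable_sets
    (fun p => Z p.2 p.1).

(* The product of the predictable and the Borel sigma-algebras.               *)
Definition predictable_field (W : Omega -> R -> R -> R) :=
  measurable_wrt (([set: Omega] `*` `[0, T]) `*` [set: R])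
    <<s ([set: Omega] `*` `[0, T]) `*` [set: R],
        [set E | exists D : set (Omega * R), exists2 A : set R,
           predictable_sets D /\ measurable A & E = D `*` A] >>
    (fun q => W q.1.1 q.1.2 q.2).

Definition cadlag (f : R -> R) :=
  (forall t, 0 <= t < T -> f x @[x --> t^'+] --> f t) /\
  (forall t, 0 < t <= T -> cvg (f x @[x --> t^'-])).

Definition stopping_time (tau : Omega -> R) :=
  (forall w, 0 <= tau w) /\
  (forall t, 0 <= t <= T -> F t [set w | tau w <= t]).

Definition localizing (tau : nat -> Omega -> R) :=
  [/\ forall k, stopping_time (tau k),
      forall k w, tau k w <= tau k.+1 w &
      {ae P, forall w, exists k, T <= tau k w}].

Definition stopped (tau : Omega -> R) (Z : process) : process :=
  fun t w => Z (Num.min t (tau w)) w.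

Definition locally_bounded (Z : process) :=
  exists (tau : nat -> Omega -> R) (K : nat -> R), localizing tau /\
    forall k, {ae P, forall w, 0 < tau k w ->
      forall t, 0 <= t <= T -> t <= tau k w -> `|Z t w| <= K k}.

Definition martingale (M : process) :=
  [/\ adapted M,
      forall t, 0 <= t <= T -> P.-integrable setT (EFin \o M t) &
      forall s t (A : set Omega), 0 <= s -> s <= t -> t <= T -> F s A ->
        (\int[P]_(w in A) (M t w)%:E = \int[P]_(w in A) (M s w)%:E)%E].

Definition local_martingale0 (M : process) :=
  [/\ adapted M, {ae P, forall w, cadlag (M ^~ w)}, forall w, M 0 w = 0 &
      exists2 tau, localizing tau & forall k, martingale (stopped (tau k) M)].

Definition continuous_local_martingale0 (M : process) :=
  local_martingale0 M /\
  {ae P, forall w, {within `[0, T], continuous (M ^~ w)}}.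

Definition purely_discontinuous_local_martingale0 (M : process) :=
  local_martingale0 M /\
  forall N : process, continuous_local_martingale0 N ->
    local_martingale0 (fun t w => M t w * N t w).

Definition brownian_motion (B : process) :=
  [/\ adapted B, forall w, B 0 w = 0,
      forall w, {within `[0, T], continuous (B ^~ w)},
      forall s t (A : set R), 0 <= s -> s < t -> t <= T -> measurable A ->
        P [set w | A (B t w - B s w)] = normal_prob 0 (Num.sqrt (t - s)) A &
      forall s t (A : set R) (E : set Omega),
        0 <= s -> s < t -> t <= T -> measurable A -> F s E ->
        P (E `&` [set w | A (B t w - B s w)]) =
          (P E * P [set w | A (B t w - B s w)%R])%E].

(* The process sum_(i < sp_size) sp_val i * 1_]sp_time i, sp_time i.+1].      *)
Record simple_process := SimpleProcess {
  sp_size : nat;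
  sp_time : nat -> R;
  sp_val : nat -> Omega -> R;
  sp_time0 : sp_time 0 = 0;
  sp_timeT : sp_time sp_size = T;
  sp_time_le : forall i, (i < sp_size)%N -> sp_time i <= sp_time i.+1;
  sp_adapted : forall i, (i < sp_size)%N ->
    measurable_wrt setT (F (sp_time i)) (sp_val i);
  sp_bounded : exists K : R, forall i w, (i < sp_size)%N -> `|sp_val i w| <= K
}.

Definition simple_eval (H : simple_process) : process := fun t w =>
  \sum_(i < sp_size H) sp_val H i w * \1_(`]sp_time H i, sp_time H i.+1]) t.

Definition simple_integral (H : simple_process) (B : process) : process :=
  fun t w => \sum_(i < sp_size H) sp_val H i w *
    (B (Num.min t (sp_time H i.+1)) w - B (Num.min t (sp_time H i)) w).

(* [J] is the continuous process t |-> int_0^t H dB, as the limit in          *)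
(* probability of the integrals of simple processes H_m such that             *)
(* int_0^T (H_m - H)^2 ds tends to 0 in probability.                          *)
Definition ito_integral (B H J : process) :=
  [/\ adapted J, forall w, {within `[0, T], continuous (J ^~ w)} &
      exists Hm : nat -> simple_process,
        (forall e : R, 0 < e ->
           P [set w | (e%:E <= \int[leb]_(s in `[0%R, T])
                ((simple_eval (Hm m) s w - H s w) ^+ 2)%:E)%E]
             @[m --> \oo] --> 0%E) /\
        (forall t, 0 <= t <= T -> forall e : R, 0 < e ->
           P [set w | e <= `|simple_integral (Hm m) B t w - J t w|]
             @[m --> \oo] --> 0%E)].

(* dX_t = mu_t dt + sigma_t dB_t.                                             *)
Definition ito_process (B mu sigma X : process) :=
  adapted X /\
  exists2 J, ito_integral B sigma J &
    {ae P, forall w, forall t, 0 <= t <= T ->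
       X t w = X 0 w + (\int[leb]_(s in `[0, t]) mu s w) + J t w}.

Definition jump (Z : process) : process :=
  fun t w => Z t w - lim (Z x w @[x --> t^'-]).

Definition levy_measure (m : {measure set R -> \bar R}) :=
  m [set 0] = 0%E /\ (\int[m]_x (Num.min 1 (x ^+ 2))%:E < +oo)%E.

(* nu_s(w, dx) ds is the compensator of the jump measure of [Z].              *)
Definition jump_compensator (Z : process)
    (nu : R -> Omega -> {measure set R -> \bar R}) :=
  forall W : Omega -> R -> R -> R,
    (forall w s x, 0 <= W w s x) -> predictable_field W ->
    (\int[P]_w
       (\esum_(s in [set s : R | (0 < s <= T)%R /\ (jump Z s w != 0)%R])
          (W w s (jump Z s w))%:E) =
     \int[P]_w (\int[leb]_(s in `[0%R, T]) (\int[nu s w]_x (W w s x)%:E)))%E.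

(* A semimartingale whose characteristics relative to the truncation function *)
(* x 1_{|x| <= 1} are int_0^t b_s ds, int_0^t c_s ds and nu_s(dx) ds.  [Mc]   *)
(* and [Md] are the continuous and the purely discontinuous parts of the      *)
(* local martingale in the canonical decomposition of                         *)
(* Z - sum_(s <= .) (jump Z s) 1_{|jump Z s| > 1}.                            *)
Definition ito_semimartingale (Z : process) :=
  [/\ adapted Z, forall w, cadlag (Z ^~ w) &
      exists (b c : process) (nu : R -> Omega -> {measure set R -> \bar R})
             (Mc Md : process),
      [/\ [/\ predictable b, predictable c, forall s w, 0 <= c s w,
              forall s w, levy_measure (nu s w) &
              forall A : set R, measurable A ->
                predictable (fun s w => nu s w A)],
          {ae P, forall w,
             [/\ leb.-integrable `[0, T] (fun s => (b s w)%:E),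
                 leb.-integrable `[0, T] (fun s => (c s w)%:E) &
                 (\int[leb]_(s in `[0%R, T])
                    \int[nu s w]_x (Num.min 1%R (x ^+ 2))%:E < +oo)%E]},
          continuous_local_martingale0 Mc /\
          local_martingale0
            (fun t w => Mc t w ^+ 2 - \int[leb]_(s in `[0, t]) c s w),
          purely_discontinuous_local_martingale0 Md /\
          jump_compensator Z nu &
          {ae P, forall w, forall t, 0 <= t <= T ->
             Z t w = Z 0 w + (\int[leb]_(s in `[0, t]) b s w) + Mc t w + Md t w
               + (\sum_(s \in [set s | 0 < s <= t /\ 1 < `|jump Z s w|])
                    jump Z s w)}]].

End stochastic_calculus.

Definition class_X (R : realType) (T C1 : R) (d : measure_display)
    (Omega : measurableType d) (P : probability Omega R)
    (X : R -> Omega -> R) :=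
  exists (F : R -> set (set Omega)) (B mu sigma : R -> Omega -> R),
  [/\ filtration T F /\ brownian_motion P T F B,
      locally_bounded P T F mu /\ progressively_measurable T F mu,
      [/\ {ae P, forall w, forall t, 0 <= t <= T -> 0 < sigma t w},
          locally_bounded P T F sigma & ito_semimartingale P T F sigma],
      ito_process P T F B mu sigma X &
      forall t, 0 <= t <= T ->
        ('E_P[(fun w => mu t w ^+ 4)%R] <= C1%:E)%E /\
        ('E_P[(fun w => sigma t w ^+ 4)%R] <= C1%:E)%E].

Section fourier.
Context {R : realType}.
Local Open Scope complex_scope.

Definition cintegral (f : R -> R[i]) : R[i] :=
  (\int[lebesgue_measure]_x complex.Re (f x)) +i*
  (\int[lebesgue_measure]_x complex.Im (f x)).

Definition expi (x : R) : R[i] := cos x +i* sin x.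

Definition fourier (f : R -> R) (s : R) : R[i] :=
  cintegral (fun x => expi (s * x) * (f x)%:C).

Definition cabs (z : R[i]) : R := complex.Re `|z|.

Definition L2norm (f : R -> R[i]) : \bar R :=
  ('N[@lebesgue_measure R]_(2%:E)[(fun x => (cabs (f x))%:E)])%E.

Definition class_F1 (alpha C2 : R) (f : R -> R) :=
  forall s : R, cabs (fourier f s) <= C2 * (1 + `|s|) `^ (- alpha).

Definition real_nonvanishing_fourier (f : R -> R) :=
  forall s : R, complex.Im (fourier f s) = 0 /\ fourier f s != 0.

End fourier.

Definition density (R : realType) (f : R -> R) :=
  [/\ measurable_fun setT f, forall x, 0 <= f x &
      (\int[lebesgue_measure]_x (f x)%:E = 1)%E].

Definition iid_with_density (R : realType) (d : measure_display)
    (Omega : measurableType d) (P : probability Omega R) (m : nat)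
    (V : 'I_m -> Omega -> R) (f : R -> R) :=
  [/\ forall j, measurable_fun setT (V j),
      forall j (A : set R), measurable A ->
        P (V j @^-1` A) = (\int[lebesgue_measure]_(x in A) (f x)%:E)%E &
      forall A : 'I_m -> set R, (forall j, measurable (A j)) ->
        P (\bigcap_(j in [set: 'I_m]) V j @^-1` A j) =
          (\prod_(j < m) P (V j @^-1` A j))%E].

Definition independent_systems (R : realType) (d : measure_display)
    (Omega : measurableType d) (P : probability Omega R)
    (G H : set (set Omega)) :=
  forall A B, G A -> H B -> P (A `&` B) = (P A * P B)%E.

(* The grid is g 0 < ... < g n; nothing is required of U away from it.        *)
Definition error_model (R : realType) (T : R) (g : nat -> R) (n : nat)
    (d : measure_display) (Omega : measurableType d) (P : probability Omega R)
    (X U : R -> Omega -> R) (f : R -> R) :=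
  [/\ density f,
      iid_with_density P (fun j : 'I_n.+1 => U (g j)) f &
      independent_systems P
        (generated_by [set: 'I_n.+1] (fun j => U (g j)))
        (generated_by [set` `[0, T]] X)].

Record model (R : realType) := Model {
  outcome_display : measure_display;
  outcome : measurableType outcome_display;
  law : probability outcome R;
  signal : R -> outcome -> R;
  error : R -> outcome -> R;
  error_density : R -> R
}.

Definition observed (R : realType) (M : model R) : R -> outcome M -> R :=
  fun t w => signal t w + error t w.

Definition class_P1 (R : realType) (T : R) (g : nat -> R) (n : nat)
    (alpha C1 C2 : R) (M : model R) :=
  [/\ class_X T C1 (law M) (signal (m := M)),
      error_model T g n (law M) (signal (m := M)) (error (m := M))
        (error_density M),
      real_nonvanishing_fourier (error_density M) &
      class_F1 alpha C2 (error_density M)].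

Section estimator.
Context {R : realType}.
Local Open Scope complex_scope.

Definition neighbour (g : nat -> R) (xi : R) (j l : nat) : bool :=
  (`|g l - g j| <= xi) && (l != j).

Definition nb_neighbours (g : nat -> R) (n : nat) (xi : R) (j : nat) : nat :=
  #|[pred l : 'I_n.+1 | neighbour g xi j l]|.

Definition nb_pairs (g : nat -> R) (n : nat) (xi : R) : nat :=
  \sum_(j < n.+1) nb_neighbours g n xi j.

(* [y j] is the observation at time [g j].                                    *)
Definition fourier_hat (g : nat -> R) (n : nat) (xi : R) (y : nat -> R)
    (s : R) : R :=
  Num.sqrt `|(nb_pairs g n xi)%:R^-1 *
    \sum_(j < n.+1) \sum_(l < n.+1 | neighbour g xi j l)
       cos (s * (y l - y j))|.

Definition sinc_kernel_fourier (s : R) : R := (`|s| <= 1)%R%:R.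

Definition density_hat (g : nat -> R) (n : nat) (xi h : R) (y : nat -> R)
    (x : R) : R[i] :=
  ((2 * pi)^-1)%:C *
  cintegral (fun s => expi (- (s * x)) *
    (fourier_hat g n xi y s * sinc_kernel_fourier (s * h))%:C).

Definition risk (g : nat -> R) (n : nat) (xi h : R) (M : model R) : \bar R :=
  (\int[law M]_w
     (L2norm (fun x =>
        density_hat g n xi h (fun j => observed (g j) w) x
        - (error_density M x)%:C)%R) ^+ 2)%E.

End estimator.

(* [g n j] is the j-th time of the n-th grid, and only n >= 1 matters.        *)
Section grids.
Context {R : realType}.

(* [c.1] and [c.2] are the constants in the comparison of [a] and [b].        *)
Definition asymp (c : R * R) (a b : nat -> R) :=
  [/\ 0 < c.1, 0 < c.2 &
      forall n, (0 < n)%N -> c.1 <= a n / b n <= c.2].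

Definition step (g : nat -> nat -> R) (n j : nat) : R := g n j - g n j.-1.

(* The initial values below belong to the ranges, which are nonempty.         *)
Definition max_step (g : nat -> nat -> R) (n : nat) : R :=
  \big[Num.max/step g n 1]_(1 <= j < n.+1) step g n j.

Definition min_step (g : nat -> nat -> R) (n : nat) : R :=
  \big[Num.min/step g n 1]_(1 <= j < n.+1) step g n j.

Definition grids (T : R) (g : nat -> nat -> R) :=
  (forall n, (0 < n)%N ->
     [/\ g n 0%N = 0, g n n = T & forall j, (j < n)%N -> g n j < g n j.+1]) /\
  max_step g n @[n --> \oo] --> 0.

Definition quasi_uniform (g : nat -> nat -> R) :=
  exists c, asymp c (min_step g) (max_step g).

Definition max_neighbours (g : nat -> nat -> R) (xi : nat -> R) (n : nat) : R :=
  (\big[maxn/nb_neighbours (g n) n (xi n) 1]_(1 <= j < n.+1)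
     nb_neighbours (g n) n (xi n) j)%:R.

Definition min_neighbours (g : nat -> nat -> R) (xi : nat -> R) (n : nat) : R :=
  (\big[minn/nb_neighbours (g n) n (xi n) 1]_(1 <= j < n.+1)
     nb_neighbours (g n) n (xi n) j)%:R.

End grids.

(* Main.v *)
(** Let phi be the characteristic function of the errors: it is real, positive and, since alpha > 3/2,
    integrable. The Plancherel inequality for cosine transforms (obtained with the weights exp(-e|s|)
    and Fubini's theorem) and Fourier inversion bound the integrated squared error by (2 pi)^-1 times
    the integral of (phihat(s) 1_{|s| <= 1/h} - phi(s))^2.

    At a fixed frequency s, expanding cos(s (Y_l - Y_j)) around phi(s) gives
    phihat^2 = |phi^2 + phi D + Q|, where D is the sum of the bias, -phi times the mean of
    1 - cos(s (X_l - X_j)), and of a noise linear in cos(s U_j) - phi and sin(s U_j), and Q is a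
    quadratic noise; hence (phihat - phi)^2 <= 4 D^2 + 2 |Q|. All these noise terms have mean zero and
    are essentially uncorrelated. With N >= c n^2 xi pairs of observations, each having at most a
    constant times n xi neighbours, the linear part contributes O(1/n) and E|Q| = O(N^(-1/2)).
    The bias contributes O(phi^2 s^2 xi) because E (X_t - X_s)^2 <= K |t - s|. For the stochastic
    integral this last bound is derived from its definition as a limit in probability: the energy of
    the approximating simple processes is truncated, the discrete martingale transforms are bounded
    in mean square, and Fatou's lemma is applied.

    Integrating over |s| <= 1/h, and bounding phi^2 by its decay for |s| > 1/h, yields terms of order
    xi, n^-1 h^-1, N^(-1/2) h^-1 and h^(2 alpha - 1), all of which are O(n^(-1/2)). *)

Require Import Defs.
From mathcomp Require Import all_boot all_order all_algebra.
From mathcomp Require Import all_classical all_reals all_analysis.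
From mathcomp Require Import measurable_realfun complex ring lra.
Set Implicit Arguments.
Unset Strict Implicit.
Unset Printing Implicit Defensive.
Import Order.TTheory GRing.Theory Num.Theory.
Import numFieldNormedType.Exports.
Local Open Scope classical_set_scope.
Local Open Scope ring_scope.

(** * Exponential weights and Fourier inversion *)

Section calculus.
Context {R : realType}.
Local Notation leb := (@lebesgue_measure R).
Implicit Types (a b l u e s t : R).


(** The estimator takes a square root, while [phi] has no lower bound at high frequencies.
    Linearizing the root would divide the quadratic noise [Q] by [phi]. The comparison used instead
    separates the case where [|Q|] exceeds [phi |D|] and pays [|Q|] there, not [(Q / phi)^2]. The
    price is a term [N^(-1/2)] at each frequency; its integral over [|s| <= 1/h] has order
    [n^(-1 + delta1/2 + delta2)], which is what [delta1 + 2 delta2 <= 1] controls. The linear noise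
    carries a factor [phi] of its own and survives the division. The bound [alpha > 3/2] makes
    [s^2 phi(s)^2] integrable over the whole line, so that the bias costs a multiple of [xi]
    whatever [h] is.

    A second obstacle is that independence and laws are given on events only, and that the
    stochastic integral is only a limit in probability. Expectations are therefore built up from
    indicators, and most computations involve nonnegative functions, so that infinite integrals
    never have to be subtracted; integrability comes afterwards, from cut-offs and Fatou's lemma. *)

Lemma is_derive_continuous (f : R -> R) (x df : R) : is_derive x (1 : R) f df -> {for x, continuous f}.
Proof. by move=> h; apply/differentiable_continuous/derivable1_diffP/ex_derive. Qed.

Lemma ge0_FTC2y (f F : R -> R) (a l : R) : (forall x, a <= x -> 0 <= f x) ->
  (forall x, a <= x -> is_derive x (1 : R) F (f x)) ->
  (forall x, a <= x -> {for x, continuous f}) -> F x @[x --> +oo] --> l ->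
  (\int[leb]_(x in `[a, +oo[) (f x)%:E)%E = (l - F a)%:E.
Proof.
move=> f0 dF cf Fl; rewrite EFinB; apply: ge0_continuous_FTC2y => //.
- apply/continuous_within_itvcyP; split.
    by move=> x; rewrite in_itv/= andbT => /ltW/cf.
  by apply: cvg_at_right_filter; exact: cf.
- by move=> x /ltW/dF[].
- by apply: cvg_at_right_filter; apply: is_derive_continuous; exact: dF.
- move=> x; rewrite in_itv/= andbT => /ltW/dF h.
  by rewrite derive1E derive_val.
Qed.

Lemma FTC2 (f F : R -> R) (a b : R) : a < b ->
  (forall x, is_derive x (1 : R) F (f x)) -> continuous f ->
  (\int[leb]_(x in `[a, b]) (f x)%:E)%E = (F b - F a)%:E.
Proof.
move=> ab dF cf; rewrite EFinB; apply: continuous_FTC2 => //.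
- exact: continuous_subspaceT.
- have cF x : {for x, continuous F} by exact: is_derive_continuous.
  split.
  + by move=> x _; exact: ex_derive.
  + by apply: cvg_at_right_filter; exact: cF.
  + by apply: cvg_at_left_filter; exact: cF.
- by move=> x _; rewrite derive1E derive_val.
Qed.

Lemma integral_even (f : R -> R) : (forall x, 0 <= f x) -> continuous f ->
  (forall x, f (- x) = f x) ->
  (\int[leb]_x (f x)%:E = 2%:E * \int[leb]_(x in `[0%R, +oo[) (f x)%:E)%E.
Proof.
move=> f0 cf fN; rewrite ge0_symfun_integralT ?set_itvcy //.
by move=> x /=; rewrite fN.
Qed.

Lemma integrable_even (f : R -> R) (A : R) : (forall x, 0 <= f x) -> continuous f ->
  (forall x, f (- x) = f x) ->
  (\int[leb]_(x in `[0%R, +oo[) (f x)%:E)%E = A%:E ->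
  leb.-integrable setT (EFin \o f) /\ \int[leb]_x f x = 2 * A.
Proof.
move=> f0 cf fN fA.
have fE := integral_even f0 cf fN; rewrite fA -EFinM in fE.
split; last by rewrite /Rintegral fE.
apply/integrableP; split.
  by apply/measurable_EFinP; exact: continuous_measurable_fun.
under eq_integral do rewrite /= ger0_norm//.
by rewrite fE ltry.
Qed.

Definition expN_abs (e x : R) : R := expR (- (e * `|x|)).

Lemma expN_abs_gt0 e x : 0 < expN_abs e x.
Proof. exact: expR_gt0. Qed.

Lemma expN_abs_le1 e x : 0 < e -> expN_abs e x <= 1.
Proof. by move=> e0; rewrite -expR0 ler_expR oppr_le0 mulr_ge0// ltW. Qed.

Lemma continuous_expN_abs e : continuous (expN_abs e).
Proof.
move=> x; apply: (@continuous_comp _ _ _ (fun x : R => - (e * `|x|)) expR).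
  apply: continuousN; apply: continuousM; first exact: cvg_cst.
  exact: norm_continuous.
exact: continuous_expR.
Qed.

Lemma cvg_bounded_expN (g : R -> R) M e : 0 < e -> (forall x, `|g x| <= M) ->
  expR (- (e * x)) * g x @[x --> +oo] --> (0 : R).
Proof.
move=> e0 gM.
have M0 : 0 <= M by exact: le_trans (gM 0).
have lim : (M + 1) * expR (- (e * x)) @[x --> +oo] --> (0 : R).
  rewrite -[X in _ --> X](mulr0 (M + 1)); apply: cvgMr.
  apply: (@cvg_comp _ _ _ (fun x => e * x) (fun y => expR (- y)) _ (pinfty_nbhs R)).
    exact/gt0_cvgMry.
  exact: cvgr_expR.
apply/cvgr0Pnorm_lt => d d0.
move/cvgr0Pnorm_lt : lim => /(_ _ d0); apply: filterS => x.
apply: le_lt_trans; rewrite !normrM mulrC.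
rewrite ler_wpM2r// (le_trans (gM x))// ger0_norm; lra.
Qed.

(** Adding 1 to the cosine makes the integrand nonnegative, so that the fundamental theorem on a
    half-line applies without prior integrability; the 1 is subtracted again in
    [Rintegral_expN_cos]. *)
Lemma integral_expN_1Dcos e u : 0 < e ->
  (\int[leb]_(x in `[0%R, +oo[) (expR (- (e * x)) * (1 + cos (u * x)))%:E)%E
  = (e^-1 + e / (e ^+ 2 + u ^+ 2))%:E.
Proof.
move=> e0.
pose D := e ^+ 2 + u ^+ 2.
have D0 : D != 0.
  by rewrite gt_eqF// ltr_pwDl ?sqr_ge0// exprn_gt0.
pose F x := expR (- (e * x)) * (- e^-1 + (u * sin (u * x) - e * cos (u * x)) / D).
have dF x : is_derive x (1 : R) F (expR (- (e * x)) * (1 + cos (u * x))).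
  rewrite /F; apply: is_derive_eq.
  rewrite /GRing.scale/= !mulr0 !mulr1 ?addr0 ?add0r.
  rewrite /D; field.
  by rewrite D0 gt_eqF.
etransitivity; first apply: (@ge0_FTC2y _ F 0 0).
- move=> x _; rewrite mulr_ge0 ?expR_ge0//.

- by move=> x _; apply: is_derive_continuous.
- rewrite /F.
  apply: (@cvg_bounded_expN _ (e^-1 + (`|u| + e) / `|D|)) => // x.
  rewrite (le_trans (ler_normD _ _))// lerD//.
    by rewrite normrN ger0_norm// invr_ge0 ltW.
  rewrite normrM normfV ler_wpM2r ?invr_ge0//.
  rewrite (le_trans (ler_normB _ _))// lerD// normrM.
    by rewrite ler_piMr// ler_norml sin_geN1 sin_le1.
  rewrite (ger0_norm (ltW e0)) ler_piMr ?(ltW e0)//.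
  by rewrite ler_norml cos_geN1 cos_le1.
- congr _%:E; rewrite /F mulr0 oppr0 expR0 mulr0 sin0 cos0 /D; field.
  by rewrite D0 gt_eqF.
Qed.

Lemma expN_abs_even e x : expN_abs e (- x) = expN_abs e x.
Proof. by rewrite /expN_abs normrN. Qed.



Lemma continuous_cosM s : continuous (fun x : R => cos (s * x)).
Proof. by move=> x; apply: is_derive_continuous. Qed.

Lemma Rintegral_expN_abs e : 0 < e ->
  leb.-integrable setT (EFin \o expN_abs e) /\ \int[leb]_x expN_abs e x = 2 / e.
Proof.
move=> e0; apply: integrable_even.
- by move=> x; exact: expR_ge0.
- exact: continuous_expN_abs.
- exact: expN_abs_even.
(* At [u = 0] the integrand is twice the weight. The factor 2 is cancelled in the extended reals
   once infinite values are ruled out. *)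
have := integral_expN_1Dcos 0 e0.
rewrite expr0n/= addr0.
have -> : e^-1 + e / e ^+ 2 = 2 * e^-1 by field; rewrite gt_eqF.
under eq_integral => x _.
  rewrite mul0r cos0 -[1 + 1]/(2%:R : R) [_ * 2]mulrC EFinM; over.
rewrite ge0_integralZl//; last first.
  apply/measurable_EFinP/measurable_funTS; apply: continuous_measurable_fun.
  by move=> x; apply: is_derive_continuous.
move=> h.
have -> : (\int[leb]_(x in `[0%R, +oo[) (expN_abs e x)%:E =
  \int[leb]_(x in `[0%R, +oo[) (expR (- (e * x)))%:E)%E.
  apply: eq_integral => x; rewrite inE/= in_itv/= andbT => x0.
  by rewrite /expN_abs ger0_norm.
move: h; case: (\int[_]_(_ in _) _)%E => [r||].
- by rewrite -!EFinM => -[]; move/(mulfI _) => -> //.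
- by rewrite mulry gtr0_sg// mul1e.
- by rewrite mulrNy gtr0_sg// mul1e.
Qed.

Lemma Rintegral_expN_cos e u : 0 < e ->
  \int[leb]_x (expN_abs e x * cos (u * x)) = 2 * (e / (e ^+ 2 + u ^+ 2)).
Proof.
move=> e0.
have [iw wE] := Rintegral_expN_abs e0.
have [|||| iwc wcE] := @integrable_even (fun x => expN_abs e x * (1 + cos (u * x)))
   (e^-1 + e / (e ^+ 2 + u ^+ 2)).
- by move=> x; rewrite mulr_ge0 ?expR_ge0// -lerBlDl sub0r cos_geN1.
- move=> x; apply: continuousM; first exact: continuous_expN_abs.
  by apply: continuousD; [exact: cst_continuous|exact: continuous_cosM].
- by move=> x; rewrite expN_abs_even mulrN cosN.
- rewrite -(integral_expN_1Dcos u e0); apply: eq_integral => x.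
  by rewrite inE/= in_itv/= andbT => x0; rewrite /expN_abs ger0_norm.
have -> : (fun x => expN_abs e x * cos (u * x)) =
  (fun x => expN_abs e x * (1 + cos (u * x)) - expN_abs e x).
  by apply/funext => x; rewrite mulrDr mulr1 addrAC subrr add0r.
rewrite RintegralB// wE wcE; field.
rewrite (gt_eqF e0)/= gt_eqF// ltr_pwDl ?sqr_ge0// exprn_gt0//.
Qed.

Lemma integrable_mul_bounded d (T : measurableType d) (mu : {measure set T -> \bar R})
    (f g : T -> R) M : mu.-integrable setT (EFin \o f) -> measurable_fun setT g ->
  (forall x, `|g x| <= M) -> mu.-integrable setT (EFin \o (fun x => f x * g x)).
Proof.
move=> fi mg gM; have := @integrableMl _ _ _ mu setT measurableT _ _ fi mg.
apply; exists M; split; first exact: num_real.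
by move=> N MN x _ /=; rewrite (le_trans (gM x))// ltW.
Qed.

End calculus.

(** The way from regularized to unregularized quantities: it removes the exponential weight in the
    Plancherel inequality and the cut-off of increments of the stochastic integral. *)
Lemma fatou_bound d (T : measurableType d) (R : realType)
    (mu : {measure set T -> \bar R}) (f : (T -> \bar R)^nat) (g : T -> \bar R)
    (M : \bar R) :
  (forall n, measurable_fun setT (f n)) -> (forall n x, (0 <= f n x)%E) ->
  (forall x, f n x @[n --> \oo] --> g x) ->
  (forall n, (\int[mu]_x f n x <= M)%E) -> (\int[mu]_x g x <= M)%E.
Proof.
move=> mf f0 fg fM.
have -> : g = fun x => limn_einf (f ^~ x).
  by apply/funext => x; have /cvg_limn_einf_sup[-> _] := fg x.
apply: le_trans (fatou mu measurableT mf _) _ => //.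
rewrite limn_einf_lim; apply: lime_le; first exact: is_cvg_einfs.
apply: nearW => n; apply: le_trans (fM n).
by apply: ereal_inf_lbound; exists n => //=.
Qed.

(** * Exchange of integrals and the Cauchy kernel *)

Section fubini.
Context {R : realType}.
Local Notation leb := (@lebesgue_measure R).
Implicit Types (e s t u M : R).

Lemma integrable_prod (a b : R -> R) : leb.-integrable setT (EFin \o a) ->
  leb.-integrable setT (EFin \o b) ->
  (leb \x leb)%E.-integrable setT (EFin \o (fun z => a z.1 * b z.2)).
Proof.
move=> ia ib.
have ma : measurable_fun setT a by case/integrableP : ia => /measurable_EFinP.
have mb : measurable_fun setT b by case/integrableP : ib => /measurable_EFinP.
apply/integrable12ltyP.
  by apply/measurable_EFinP; apply: measurable_funM; exact: measurableT_comp.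
under eq_integral => x _.
  under eq_integral => y _ do rewrite /= normrM EFinM.
  rewrite ge0_integralZl//; last by apply/measurable_EFinP; exact: measurableT_comp.
  over.
rewrite ge0_integralZr//.
- apply: lte_mul_pinfty; first exact: integral_ge0.
    by rewrite ge0_fin_numE ?integral_ge0//; case/integrableP : ia.
  by case/integrableP : ib.
- by apply/measurable_EFinP; exact: measurableT_comp.
- exact: integral_ge0.
Qed.

(** Two integrable weights and a bounded kernel: the kernels met below are cosines and multiples of
    the Cauchy kernel, so this form covers the exchanges in the inversion and most of those in the
    Plancherel inequality. *)
Lemma Rfubini_bounded (a b : R -> R) (k : R * R -> R) M :
  leb.-integrable setT (EFin \o a) -> leb.-integrable setT (EFin \o b) ->
  measurable_fun setT k -> (forall z, `|k z| <= M) ->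
  \int[leb]_x (a x * \int[leb]_y (b y * k (x, y))) =
  \int[leb]_y (b y * \int[leb]_x (a x * k (x, y))).
Proof.
move=> ia ib mk kM.
have iF : (leb \x leb)%E.-integrable setT (EFin \o (fun z => a z.1 * b z.2 * k z)).
  exact: integrable_mul_bounded (integrable_prod ia ib) mk kM.
have mk1 x : measurable_fun setT (fun y => k (x, y)).
  by apply: measurableT_comp.
have mk2 y : measurable_fun setT (fun x => k (x, y)).
  by apply: measurableT_comp.
have i1 x := integrable_mul_bounded ib (mk1 x) (fun y => kM (x, y)).
have i2 y := integrable_mul_bounded ia (mk2 y) (fun x => kM (x, y)).
rewrite /Rintegral; apply: (congr1 fine).
transitivity (\int[leb]_x \int[leb]_y ((a x * b y * k (x, y))%:E))%E.
  apply: eq_integral => x _; rewrite EFinM fineK; last first.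
    exact: (integrable_fin_num measurableT (i1 x)).
  rewrite -integralZl//; last exact: i1; apply: eq_integral => y _.
  by rewrite -EFinM mulrA.
rewrite (@Fubini _ _ _ _ _ leb leb (EFin \o (fun z => a z.1 * b z.2 * k z)))//.
apply: eq_integral => y _; rewrite EFinM fineK; last first.
  exact: (integrable_fin_num measurableT (i2 y)).
rewrite -integralZl//; last exact: i2; apply: eq_integral => x _ /=.
by rewrite -EFinM; congr _%:E; ring.
Qed.

(** This is [pi] times the Cauchy density of scale [e]; the cosine transform of [expN_abs e] is
    twice this function. *)
Definition cauchy_kernel e u := e / (e ^+ 2 + u ^+ 2).

Lemma cauchy_kernel_ge0 e u : 0 < e -> 0 <= cauchy_kernel e u.
Proof. by move=> e0; rewrite divr_ge0 ?(ltW e0)// addr_ge0 ?sqr_ge0. Qed.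

Lemma cauchy_kernel_le e u : 0 < e -> cauchy_kernel e u <= e^-1.
Proof.
move=> e0; rewrite /cauchy_kernel ler_pdivrMr; last by rewrite ltr_pwDl ?sqr_ge0 ?exprn_gt0.
rewrite mulrDr expr2 mulrA mulVf ?gt_eqF// mul1r lerDl.
by rewrite mulr_ge0 ?sqr_ge0// invr_ge0 ltW.
Qed.

Lemma cauchy_kernelN e u : cauchy_kernel e (- u) = cauchy_kernel e u.
Proof. by rewrite /cauchy_kernel sqrrN. Qed.

Lemma is_derive_atan_kernel (e s t : R) : 0 < e ->
  is_derive t (1 : R) (fun x => atan ((x - s) / e)) (cauchy_kernel e (t - s)).
Proof.
move=> e0; apply: is_derive_eq.
rewrite /GRing.scale/= /cauchy_kernel mulr0 add0r subr0 mulr1.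
field.
rewrite (gt_eqF e0) gt_eqF//= ?ltr_pwDl ?sqr_ge0 ?exprn_gt0//.
Qed.

Lemma continuous_cauchy_kernel e s : 0 < e ->
  continuous (fun x => cauchy_kernel e (x - s)).
Proof.
move=> e0 x; apply: (@continuousM _ _ (cst e) (fun x => (e ^+ 2 + (x - s) ^+ 2)^-1)).
  exact: cst_continuous.
apply: continuousV; first by rewrite gt_eqF// ltr_pwDl ?sqr_ge0 ?exprn_gt0.
by apply: is_derive_continuous.
Qed.

Lemma cvg_atan_affine e s : 0 < e ->
  atan ((x - s) / e) @[x --> +oo] --> (pi / 2 : R).
Proof.
move=> e0; apply: (@cvg_comp _ _ _ (fun x => (x - s) / e) atan _ (pinfty_nbhs R) _ _ (@cvgy_atan R)).
apply: (@cvg_comp _ _ _ (fun x => x - s) (fun y => y / e) _ (pinfty_nbhs R)).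
  exact: cvg_addrr.
by apply: gt0_cvgMly; rewrite ?invr_gt0.
Qed.

(** The symmetrized kernel is even in [t], which reduces the integral to a half-line. There the two
    arctangents each tend to [pi / 2] at infinity and cancel at 0. *)
Lemma integral_cauchy_kernels e s : 0 < e ->
  (\int[leb]_t (cauchy_kernel e (t - s) + cauchy_kernel e (t + s))%:E)%E =
  (2 * pi)%:E.
Proof.
move=> e0.
have cK x : {for x, continuous (fun t => cauchy_kernel e (t - s) + cauchy_kernel e (t + s))}.
  apply: continuousD; first exact: continuous_cauchy_kernel.
  by have := @continuous_cauchy_kernel e (- s) e0; rewrite opprK; apply.
rewrite integral_even.
- have dF x : is_derive x (1 : R)
      (fun x => atan ((x - s) / e) + atan ((x - - s) / e))
      (cauchy_kernel e (x - s) + cauchy_kernel e (x + s)).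
    apply: is_deriveD; first exact: is_derive_atan_kernel.
    by rewrite -{2}(opprK s); exact: is_derive_atan_kernel.
  have -> : (\int[leb]_(x in `[0%R, +oo[)
      (cauchy_kernel e (x - s) + cauchy_kernel e (x + s))%:E = pi%:E)%E.
    etransitivity; first apply: (ge0_FTC2y (l := pi) _ (fun x _ => dF x)).
  + by move=> x _; rewrite addr_ge0 ?cauchy_kernel_ge0.
  + by move=> x _; exact: cK.
  + rewrite [X in _ --> X]splitr; apply: cvgD; exact: cvg_atan_affine.
  + by rewrite /= !sub0r opprK mulNr atanN addNr subr0.
  by rewrite EFinM.
- by move=> x; rewrite addr_ge0 ?cauchy_kernel_ge0.
- exact: cK.
- move=> x; rewrite addrC; congr (_ + _); rewrite -cauchy_kernelN.
    by rewrite opprD opprK.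
  by rewrite opprB opprK addrC.
Qed.

End fubini.

(** * The Plancherel inequality for cosine transforms *)

Section plancherel.
Context {R : realType}.
Local Notation leb := (@lebesgue_measure R).
Implicit Types (e s t u M : R).

Lemma measurable_cosM s : measurable_fun setT (fun x : R => cos (s * x)).
Proof. by apply: continuous_measurable_fun; exact: continuous_cosM. Qed.

Lemma measurable_sinM s : measurable_fun setT (fun x : R => sin (s * x)).
Proof. by apply: continuous_measurable_fun => x; apply: is_derive_continuous. Qed.

Lemma cos_norm_le1 (x : R) : `|cos x| <= 1.
Proof. by rewrite ler_norml cos_geN1 cos_le1. Qed.

Lemma sin_norm_le1 (x : R) : `|sin x| <= 1.
Proof. by rewrite ler_norml sin_geN1 sin_le1. Qed.

Lemma measurable_cos_prod d (T : measurableType d) (a b : T -> R) :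
  measurable_fun setT a -> measurable_fun setT b ->
  measurable_fun setT (fun z => cos (a z * b z)).
Proof.
move=> ma mb; apply: (@measurableT_comp _ _ _ _ _ _ (@cos R)).
  by apply: continuous_measurable_fun; exact: continuous_cos.
exact: measurable_funM.
Qed.

(** For a real function this is the real part of [fourier]. The imaginary part vanishes for the
    error densities, so that all the analysis can stay real. *)
Definition cosine_transform (psi : R -> R) (x : R) : R :=
  \int[leb]_s (psi s * cos (s * x)).

Section bounded.
Variables (psi : R -> R) (psi_int : leb.-integrable setT (EFin \o psi)).

Lemma integrable_cosine_transform x :
  leb.-integrable setT (EFin \o (fun s => psi s * cos (s * x))).
Proof.
apply: (integrable_mul_bounded (M := 1)) psi_int _ _.
  by under eq_fun do rewrite mulrC; exact: measurable_cosM.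
by move=> s; exact: cos_norm_le1.
Qed.

Lemma cosine_transform_bound x :
  `|cosine_transform psi x| <= \int[leb]_s `|psi s|.
Proof.
apply: le_trans (le_normr_Rintegral measurableT (integrable_cosine_transform x)) _.
apply: le_Rintegral => //.
- exact: integrable_norm (integrable_cosine_transform x).
- exact: integrable_norm.
- by move=> s _; rewrite normrM ler_piMr// cos_norm_le1.
Qed.

Lemma continuous_cosine_transform : continuous (cosine_transform psi).
Proof.
move=> x.
have := @continuity_under_integral R _ (measurableTypeR R) leb (fun x s => psi s * cos (s * x)) setT
  measurableT (x - 1) (x + 1) _ _ (fun s => `|psi s|).
apply.
- by move=> y _; exact: integrable_cosine_transform.
- apply: aeW => s _ y _; apply: continuousM; first exact: cst_continuous.
  exact: continuous_cosM.
- exact: integrable_norm.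
- move=> y _; apply: aeW => s _.
  by rewrite normrM ler_piMr// cos_norm_le1.
- by rewrite inE/= in_itv/=; lra.
Qed.

End bounded.

Lemma Rintegral_weighted_cos_cos e s t : 0 < e ->
  \int[leb]_x (expN_abs e x * cos (s * x) * cos (t * x)) =
  cauchy_kernel e (t - s) + cauchy_kernel e (t + s).
Proof.
move=> e0.
have [iw _] := Rintegral_expN_abs e0.
have ic u : leb.-integrable setT (EFin \o (fun x => expN_abs e x * cos (u * x))).
  apply: (integrable_mul_bounded (M := 1)) iw (measurable_cosM u) _.
  by move=> x; exact: cos_norm_le1.
transitivity (\int[leb]_x (2^-1 * (expN_abs e x * cos ((t - s) * x)) +
    2^-1 * (expN_abs e x * cos ((t + s) * x)))).
  apply: eq_Rintegral => x _; rewrite (mulrDl t s x) (mulrBl x t s) cosB cosD.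
  by field.
have icz u : leb.-integrable setT (EFin \o (fun x => 2^-1 * (expN_abs e x * cos (u * x)))).
  exact: (integrableZl measurableT 2^-1 (ic u)).
rewrite RintegralD// !RintegralZl// !Rintegral_expN_cos// /cauchy_kernel; field.
by rewrite !gt_eqF// ltr_pwDl ?sqr_ge0 ?exprn_gt0.
Qed.

(** Expanding the square gives the double integral of [psi s * psi t * K s t] with a nonnegative
    symmetric kernel whose integral in either variable is [2 pi]. The bound is then Schur's test:
    [2 |psi s psi t| <= psi s ^ 2 + psi t ^ 2], and each square is integrated against [K] by
    Tonelli. *)
Lemma weighted_L2_cosine_transform (psi : R -> R) M e : 0 < e ->
  leb.-integrable setT (EFin \o psi) -> (forall s, `|psi s| <= M) ->
  (\int[leb]_x (expN_abs e x * cosine_transform psi x ^+ 2)%:E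
   <= (2 * pi)%:E * \int[leb]_s (psi s ^+ 2)%:E)%E.
Proof.
move=> e0 ipsi psiM.
have mpsi : measurable_fun setT psi by case/integrableP : ipsi => /measurable_EFinP.
have [iw _] := Rintegral_expN_abs e0.
set Q := cosine_transform psi.
have mQ : measurable_fun setT Q.
  by apply: continuous_measurable_fun; exact: continuous_cosine_transform.
have QM x := cosine_transform_bound ipsi x.
have i1 : leb.-integrable setT (EFin \o (fun x => expN_abs e x * Q x)).
  exact: integrable_mul_bounded iw mQ QM.
have mcos1 : measurable_fun setT (fun z : R * R => cos (z.1 * z.2)).
  exact: measurable_cos_prod.
have mcos2 : measurable_fun setT (fun z : R * R => cos (z.2 * z.1)).
  exact: measurable_cos_prod.
have ic u : leb.-integrable setT (EFin \o (fun x => expN_abs e x * cos (u * x))).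
  apply: (integrable_mul_bounded (M := 1)) iw (measurable_cosM u) _.
  by move=> x; exact: cos_norm_le1.
pose K s t := cauchy_kernel e (t - s) + cauchy_kernel e (t + s).
have K0 s t : 0 <= K s t by rewrite addr_ge0 ?cauchy_kernel_ge0.
have KC s t : K s t = K t s by rewrite /K -cauchy_kernelN opprB [t + s]addrC.
(* The two factors [Q] are expanded one after the other. In each exchange the function of [x] left
   over is an integrable weight: first the exponential times the bounded [Q], then the exponential
   times a cosine. *)
have E1 : \int[leb]_x (expN_abs e x * Q x ^+ 2) =
    \int[leb]_s (psi s * \int[leb]_t (psi t * K s t)).
  transitivity (\int[leb]_x ((expN_abs e x * Q x) *
     \int[leb]_s (psi s * cos (s * x)))).
    by apply: eq_Rintegral => x _; rewrite expr2 mulrA.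
  etransitivity; first exact: (Rfubini_bounded i1 ipsi mcos2 (fun=> cos_norm_le1 _)).
  apply: eq_Rintegral => s _ /=; congr (_ * _).
  transitivity (\int[leb]_x ((expN_abs e x * cos (s * x)) *
     \int[leb]_t (psi t * cos (t * x)))).
    by apply: eq_Rintegral => x _; rewrite mulrAC.
  etransitivity; first exact: (Rfubini_bounded (ic s) ipsi mcos2 (fun=> cos_norm_le1 _)).
  by apply: eq_Rintegral => t _; rewrite Rintegral_weighted_cos_cos.
have mck : measurable_fun setT (cauchy_kernel e).
  apply: continuous_measurable_fun => x.
  have := @continuous_cauchy_kernel R e 0 e0 x.
  by under [X in {for _, continuous X} -> _]eq_fun do rewrite subr0.
have mKs s : measurable_fun setT (K s).
  apply: measurable_funD; apply: (measurableT_comp mck).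
    exact: measurable_funB.
  exact: measurable_funD.
pose Kz (z : R * R) := K z.1 z.2.
have mK : measurable_fun setT Kz.
  apply: measurable_funD; apply: (measurableT_comp mck).
    exact: measurable_funB.
  exact: measurable_funD.
have KM z : `|Kz z| <= 2 * e^-1.
  rewrite ger0_norm ?K0// /Kz/K (_ : 2 * e^-1 = e^-1 + e^-1); last by field; rewrite gt_eqF.
  by rewrite lerD// cauchy_kernel_le.
have iF := integrable_mul_bounded (integrable_prod ipsi ipsi) mK KM.
have E2 : (\int[leb]_s (psi s * \int[leb]_t (psi t * K s t)) %:E =
    \int[leb \x leb]_z (psi z.1 * psi z.2 * Kz z)%:E)%E.
  rewrite -[RHS](integral12_prod_meas1 iF); apply: eq_integral => s _.
  have iKs := integrable_mul_bounded ipsi (mKs s) (fun t => KM (s, t)).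
  rewrite EFinM fineK; last exact: (integrable_fin_num measurableT iKs).
  rewrite -integralZl//; apply: eq_integral => t _.
  by rewrite -EFinM/= mulrA.
have iQ : leb.-integrable setT (EFin \o (fun x => expN_abs e x * Q x ^+ 2)).
  under [X in EFin \o X]eq_fun do rewrite expr2 mulrA.
  exact: integrable_mul_bounded i1 mQ QM.
have -> : (\int[leb]_x (expN_abs e x * Q x ^+ 2)%:E =
    \int[leb \x leb]_z (psi z.1 * psi z.2 * Kz z)%:E)%E.
  rewrite -E2 -[LHS]fineK; last exact: (integrable_fin_num measurableT iQ).
  rewrite -[RHS]fineK; first by congr _%:E.
  by rewrite E2; exact: (integrable_fin_num _ iF).
have mpsi1 : measurable_fun setT (fun z : R * R => psi z.1 ^+ 2 * Kz z).
  by apply: measurable_funM => //; apply: measurable_funX; exact: measurableT_comp.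
have mpsi2 : measurable_fun setT (fun z : R * R => psi z.2 ^+ 2 * Kz z).
  by apply: measurable_funM => //; apply: measurable_funX; exact: measurableT_comp.
apply: (@le_trans _ _ (\int[leb \x leb]_z
   ((2^-1)%:E * (psi z.1 ^+ 2 * Kz z)%:E + (2^-1)%:E * (psi z.2 ^+ 2 * Kz z)%:E))%E).
  apply: le_trans (lee_abs _) _.
  apply: le_trans (le_abse_integral _ measurableT _) _.
    by case/integrableP : iF.
  apply: ge0_le_integral => //.
  - by apply: measurableT_comp => //; case/integrableP : iF.
  - by apply: emeasurable_funD; apply: measurable_funeM; exact/measurable_EFinP.
  move=> z _ /=; rewrite -!EFinM -EFinD lee_fin normrM (ger0_norm (K0 _ _)).
  rewrite !mulrA -mulrDl ler_wpM2r ?K0// normrM.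
  have := sqr_ge0 (`|psi z.1| - `|psi z.2|).
  rewrite sqrrB !real_normK ?num_real//; lra.
have sq0 z (p : R -> R) (w : R): (0 <= (p w ^+ 2 * Kz z)%:E)%E.
  by rewrite lee_fin mulr_ge0 ?sqr_ge0 ?K0.
have mf1 : measurable_fun setT (fun z : R * R => (psi z.1 ^+ 2 * Kz z)%:E).
  exact/measurable_EFinP.
have mf2 : measurable_fun setT (fun z : R * R => (psi z.2 ^+ 2 * Kz z)%:E).
  exact/measurable_EFinP.
have I0 : (\int[leb]_s \int[leb]_t (psi s ^+ 2 * K s t)%:E =
    (2 * pi)%:E * \int[leb]_s (psi s ^+ 2)%:E)%E.
  rewrite -ge0_integralZl//.
  - apply: eq_integral => s _; under eq_integral do rewrite EFinM /=.
    rewrite ge0_integralZl//.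
    + by rewrite integral_cauchy_kernels// muleC.
    + by apply/measurable_EFinP; exact: mKs.
    + by move=> t _; rewrite lee_fin K0.
    + by rewrite lee_fin sqr_ge0.
  - by apply/measurable_EFinP; apply: measurable_funX.
  - by move=> s _; rewrite lee_fin sqr_ge0.
  - by rewrite lee_fin mulr_ge0 ?pi_ge0.
have I1 : (\int[leb \x leb]_z (psi z.1 ^+ 2 * Kz z)%:E =
    (2 * pi)%:E * \int[leb]_s (psi s ^+ 2)%:E)%E.
  rewrite -I0; apply: (@fubini_tonelli1 _ _ _ _ R leb leb _ mf1).
  by move=> z; exact: sq0.
have I2 : (\int[leb \x leb]_z (psi z.2 ^+ 2 * Kz z)%:E =
    (2 * pi)%:E * \int[leb]_s (psi s ^+ 2)%:E)%E.
  rewrite -I0; etransitivity.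
    by apply: (@fubini_tonelli2 _ _ _ _ R leb leb _ mf2) => z; exact: sq0.
  apply: eq_integral => s _; apply: eq_integral => t _.
  by rewrite /= /Kz KC.
rewrite ge0_integralD//=; last 4 first.
- by move=> z _; rewrite mule_ge0 ?sq0 ?lee_fin ?invr_ge0.
- exact: measurable_funeM.
- by move=> z _; rewrite mule_ge0 ?sq0 ?lee_fin ?invr_ge0.
- exact: measurable_funeM.
rewrite ge0_integralZl ?lee_fin ?invr_ge0//.
rewrite ge0_integralZl ?lee_fin ?invr_ge0//.
rewrite I1 I2 -ge0_muleDl ?lee_fin ?invr_ge0// -EFinD.
by rewrite (_ : 2^-1 + 2^-1 = 1) ?mul1e//; lra.
Qed.

(** The weight tends to 1 as [e] tends to 0, and Fatou's lemma preserves this direction of the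
    inequality, which is the one that a risk bound calls for. *)
Lemma L2_cosine_transform (psi : R -> R) M :
  leb.-integrable setT (EFin \o psi) -> (forall s, `|psi s| <= M) ->
  (\int[leb]_x (cosine_transform psi x ^+ 2)%:E
   <= (2 * pi)%:E * \int[leb]_s (psi s ^+ 2)%:E)%E.
Proof.
move=> ipsi psiM.
apply: (@fatou_bound _ _ _ leb
  (fun n x => (expN_abs n.+1%:R^-1 x * cosine_transform psi x ^+ 2)%:E)).
- move=> n; apply/measurable_EFinP; apply: measurable_funM.
    apply: continuous_measurable_fun; exact: continuous_expN_abs.
  apply: measurable_funX; apply: continuous_measurable_fun.
  exact: continuous_cosine_transform.
- by move=> n x; rewrite lee_fin mulr_ge0 ?sqr_ge0// ltW// expN_abs_gt0.
- move=> x; apply: cvg_EFin; first by near=> n.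
  rewrite -[X in _ --> X]mul1r; apply: cvgMl.
  rewrite -[X in _ --> X]expR0 /expN_abs.
  have h : - (n.+1%:R^-1 * `|x|) @[n --> \oo] --> (0 : R).
    rewrite -[X in _ --> X]oppr0 -(mul0r `|x|).
    by apply: cvgN; apply: cvgMl; exact: cvg_harmonic.
  exact: (cvg_comp _ _ h (@continuous_expR R 0)).
- by move=> n; apply: weighted_L2_cosine_transform psiM.
Unshelve. all: by end_near. Qed.

End plancherel.

Lemma Rdominated_convergence d (T : measurableType d) (R : realType)
    (mu : {measure set T -> \bar R}) (f_ : (T -> R)^nat) (f g : T -> R) :
  (forall n, measurable_fun setT (f_ n)) -> measurable_fun setT f ->
  {ae mu, forall x, f_ n x @[n --> \oo] --> f x} ->
  mu.-integrable setT (EFin \o g) -> (forall n x, `|f_ n x| <= g x) ->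
  \int[mu]_x f_ n x @[n --> \oo] --> \int[mu]_x f x.
Proof.
move=> mf_ mf ff ig fg.
have [] := @dominated_convergence _ _ _ mu setT measurableT
  (fun n => EFin \o f_ n) (EFin \o f) (EFin \o g).
- by move=> n; apply/measurable_EFinP.
- exact/measurable_EFinP.
- apply: filterS ff => x h _; apply: cvg_EFin => //.
  by apply: nearW.
- exact: ig.
- by apply: aeW => x n _ /=; rewrite lee_fin.
move=> fi _; move: (integrable_fin_num measurableT fi) => fin.
rewrite -[X in _ --> X -> _]fineK// => /fine_cvgP[_].
by apply.
Qed.

Lemma integrable_subr d (T : measurableType d) (R : realType)
    (mu : {measure set T -> \bar R}) (D : set T) (f g : T -> R) : measurable D ->
  mu.-integrable D (EFin \o f) -> mu.-integrable D (EFin \o g) ->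
  mu.-integrable D (EFin \o (fun x => f x - g x)).
Proof. by move=> mD fi gi; have := integrableB mD fi gi. Qed.

(** * Fourier inversion for a density with integrable, real characteristic function *)

Section inversion.
Context {R : realType}.
Local Notation leb := (@lebesgue_measure R).
Implicit Types (e s t u M a b c : R).

Lemma cvg_atan_mulrn c : c != 0 ->
  atan (c * n.+1%:R) @[n --> \oo] --> (if 0 < c then pi / 2 else - (pi / 2) : R).
Proof.
have pos (r : R) : 0 < r -> atan (r * n.+1%:R) @[n --> \oo] --> (pi / 2 : R).
  move=> r0; have h : r * n.+1%:R @[n --> \oo] --> +oo.
    apply/cvgryPge => A; near=> n; rewrite mulrC -ler_pdivrMr//.
    by rewrite (@le_trans _ _ n%:R) ?ler_nat//; near: n; exact: nbhs_infty_ger.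
  exact: (cvg_comp _ _ h (@cvgy_atan R)).
move=> c0; case: ltP => [/pos//|c_le0].
have Nc : 0 < - c by rewrite oppr_gt0 lt_neqAle c0.
rewrite (_ : (fun n : nat => _) = (fun n => - atan (- c * n.+1%:R))).
  by apply: cvgN; exact: pos.
by apply/funext => n /=; rewrite mulNr atanN /= opprK.
Unshelve. all: by end_near. Qed.

Lemma cvg_expN_abs s : expN_abs n.+1%:R^-1 s @[n --> \oo] --> (1 : R).
Proof.
rewrite -[X in _ --> X]expR0 /expN_abs.
have h : - (n.+1%:R^-1 * `|s|) @[n --> \oo] --> (0 : R).
  rewrite -[X in _ --> X]oppr0 -(mul0r `|s|).
  by apply: cvgN; apply: cvgMl; exact: cvg_harmonic.
exact: (cvg_comp _ _ h (@continuous_expR R 0)).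
Qed.

Section fixed_function.
Variables (f : R -> R).
Hypotheses (f_int : leb.-integrable setT (EFin \o f)) (f_ge0 : forall x, 0 <= f x).
Hypothesis f_sin : forall s, \int[leb]_x (f x * sin (x * s)) = 0.

Let phi := cosine_transform f.
Hypothesis phi_int : leb.-integrable setT (EFin \o phi).

Let mf : measurable_fun setT f.
Proof. by case/integrableP : f_int => /measurable_EFinP. Qed.

(** The addition formula leaves a cosine term and a sine term; the latter vanishes because the
    Fourier transform is real. *)
Lemma cosine_transform_shift s x :
  \int[leb]_y (f y * cos (s * (x - y))) = phi s * cos (s * x).
Proof.
have is1 : leb.-integrable setT (EFin \o (fun y => f y * sin (y * s))).
  apply: (integrable_mul_bounded (M := 1)) f_int _ _.
    by under eq_fun do rewrite mulrC; exact: measurable_sinM.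
  by move=> y; exact: sin_norm_le1.
transitivity (\int[leb]_y (cos (s * x) * (f y * cos (y * s)) +
                           sin (s * x) * (f y * sin (y * s)))).
  by apply: eq_Rintegral => y _; rewrite mulrBr cosB (mulrC s y); ring.
have ic1 := integrable_cosine_transform f_int s.
rewrite RintegralD//; last 2 first.
  exact: (integrableZl measurableT _ ic1).
  exact: (integrableZl measurableT _ is1).
by rewrite !RintegralZl// f_sin mulr0 addr0 mulrC.
Qed.

(** Damping by [exp(-e|s|)] makes all the exchanges legitimate and turns inversion into convolution
    of [f] with the Cauchy kernel. Integrated over [[a, b]], that kernel is a difference of
    arctangents, which approximates [pi] times the indicator of [[a, b]]. *)
Lemma smoothed_inversion e a b : 0 < e -> a < b ->
  \int[leb]_s (phi s * (expN_abs e s * cosine_transform \1_(`[a, b]) s)) =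
  \int[leb]_y (f y * (2 * (atan ((b - y) / e) - atan ((a - y) / e)))).
Proof.
move=> e0 ab.
have [iw _] := Rintegral_expN_abs e0.
have ii : leb.-integrable setT (EFin \o (\1_(`[a, b]) : R -> R)).
  by apply: integrable_indic_itv.
have wM s : `|expN_abs e s| <= 1.
  by rewrite ger0_norm ?expN_abs_le1// ltW// expN_abs_gt0.
have mw : measurable_fun setT (expN_abs e).
  by apply: continuous_measurable_fun; exact: continuous_expN_abs.
have iwphi : leb.-integrable setT (EFin \o (fun s => phi s * expN_abs e s)).
  exact: integrable_mul_bounded phi_int mw wM.
have mcos1 : measurable_fun setT (fun z : R * R => cos (z.2 * z.1)).
  exact: measurable_cos_prod.
transitivity (\int[leb]_s ((phi s * expN_abs e s) *
    \int[leb]_x (\1_(`[a, b]) x * cos (x * s)))).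
  by apply: eq_Rintegral => s _; rewrite mulrA.
etransitivity; first exact: (Rfubini_bounded iwphi ii mcos1 (fun=> cos_norm_le1 _)).
transitivity (\int[leb]_x (\1_(`[a, b]) x *
   \int[leb]_y (f y * (2 * cauchy_kernel e (x - y))))).
  apply: eq_Rintegral => x _ /=; congr (_ * _).
  transitivity (\int[leb]_s (expN_abs e s * \int[leb]_y (f y * cos (s * (x - y))))).
    by apply: eq_Rintegral => s _; rewrite cosine_transform_shift /= (mulrC x s); ring.
  have mc : measurable_fun setT (fun z : R * R => cos (z.1 * (x - z.2))).
    apply: measurable_cos_prod => //; exact: measurable_funB.
  etransitivity; first exact: (Rfubini_bounded iw f_int mc (fun=> cos_norm_le1 _)).
  apply: eq_Rintegral => y _ /=; congr (_ * _).
  rewrite -Rintegral_expN_cos//; apply: eq_Rintegral => s _.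
  by rewrite mulrC [s * _]mulrC mulrC.
have mck : measurable_fun setT (cauchy_kernel e).
  apply: continuous_measurable_fun => x.
  have := @continuous_cauchy_kernel R e 0 e0 x.
  by under [X in {for _, continuous X} -> _]eq_fun do rewrite subr0.
have mk : measurable_fun setT (fun z : R * R => 2 * cauchy_kernel e (z.1 - z.2)).
  apply: measurable_funM => //; apply: (measurableT_comp mck).
  exact: measurable_funB.
have kM z : `|2 * cauchy_kernel e (z.1 - z.2 : R)| <= 2 * e^-1.
  rewrite ger0_norm; last by rewrite mulr_ge0// cauchy_kernel_ge0.
  by rewrite ler_pM2l// cauchy_kernel_le.
etransitivity; first exact: (Rfubini_bounded ii f_int mk kM).
apply: eq_Rintegral => y _ /=; congr (_ * _).
rewrite /Rintegral; transitivity (fine (\int[leb]_(x in `[a, b]) (2 * cauchy_kernel e (x - y))%:E)%E).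
  congr fine; rewrite [RHS]integral_mkcond; apply: eq_integral => x _.
  rewrite patchE indicE; case: ifP => _ /=; by rewrite ?mul1r ?mul0r.
have dF x : is_derive x (1 : R) (fun x => 2 * atan ((x - y) / e)) (2 * cauchy_kernel e (x - y)).
  have dk : is_derive x (1 : R) (fun x => atan ((x - y) / e)) (cauchy_kernel e (x - y)).
    exact: is_derive_atan_kernel.
  by apply: is_derive_eq; rewrite /GRing.scale/= ?mulr0 ?addr0.
have -> := FTC2 ab dF.
  by rewrite /= mulrBr.
move=> x; apply: (@continuousM _ _ (cst 2) (fun x => cauchy_kernel e (x - y))).
  exact: cst_continuous.
exact: continuous_cauchy_kernel.
Qed.

(** Let [e] tend to 0 in [smoothed_inversion]. The left side is dominated by a multiple of [|phi|],
    the right side by [2 pi f], and the two limits must agree. *)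
Lemma interval_inversion a b : a < b ->
  \int[leb]_(x in `[a, b]) cosine_transform phi x = 2 * pi * \int[leb]_(x in `[a, b]) f x.
Proof.
move=> ab; pose ind : R -> R := \1_(`[a, b]).
have ii : leb.-integrable setT (EFin \o ind) by apply: integrable_indic_itv.
have mphi : measurable_fun setT phi by case/integrableP : phi_int => /measurable_EFinP.
have mct : measurable_fun setT (cosine_transform ind).
  by apply: continuous_measurable_fun; exact: continuous_cosine_transform.
have mcos1 : measurable_fun setT (fun z : R * R => cos (z.2 * z.1)).
  exact: measurable_cos_prod.
pose e n : R := n.+1%:R^-1.
have lim1 : \int[leb]_s (phi s * (expN_abs (e n) s * cosine_transform ind s))
    @[n --> \oo] --> \int[leb]_s (phi s * cosine_transform ind s).
  apply: (Rdominated_convergence (mu := leb)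
    (f_ := fun n s => phi s * (expN_abs (e n) s * cosine_transform ind s))
    (f := fun s => phi s * cosine_transform ind s)
    (g := fun s => `|phi s| * (\int[leb]_x `|ind x|))).
  - move=> n; apply: measurable_funM => //; apply: measurable_funM => //.
    by apply: continuous_measurable_fun; exact: continuous_expN_abs.
  - exact: measurable_funM.
  - apply: aeW => s; apply: cvgMr.
    rewrite -[X in _ --> X]mul1r; apply: cvgMl; exact: cvg_expN_abs.
  - have := integrableZr measurableT (\int[leb]_x `|ind x|) (integrable_norm phi_int).
    by [].
  - move=> n s; rewrite normrM ler_wpM2l// normrM.
    rewrite -[X in _ <= X]mul1r ler_pM//.
      rewrite ger0_norm; last by rewrite ltW// expN_abs_gt0.
      by rewrite expN_abs_le1// invr_gt0.
    exact: cosine_transform_bound.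

have lim2 : \int[leb]_y (f y * (2 * (atan ((b - y) / e n) - atan ((a - y) / e n))))
    @[n --> \oo] --> \int[leb]_y (f y * (2 * pi * \1_(`[a, b]) y)).
  apply: (Rdominated_convergence (mu := leb)
    (f_ := fun n y => f y * (2 * (atan ((b - y) / e n) - atan ((a - y) / e n))))
    (f := fun y => f y * (2 * pi * \1_(`[a, b]) y))
    (g := fun y => f y * (2 * pi))).
  - move=> n; apply: measurable_funM => //; apply: measurable_funM => //.
    have mat c : measurable_fun setT (fun y : R => atan ((c - y) / e n)).
      by apply: continuous_measurable_fun => x; apply: is_derive_continuous.
    exact: (measurable_funB (mat b) (mat a)).
  - apply: measurable_funM => //; apply: measurable_funM => //.
  (* At an endpoint one of the arctangents is constantly 0, and the limit is half of the desired
     value; these two points form a null set. *)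
  - exists [set a; b]; split.
    + exact: measurableU.
    + by apply: countable_lebesgue_measure0; exact: finite_set_countable.
    move=> y /=; apply: contra_notP => /not_orP[/eqP ya /eqP yb].
    apply: cvgMr; rewrite indicE.
    have cvg_at c : y != c -> atan ((c - y) / e n) @[n --> \oo] -->
        (if 0 < c - y then pi / 2 else - (pi / 2) : R).
      rewrite eq_sym -subr_eq0 => h; have := cvg_atan_mulrn h.
      by under [X in X @ _ --> _ -> _]eq_fun do rewrite -[_.+1%:R]invrK.
    suff -> : 2 * pi * (y \in `[a, b]%classic)%:R =
      2 * ((if 0 < b - y then pi / 2 else - (pi / 2)) -
           (if 0 < a - y then pi / 2 else - (pi / 2))) :> R.
      by apply: cvgMr; apply: cvgB; exact: cvg_at.
    rewrite !subr_gt0.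
    case: ifP => yb'; case: ifP => ya' /=.
    + rewrite memNset /=; first by rewrite subrr !mulr0.
      by rewrite in_itv/= (leNgt a y) ya'.
    + rewrite mem_set /=; first by field.
      by rewrite in_itv/= (ltW yb') leNgt ya'.
    + by move/negbT: yb'; rewrite -leNgt => yb'; have := lt_trans (le_lt_trans yb' ya') ab; rewrite ltxx.
    + rewrite memNset /=; first by rewrite opprK addNr mulr0 mulr0.
      rewrite in_itv/= => /andP[_ h]; move/negbT: yb'; rewrite -leNgt => h2.
      by move: yb; rewrite eq_le h h2.
  - have := integrableZr measurableT (2 * pi) f_int.
    by [].
  - move=> n y; rewrite normrM ger0_norm// ler_wpM2l// normrM ger0_norm// ler_pM2l//.
    have h (z : R) := (atan_gtNpi2 z, atan_ltpi2 z).
    rewrite ler_norml.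
    have [h1 h2] := h ((b - y) / e n); have [h3 h4] := h ((a - y) / e n).
    by lra.
have E n : \int[leb]_s (phi s * (expN_abs (e n) s * cosine_transform ind s)) =
   \int[leb]_y (f y * (2 * (atan ((b - y) / e n) - atan ((a - y) / e n)))).
  by apply: smoothed_inversion; rewrite // invr_gt0.
have := lim2; under eq_fun do rewrite -E.
move=> /(cvg_unique (@Rhausdorff R) lim1) H.
transitivity (\int[leb]_x (ind x * cosine_transform phi x)).
  rewrite [LHS]Rintegral_mkcond; apply: eq_Rintegral => x _.
  by rewrite patchE /ind indicE; case: ifP => _ /=; rewrite ?mul1r ?mul0r.
etransitivity; first exact: (Rfubini_bounded ii phi_int mcos1 (fun=> cos_norm_le1 _)).
transitivity (\int[leb]_s (phi s * cosine_transform ind s)).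
  apply: eq_Rintegral => s _; congr (_ * _); apply: eq_Rintegral => x _.
  by rewrite /= (mulrC s x).
rewrite H -RintegralZl//; last exact: integrableS f_int.
rewrite [RHS]Rintegral_mkcond; apply: eq_Rintegral => y _.
by rewrite patchE indicE; case: ifP => _ /=; rewrite ?mulr1 ?mulr0// mulrC.
Qed.

(* Both sides have the same integral over every bounded interval. *)
Lemma fourier_inversion : {ae leb, forall x, f x = (2 * pi)^-1 * cosine_transform phi x}.
Proof.
pose g x := cosine_transform phi x - 2 * pi * f x.
have cct := continuous_cosine_transform phi_int.
have mct : measurable_fun setT (cosine_transform phi) by exact: continuous_measurable_fun.
have locf : locally_integrable setT (fun x => 2 * pi * f x).
  apply: open_integrable_locally; first exact: openT.
  exact: (integrableZl measurableT (2 * pi) f_int).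
have locct : locally_integrable setT (cosine_transform phi).
  split => //; first exact: openT.
  move=> K _ cK; have mK := compact_measurable cK.
  apply: (@le_lt_trans _ _ (\int[leb]_(x in K) (\int[leb]_s `|phi s|)%:E)%E).
    apply: ge0_le_integral => //.
    - by apply/measurable_EFinP; apply: measurableT_comp => //; exact: measurable_funS mct.
    - by move=> x _; rewrite lee_fin cosine_transform_bound.
  rewrite integral_cst// lte_mul_pinfty ?lee_fin ?Rintegral_ge0//.
  exact: compact_finite_measure.
have locg := locally_integrableB locct locf.
have ictitv (k y : R) : leb.-integrable `[k, y] (EFin \o cosine_transform phi).
  apply: continuous_compact_integrable; first exact: segment_compact.
  exact: continuous_subspaceT.
have ifitv (k y : R) : leb.-integrable `[k, y] (EFin \o f).
  by apply: integrableS f_int.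
have ifZitv (k y : R) : leb.-integrable `[k, y] (EFin \o (fun x => 2 * pi * f x)).
  by apply: integrableS (integrableZl measurableT (2 * pi) f_int).
have igitv (k y : R) : leb.-integrable `[k, y] (EFin \o g).
  exact: (integrable_subr _ (ictitv k y) (ifZitv k y)).
have G0 (k y : R) : \int[leb]_(x in `[k, y]) g x = 0.
  have [yk|ky|->] := ltgtP y k.
  - by rewrite set_itv_ge ?Rintegral_set0// bnd_simp -ltNge.
  - by rewrite RintegralB// RintegralZl// interval_inversion// subrr.
  - by rewrite set_itv1 Rintegral_set1.
(* Differentiating the integral of [g] needs a fixed left end. The ends [- k] cover the line, at the
   cost of a countable union of null sets. *)
have H (k : nat) : {ae leb, forall x, - k%:R < x -> g x = 0}.
  have := FTC1 (fun y => igitv (- k%:R) y) locg.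
  apply: filterS; first exact: (ae_filter_ringOfSetsType leb).
  move=> x h kx; have [|_ <-] := h.
  by rewrite lte_fin.
  rewrite (_ : (fun x => _) = cst 0); last by apply/funext => y; exact: G0.
  by rewrite derive1_cst.
have : {ae leb, forall x, forall k : nat, - k%:R < x -> g x = 0} by exact: ae_foralln.
apply: filterS; first exact: (ae_filter_ringOfSetsType leb).
move=> x h.
have : g x = 0.
  apply: (h (Num.truncn `|x|).+1).
  rewrite ltrNl (le_lt_trans (ler_norm _))// normrN.
  by rewrite truncnS_gt.
move/eqP; rewrite subr_eq0 => /eqP ->.
by rewrite mulrA mulVf ?mul1r// mulf_neq0// gt_eqF// pi_gt0.
Qed.

End fixed_function.
End inversion.

(** * From the error in L2 to an integral over frequencies *)

Section risk.
Context {R : realType}.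
Local Notation leb := (@lebesgue_measure R).
Implicit Types (f : R -> R) (g y : nat -> R) (n : nat) (s x xi h : R).

Lemma integralT_opp (F : R -> \bar R) : measurable_fun setT F -> (forall x, 0 <= F x)%E ->
  (\int[leb]_x F (- x)%R = \int[leb]_x F x)%E.
Proof.
move=> mF F0; have mN : measurable_fun setT (-%R : R -> measurableTypeR R) by [].
transitivity (\int[pushforward leb (-%R : _ -> measurableTypeR R)]_x F x)%E.
  by rewrite ge0_integral_pushforward//= preimage_setT.
by apply: eq_measure_integral => A mA _; exact: lebesgue_measureN.
Qed.

(** No integrability is assumed: reflection equates the integrals of the positive and negative
    parts, and if both are infinite then [fine] sends their difference to 0. *)
Lemma Rintegral_odd f : measurable_fun setT f -> (forall x, f (- x) = - f x) ->
  \int[leb]_x f x = 0.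
Proof.
move=> mf fN; rewrite /Rintegral integralE.
have -> : (\int[leb]_x ((EFin \o f)^\- x) = \int[leb]_x ((EFin \o f)^\+ x))%E.
  rewrite -[RHS]integralT_opp//.
    apply: eq_integral => x _; rewrite funeposE funenegE /= fN.
    by rewrite EFinN.
  by apply: measurable_funepos; exact/measurable_EFinP.
case: (\int[leb]_x _)%E => //= r; by rewrite subrr.
Qed.

Lemma sqre_poweR (X : \bar R) : (0 <= X -> X ^+ 2 = X `^ 2)%E.
Proof.
case: X => [r||]//.
  by rewrite lee_fin => r0; rewrite poweR_EFin powR_mulrn// -EFin_expe.
by rewrite poweRyr// expe2 mulyy.
Qed.

Lemma L2norm_sqr (F : R -> R[i]) :
  (L2norm F ^+ 2 = \int[leb]_x (cabs (F x) ^+ 2)%:E)%E.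
Proof.
rewrite sqre_poweR ?Lnorm_ge0// /L2norm poweR_Lnorm//.
apply: eq_integral => x _ /=; rewrite powR_mulrn//.
by rewrite real_normK ?num_real.
Qed.

Lemma cabs_sqr (z : R[i]) : cabs z ^+ 2 = complex.Re z ^+ 2 + complex.Im z ^+ 2.
Proof. by rewrite /cabs normc_def /= sqr_sqrtr// addr_ge0 ?sqr_ge0. Qed.

Lemma measurable_fourier_hat g n xi y : measurable_fun setT (fourier_hat g n xi y).
Proof.
apply: measurableT_comp.
  by apply: continuous_measurable_fun; exact: sqrt_continuous.
apply: measurableT_comp => //; apply: measurable_funM => //.
rewrite (_ : (fun s => _) = (fun s => \sum_(j < n.+1) \sum_(l < n.+1)
    (if neighbour g xi j l then cos ((y l - y j) * s) else 0))).
  apply: measurable_sum => j; apply: measurable_sum => l.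
  by case: (neighbour g xi j l); [exact: measurable_cosM|exact: measurable_cst].
apply/funext => s; apply: eq_bigr => j _; rewrite big_mkcond.
by apply: eq_bigr => l _; rewrite mulrC.
Qed.

Lemma nb_pairs_sum g n xi : (nb_pairs g n xi)%:R =
  \sum_(j < n.+1) \sum_(l < n.+1 | neighbour g xi j l) (1 : R).
Proof.
rewrite /nb_pairs natr_sum; apply: eq_bigr => j _.
by rewrite /nb_neighbours -sum1_card natr_sum.
Qed.

Lemma fourier_hat_ge0 g n xi y s : 0 <= fourier_hat g n xi y s.
Proof. exact: sqrtr_ge0. Qed.

Lemma fourier_hat_le1 g n xi y s : fourier_hat g n xi y s <= 1.
Proof.
rewrite /fourier_hat -[X in _ <= X]sqrtr1; apply: ler_wsqrtr.
rewrite normrM ger0_norm ?invr_ge0//.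
(* Without pairs the normalizing factor is the inverse of 0, which is 0. *)
have [->|N0] := eqVneq (nb_pairs g n xi) 0%N; first by rewrite invr0 mul0r.
rewrite ler_pdivrMl ?ltr0n ?lt0n// mulr1 nb_pairs_sum.
apply: le_trans (ler_norm_sum _ _ _) _; apply: ler_sum => j _.
apply: le_trans (ler_norm_sum _ _ _) _; apply: ler_sum => l _.
exact: cos_norm_le1.
Qed.

Lemma fourier_hatN g n xi y s : fourier_hat g n xi y (- s) = fourier_hat g n xi y s.
Proof.
rewrite /fourier_hat; congr (Num.sqrt `|_ * _|).
by apply: eq_bigr => j _; apply: eq_bigr => l _; rewrite mulNr cosN.
Qed.

Definition truncated_fourier_hat g n xi h y s : R :=
  fourier_hat g n xi y s * sinc_kernel_fourier (s * h).

Lemma integrable_truncated_fourier_hat g n xi h y : 0 < h ->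
  leb.-integrable setT (EFin \o truncated_fourier_hat g n xi h y).
Proof.
move=> h0.
have ii : leb.-integrable setT (EFin \o (\1_(`[- h^-1, h^-1]) : R -> R)).
  by apply: integrable_indic_itv.
have := integrable_mul_bounded (M := 1) ii (measurable_fourier_hat g n xi y) _.
rewrite (_ : (fun x => _) = truncated_fourier_hat g n xi h y).
  by apply => s; rewrite ger0_norm ?fourier_hat_le1 ?fourier_hat_ge0.
apply/funext => s; rewrite /truncated_fourier_hat mulrC /sinc_kernel_fourier indicE.
congr (_ * _%:R); rewrite normrM (gtr0_norm h0) -ler_pdivlMr// div1r ler_norml.
congr (nat_of_bool _).
by apply/idP/idP => [/set_mem|hs]; [|apply/mem_set]; rewrite /= in_itv.
Qed.

(** The truncated estimate is even in [s], hence the sine part of the integrand is odd and the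
    estimator, although complex by definition, is real. *)
Lemma density_hatE g n xi h y x : 0 < h ->
  density_hat g n xi h y x =
  ((2 * pi)^-1 * cosine_transform (truncated_fourier_hat g n xi h y) x)%:C%C.
Proof.
move=> h0; rewrite /density_hat /cintegral.
set v := truncated_fourier_hat g n xi h y.
have mv : measurable_fun setT v.
  by case/integrableP : (@integrable_truncated_fourier_hat g n xi h y h0) => /measurable_EFinP.
have vN s : v (- s) = v s.
  by rewrite /v/truncated_fourier_hat fourier_hatN /sinc_kernel_fourier mulNr normrN.
have -> : \int[leb]_s complex.Im (expi (- (s * x)) *
   (fourier_hat g n xi y s * sinc_kernel_fourier (s * h))%:C%C) = 0.
  transitivity (\int[leb]_s (v s * sin (- x * s))).
    by apply: eq_Rintegral => s _ /=; rewrite mulr0 add0r mulNr mulrC [x * s]mulrC.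
  apply: Rintegral_odd.
    by apply: measurable_funM => //; exact: measurable_sinM.
  by move=> s /=; rewrite vN mulrN sinN mulrN.
have -> : \int[leb]_s complex.Re (expi (- (s * x)) *
   (fourier_hat g n xi y s * sinc_kernel_fourier (s * h))%:C%C) = cosine_transform v x.
  apply: eq_Rintegral => s _ /=; by rewrite mulr0 subr0 cosN mulrC.
by apply/eqP; rewrite eq_complex /= !mulr0 !mul0r subr0 addr0 !eqxx.
Qed.

Lemma Re_fourier f s : complex.Re (fourier f s) = cosine_transform f s.
Proof. by apply: eq_Rintegral => x _ /=; rewrite mulr0 subr0 mulrC [s * x]mulrC. Qed.

Lemma Im_fourier f s : complex.Im (fourier f s) = \int[leb]_x (f x * sin (x * s)).
Proof. by apply: eq_Rintegral => x _ /=; rewrite mulr0 add0r mulrC [s * x]mulrC. Qed.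

Lemma density_integrable f : density f -> leb.-integrable setT (EFin \o f).
Proof.
case=> mf f0 f1; apply/integrableP; split; first exact/measurable_EFinP.
by under eq_integral do rewrite /= ger0_norm//; rewrite f1 ltry.
Qed.

(** By inversion, almost everywhere the error is [(2 pi)^-1] times the cosine transform of the
    difference of the transforms. The square of this factor meets the [2 pi] of the Plancherel
    inequality. *)
Lemma density_hat_L2_error g n xi h y f : 0 < h -> density f ->
  real_nonvanishing_fourier f ->
  leb.-integrable setT (EFin \o cosine_transform f) ->
  (L2norm (fun x => density_hat g n xi h y x - (f x)%:C%C)%R ^+ 2 <=
   ((2 * pi)^-1)%:E *
   \int[leb]_s ((truncated_fourier_hat g n xi h y s - cosine_transform f s) ^+ 2)%:E)%E.
Proof.
move=> h0 df rf iphi; rewrite L2norm_sqr.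
have fi := density_integrable df.
set v := truncated_fourier_hat g n xi h y; set phi := cosine_transform f.
have iv : leb.-integrable setT (EFin \o v) by exact: integrable_truncated_fourier_hat.
have f_sin s : \int[leb]_x (f x * sin (x * s)) = 0.
  by rewrite -Im_fourier; have [] := rf s.
have ipsi : leb.-integrable setT (EFin \o (fun s => v s - phi s)).
  exact: integrable_subr.
have psiM s : `|v s - phi s| <= 1 + \int[leb]_s `|f s|.
  rewrite (le_trans (ler_normB _ _))// lerD//; last exact: cosine_transform_bound.
  rewrite /v/truncated_fourier_hat normrM ger0_norm ?fourier_hat_ge0//.
  rewrite -[leRHS]mul1r ler_pM ?fourier_hat_ge0 ?fourier_hat_le1//.
  by rewrite /sinc_kernel_fourier normr_nat lern1 leq_b1.
have [mf f0 _] := df.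
have invE := fourier_inversion fi f0 f_sin iphi.
have mct : measurable_fun setT (cosine_transform (fun s => v s - phi s)).
  by apply: continuous_measurable_fun; exact: continuous_cosine_transform.
have mcv : measurable_fun setT (cosine_transform v).
  by apply: continuous_measurable_fun; exact: continuous_cosine_transform.
have ctB x : cosine_transform (fun s => v s - phi s) x =
    cosine_transform v x - cosine_transform phi x.
  rewrite -RintegralB//; first by apply: eq_Rintegral => s _; rewrite mulrBl.
  - exact: integrable_cosine_transform.
  - exact: integrable_cosine_transform.
have cE x : cabs (density_hat g n xi h y x - (f x)%:C%C) ^+ 2 =
    ((2 * pi)^-1 * cosine_transform v x - f x) ^+ 2.
  by rewrite density_hatE// cabs_sqr /= subr0 expr0n addr0.
have pi2 : 0 < 2 * pi :> R by rewrite mulr_gt0// pi_gt0.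
have -> : (\int[leb]_x (cabs (density_hat g n xi h y x - (f x)%:C%C) ^+ 2)%:E =
    \int[leb]_x (((2 * pi)^-1) ^+ 2 * (cosine_transform (fun s => (v s - phi s)%R) x) ^+ 2)%:E)%E.
  under eq_integral do rewrite cE.
  apply: ge0_ae_eq_integral => //.
  - by apply/measurable_EFinP; apply: measurable_funX; apply: measurable_funB => //; exact: measurable_funM.
  - by apply/measurable_EFinP; apply: measurable_funM => //; exact: measurable_funX.
  - by move=> x _; rewrite lee_fin sqr_ge0.
  - by move=> x _; rewrite lee_fin mulr_ge0 ?sqr_ge0.
  - move: invE; apply: filterS; first exact: (ae_filter_ringOfSetsType leb).
    by move=> x -> _; rewrite ctB -exprMn mulrBr.
under eq_integral do rewrite EFinM.
rewrite ge0_integralZl//; last 3 first.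
- by apply/measurable_EFinP; exact: measurable_funX.
- by move=> x _; rewrite lee_fin sqr_ge0.
- by rewrite lee_fin sqr_ge0.
apply: (@le_trans _ _ (((2 * pi)^-1 ^+ 2)%:E * ((2 * pi)%:E *
    \int[leb]_s ((v s - phi s) ^+ 2)%:E))%E).
  rewrite lee_pmul2l//; last by rewrite lte_fin exprn_gt0// invr_gt0.
  exact: L2_cosine_transform psiM.
by rewrite muleA -EFinM expr2 -mulrA mulVf ?mulr1// gt_eqF.
Qed.

End risk.

(** * Independence and second moments of the noise *)

Section transfer.
Context {R : realType} d1 d2 d (T1 : measurableType d1) (T2 : measurableType d2)
  (S : measurableType d).
Variables (mu1 : {measure set T1 -> \bar R}) (mu2 : {measure set T2 -> \bar R}).
Variables (W1 : T1 -> R) (W2 : T2 -> R) (X1 : T1 -> S) (X2 : T2 -> S).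
Hypotheses (mW1 : measurable_fun setT W1) (mW2 : measurable_fun setT W2).
Hypotheses (mX1 : measurable_fun setT X1) (mX2 : measurable_fun setT X2).
Hypotheses (W1_ge0 : forall x, 0 <= W1 x) (W2_ge0 : forall x, 0 <= W2 x).
Hypothesis W12 : forall A, measurable A ->
  (\int[mu1]_x (W1 x * \1_A (X1 x))%:E = \int[mu2]_x (W2 x * \1_A (X2 x))%:E)%E.

Import HBNNSimple.

Lemma weighted_integral_nnsfun d' (T : measurableType d')
    (mu : {measure set T -> \bar R}) (W : T -> R) (X : T -> S) (h : {nnsfun S >-> R}) :
  measurable_fun setT W -> measurable_fun setT X -> (forall x, 0 <= W x) ->
  (\int[mu]_x (W x * h (X x))%:E =
   \sum_(r \in range h) r%:E * \int[mu]_x (W x * \1_(h @^-1` [set r]) (X x))%:E)%E.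
Proof.
move=> mW mX W0.
have mi r : measurable_fun setT (fun x => W x * \1_(h @^-1` [set r]) (X x)).
  apply: measurable_funM => //; apply: (measurableT_comp _ mX).
  exact: measurable_indic.
have hr0 r x : 0 <= r * \1_(h @^-1` [set r]) x.
  rewrite indicE; have [/set_mem /= <-|] := boolP (x \in _).
    by rewrite mulr1.
  by rewrite mulr0.
under eq_integral => x _.
  rewrite fimfunE EFinM -fsumEFin// ge0_mule_fsumr; last first.
    by move=> r; rewrite lee_fin hr0.
  over.
rewrite ge0_integral_fsum//; last 2 first.
- move=> r; under eq_fun do rewrite -EFinM mulrCA.
  by apply/measurable_EFinP; apply: measurable_funM.
- by move=> r x _; rewrite -EFinM lee_fin mulr_ge0.
apply: eq_fsbigr => r /set_mem [s _ <-].
rewrite -ge0_integralZl//.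
- by apply: eq_integral => x _; rewrite -!EFinM mulrCA.
- exact/measurable_EFinP.
- by move=> x _; rewrite lee_fin mulr_ge0.
- by rewrite lee_fin.
Qed.

(** Weighted image measures that agree on sets give the same integrals, by simple functions and
    monotone convergence. With a density as weight this yields the law of a variable; with an
    indicator or another random variable as weight it yields independence. *)
Lemma transfer_ge0 (f : S -> R) : measurable_fun setT f -> (forall x, 0 <= f x) ->
  (\int[mu1]_x (W1 x * f (X1 x))%:E = \int[mu2]_x (W2 x * f (X2 x))%:E)%E.
Proof.
move=> mf f0.
have mfE : measurable_fun setT (EFin \o f) by exact/measurable_EFinP.
pose h := nnsfun_approx measurableT mfE.
have main d' (T : measurableType d') (mu : {measure set T -> \bar R}) (W : T -> R) (X : T -> S) :
    measurable_fun setT W -> measurable_fun setT X -> (forall x, 0 <= W x) ->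
    (\int[mu]_x (W x * h n (X x))%:E)%E @[n --> \oo] --> (\int[mu]_x (W x * f (X x))%:E)%E.
  move=> mW mX W0.
  have lim x : (W x * h n (X x))%:E @[n --> \oo] --> (W x * f (X x))%:E.
    have f0' s : [set: S] s -> (0 <= (EFin \o f) s)%E by rewrite lee_fin.
    have := cvg_nnsfun_approx measurableT mfE f0' (I : setT (X x)).
    move/fine_cvgP => [_] /= hl.
    by apply: cvg_EFin; [exact: nearW|apply: cvgMr].
  have -> : (\int[mu]_x (W x * f (X x))%:E = \int[mu]_x limn (fun n => (W x * h n (X x))%:E))%E.
    by apply: eq_integral => x _; rewrite (cvg_lim _ (lim x)).
  apply: cvg_monotone_convergence => //.
  - by move=> n; apply/measurable_EFinP; apply: measurable_funM => //; exact: measurableT_comp.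
  - by move=> n x _; rewrite lee_fin mulr_ge0.
  - move=> x _ m n mn; rewrite lee_fin ler_wpM2l//.
    by have /lefP := nd_nnsfun_approx measurableT mfE mn; apply.
have := main _ _ mu1 W1 X1 mW1 mX1 W1_ge0.
have := main _ _ mu2 W2 X2 mW2 mX2 W2_ge0.
have -> : (fun n => (\int[mu2]_x (W2 x * h n (X2 x))%:E)%E) =
          (fun n => (\int[mu1]_x (W1 x * h n (X1 x))%:E)%E).
  apply/funext => n; rewrite !weighted_integral_nnsfun//.
  by apply: eq_fsbigr => r _; rewrite W12.
by move=> h1 h2; exact: (cvg_unique _ h2 h1).
Qed.

(** [f] is shifted by its bound [M] to become nonnegative; the shift is subtracted afterwards, since
    the weights are integrable. *)
Lemma transfer_bounded (f : S -> R) M : measurable_fun setT f ->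
  (forall x, `|f x| <= M) ->
  mu1.-integrable setT (EFin \o W1) -> mu2.-integrable setT (EFin \o W2) ->
  \int[mu1]_x (W1 x * f (X1 x)) = \int[mu2]_x (W2 x * f (X2 x)).
Proof.
move=> mf fM i1 i2.
have fM0 x : 0 <= f x + M.
  by have := fM x; rewrite ler_norml => /andP[h _]; rewrite -lerBlDr sub0r.
have mfM : measurable_fun setT (fun x => f x + M) by exact: measurable_funD.
have H := transfer_ge0 mfM fM0.
have H1 := transfer_ge0 (measurable_cst (1 : R)) (fun=> ler01).
have split d' (T : measurableType d') (mu : {measure set T -> \bar R}) (W : T -> R) (X : T -> S) :
    measurable_fun setT X -> mu.-integrable setT (EFin \o W) ->
    fine (\int[mu]_x (W x * (f (X x) + M))%:E)%E =
      \int[mu]_x (W x * f (X x)) + M * fine (\int[mu]_x (W x * 1)%:E)%E.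
  move=> mX iW.
  have iWf : mu.-integrable setT (EFin \o (fun x => W x * f (X x))).
    by apply: integrable_mul_bounded iW _ _ => //; exact: measurableT_comp.
  rewrite -RintegralZl//; last first.
    by apply: eq_integrable iW => // x _ /=; rewrite mulr1.
  rewrite -RintegralD//; last first.
    have := integrableZl measurableT M iW.
    by apply: eq_integrable => // x _ /=; rewrite mulr1.
  by congr fine; apply: eq_integral => x _; rewrite mulr1 mulrDr [W x * M]mulrC.
have := split _ _ mu1 W1 X1 mX1 i1; rewrite H H1 (split _ _ mu2 W2 X2 mX2 i2).
by move/addIr.
Qed.

End transfer.

(** * Expectations of products from independence of events *)

Section independence.
Context {R : realType} d (T : measurableType d) (P : probability T R).
Implicit Types (f g : T -> R).

Lemma bounded_integrable f (M : R) : measurable_fun setT f -> (forall x, `|f x| <= M) ->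
  P.-integrable setT (EFin \o f).
Proof.
move=> mf fM; apply: measurable_bounded_integrable => //.
  by rewrite (le_lt_trans (probability_le1 _ _))// ltry.
exists M; split; first exact: num_real.
by move=> N MN x _ /=; rewrite (le_trans (fM x))// ltW.
Qed.

Lemma Rintegral_indicator (A : set T) : measurable A ->
  \int[P]_x \1_A x = fine (P A).
Proof. by move=> mA; rewrite /Rintegral integral_indic// setIT. Qed.

Lemma Rintegral_prob_cst (c : R) : \int[P]_x c = c.
Proof. by transitivity (c * fine (P setT)); [exact: Rintegral_cst|rewrite probability_setT mulr1]. Qed.

(** Two transfers: with an indicator of [g] as weight to pass from sets to [h], then with [h (f w)]
    as weight to pass from sets to [k]. In the second one the mean of [h (f w)] serves as a constant
    real weight, hence its finiteness; the other factor may have infinite mean. *)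
Lemma indep_mul_ge0 f g (h k : R -> R) :
  measurable_fun setT f -> measurable_fun setT g ->
  (forall A B : set R, measurable A -> measurable B ->
     P ((f @^-1` A) `&` (g @^-1` B)) = (P (f @^-1` A) * P (g @^-1` B))%E) ->
  measurable_fun setT h -> measurable_fun setT k ->
  (forall x, 0 <= h x) -> (forall x, 0 <= k x) ->
  (\int[P]_w (h (f w))%:E < +oo)%E ->
  (\int[P]_w (h (f w) * k (g w))%:E =
   \int[P]_w (h (f w))%:E * \int[P]_w (k (g w))%:E)%E.
Proof.
move=> mf mg ind mh mk h0 k0 hfin.
have mpre (u : T -> R) (A : set R) : measurable_fun setT u -> measurable A -> measurable (u @^-1` A).
  by move=> mu mA; rewrite -[_ @^-1` _]setTI; exact: mu.
have mind (u : T -> R) (A : set R) : measurable_fun setT u -> measurable A ->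
    measurable_fun setT (fun w => \1_A (u w) : R).
  by move=> mu mA; apply: measurableT_comp mu; exact: measurable_indic.
have indE (u : T -> R) (A : set R) : (fun w => \1_A (u w)) = \1_(u @^-1` A) :> (T -> R).
  by apply/funext => w; rewrite !indicE; congr (nat_of_bool _)%:R; apply/idP/idP => /set_mem ?; apply/mem_set.
have intind (u : T -> R) (A : set R) : measurable_fun setT u -> measurable A ->
    (\int[P]_w (\1_A (u w))%:E = P (u @^-1` A))%E.
  move=> mu mA; rewrite -[u @^-1` A]setIT -integral_indic//; last exact: mpre.

have step1 B : measurable B ->
    (\int[P]_w (\1_B (g w) * h (f w))%:E = P (g @^-1` B) * \int[P]_w (h (f w))%:E)%E.
  move=> mB.
  have pfin : P (g @^-1` B) \is a fin_num by rewrite fin_num_measure//; exact: mpre.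
  rewrite -[P (g @^-1` B)]fineK// -ge0_integralZl//; last 3 first.
  - by apply/measurable_EFinP; exact: measurableT_comp.
  - by move=> w _; rewrite lee_fin.
  - by rewrite lee_fin fine_ge0.
  under [RHS]eq_integral do rewrite -EFinM.
  apply: (transfer_ge0 (mu1 := P) (mu2 := P) (W1 := fun w => \1_B (g w))
    (W2 := cst (fine (P (g @^-1` B)))) (X1 := f) (X2 := f)) => //.
  - exact: mind.
  - by move=> w; rewrite /= fine_ge0.
  - move=> A mA /=.
    under [RHS]eq_integral do rewrite EFinM.
    rewrite ge0_integralZl//; last 2 first.
    + by apply/measurable_EFinP; exact: mind.
    + by rewrite lee_fin fine_ge0.
    rewrite fineK// intind// [RHS]muleC -ind// setIC -[in RHS](setIT (_ `&` _)).
    rewrite -integral_indic//; last by apply: measurableI; exact: mpre.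
    by apply: eq_integral => w _; rewrite indicI /= -!indE.
have step2 : (\int[P]_w (h (f w) * k (g w))%:E =
    \int[P]_w (fine (\int[P]_w (h (f w))%:E) * k (g w))%:E)%E.
  have If : (\int[P]_w (h (f w))%:E)%E \is a fin_num.
    by rewrite ge0_fin_numE// integral_ge0// => w _; rewrite lee_fin.
  apply: (transfer_ge0 (mu1 := P) (mu2 := P) (W1 := fun w => h (f w))
    (W2 := cst (fine (\int[P]_w (h (f w))%:E)%E)) (X1 := g) (X2 := g)) => //.
  - exact: measurableT_comp.
  - by move=> w /=; rewrite fine_ge0// integral_ge0// => z _; rewrite lee_fin.
  - move=> A mA /=; under eq_integral do rewrite mulrC.
    rewrite step1// muleC -[X in (X * _)%E]fineK//.
    under [RHS]eq_integral do rewrite EFinM.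
    rewrite ge0_integralZl//.
    + by rewrite intind// fineK.
    + by apply/measurable_EFinP; exact: mind.
    + by rewrite lee_fin fine_ge0// integral_ge0// => z _; rewrite lee_fin.
have If : (\int[P]_w (h (f w))%:E)%E \is a fin_num.
  by rewrite ge0_fin_numE// integral_ge0// => w _; rewrite lee_fin.
rewrite step2; under eq_integral do rewrite EFinM.
rewrite ge0_integralZl//.
- by rewrite fineK.
- by apply/measurable_EFinP; exact: measurableT_comp.
- by move=> w _; rewrite lee_fin.
- by rewrite lee_fin fine_ge0// integral_ge0// => z _; rewrite lee_fin.
Qed.

(** Taking [A] to be the whole line shows that [w] is the mean of [W]; the assumption says that [W]
    is uncorrelated with every event on [V]. Adding [K] turns the signed [W] into a nonnegative
    weight, as the transfer requires. *)
Lemma replace_indicator (W V : T -> R) (w K M : R) (f : R -> R) :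
  measurable_fun setT W -> measurable_fun setT V -> measurable_fun setT f ->
  (forall x, `|W x| <= K) -> (forall x, `|f x| <= M) ->
  (forall A, measurable A ->
     \int[P]_x (W x * \1_A (V x)) = w * \int[P]_x \1_A (V x)) ->
  \int[P]_x (W x * f (V x)) = w * \int[P]_x f (V x).
Proof.
move=> mW mV mf WK fM ind.
have K0 : 0 <= K by exact: le_trans (WK point).
have WK0 x : 0 <= W x + K.
  by have := WK x; rewrite ler_norml => /andP[h _]; rewrite -lerBlDr sub0r.
have iW := bounded_integrable mW WK.
have mfV : measurable_fun setT (fun x => f (V x)) by exact: measurableT_comp.
have ifV := bounded_integrable mfV (fun x => fM (V x)).
have iWf : P.-integrable setT (EFin \o (fun x => W x * f (V x))).
  exact: integrable_mul_bounded iW mfV (fun x => fM (V x)).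
have wE : w = \int[P]_x W x.
  have := ind _ measurableT; under [X in _ = _ * X]eq_Rintegral do rewrite indicT.
  rewrite Rintegral_prob_cst mulr1 => <-.
  by apply: eq_Rintegral => x _; rewrite indicT mulr1.
have wK0 : 0 <= w + K.
  rewrite wE -[X in _ + X]Rintegral_prob_cst -RintegralD//.
    by apply: Rintegral_ge0 => x _.
  by apply: (@bounded_integrable (cst K) K) => // x; rewrite /= ger0_norm.
have mind (A : set R) : measurable A -> measurable_fun setT (fun w => \1_A (V w) : R).
  by move=> mA; apply: measurableT_comp mV; exact: measurable_indic.
have ind1 (A : set R) x : `|\1_A (V x) : R| <= 1.
  by rewrite indicE normr_nat lern1 leq_b1.
have iWind A : measurable A -> P.-integrable setT (EFin \o (fun x => W x * \1_A (V x))).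
  by move=> mA; exact: integrable_mul_bounded iW (mind _ mA) (ind1 A).
have iind A : measurable A -> P.-integrable setT (EFin \o (fun x => \1_A (V x))).
  by move=> mA; exact: bounded_integrable (mind _ mA) (ind1 A).
have := @transfer_bounded _ _ _ _ T T R P P (fun x => W x + K) (cst (w + K)) V V.
move=> /(_ _ _ _ _ _ _ _ f M).
have -> : \int[P]_x ((W x + K) * f (V x)) = \int[P]_x (W x * f (V x)) + K * \int[P]_x f (V x).
  rewrite -RintegralZl// -RintegralD//; last exact: (integrableZl measurableT K ifV).
  by apply: eq_Rintegral => x _; rewrite mulrDl.
rewrite RintegralZl// mulrDl => H.
apply: (addIr (K * \int[P]_x f (V x))); apply: H => //.
- exact: measurable_funD.
- move=> A mA.
  have intE (u : T -> R) : P.-integrable setT (EFin \o u) ->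
      (\int[P]_x (u x)%:E = (\int[P]_x u x)%:E)%E.
    by move=> iu; rewrite fineK//; exact: (integrable_fin_num measurableT iu).
  have iW1 : P.-integrable setT (EFin \o (fun x => (W x + K) * \1_A (V x))).
    apply: (integrable_mul_bounded (M := 1)) => //; last exact: mind.
    by apply: (bounded_integrable (M := K + K)); [exact: measurable_funD|move=> x; rewrite (le_trans (ler_normD _ _))// lerD// ger0_norm].
  rewrite intE// intE; last exact: (integrableZl measurableT (w + K) (iind A mA)).
  congr _%:E; rewrite RintegralZl//; last exact: iind.
  rewrite mulrDl -ind// -RintegralZl//; last exact: iind.
  rewrite -RintegralD//.
  + by apply: eq_Rintegral => x _; rewrite mulrDl.
  + exact: iWind.
  + exact: (integrableZl measurableT K (iind A mA)).
- by apply: (bounded_integrable (M := K + K)); [exact: measurable_funD|move=> x; rewrite (le_trans (ler_normD _ _))// lerD// ger0_norm].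
- by apply: (@bounded_integrable (cst (w + K)) `|w + K|).
Qed.

Lemma bigprod_norm_le (I : finType) (F : I -> R) (M : I -> R) (Q : pred I) :
  (forall i, `|F i| <= M i) -> `|\prod_(i | Q i) F i| <= \prod_(i | Q i) M i.
Proof. by move=> FM; rewrite normr_prod; apply: ler_prod => i _; rewrite normr_ge0 FM. Qed.

Lemma expectation_prod (m : nat) (x : T -> R) (V : 'I_m -> T -> R)
    (f : 'I_m -> R -> R) (K : R) (M : 'I_m -> R) :
  measurable_fun setT x -> (forall w, `|x w| <= K) ->
  (forall j, measurable_fun setT (V j)) ->
  (forall A : 'I_m -> set R, (forall j, measurable (A j)) ->
    \int[P]_w (x w * \prod_j \1_(A j) (V j w)) =
    \int[P]_w x w * \prod_j \int[P]_w \1_(A j) (V j w)) ->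
  (forall j, measurable_fun setT (f j)) -> (forall j y, `|f j y| <= M j) ->
  \int[P]_w (x w * \prod_j f j (V j w)) =
  \int[P]_w x w * \prod_j \int[P]_w f j (V j w).
Proof.
move=> mx xK mV ind.
(* [main k] allows arbitrary bounded functions at the indices below [k] and indicators from [k] on:
   [main 0] is the hypothesis on events and [main m] is the claim. Each step frees one index by
   [replace_indicator], all other factors being put into [W]. *)
suff main (k : nat) : forall (f : 'I_m -> R -> R) (M : 'I_m -> R), (forall j : 'I_m, measurable_fun setT (f j)) ->
    (forall (j : 'I_m) (y : R), `|f j y| <= M j :> R) ->
    (forall j : 'I_m, (k <= j)%N -> exists2 A : set R, measurable A & f j = \1_A) ->
    \int[P]_w (x w * \prod_j f j (V j w)) =
    \int[P]_w x w * \prod_j \int[P]_w f j (V j w).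
  by move=> mf fM; apply: (main m) fM _ => // j; rewrite leqNgt ltn_ord.
elim: k => [{}f {}M mf fM fA|k IH {}f {}M mf fM fA].
  have /choice[A HA] : forall j : 'I_m, exists A : set R, measurable A /\ f j = \1_A.
    by move=> j; have [A mA fE] := fA j isT; exists A.
  under eq_Rintegral do under eq_bigr => j _ do rewrite (HA j).2.
  under [in RHS]eq_bigr => j _ do (under eq_Rintegral do rewrite (HA j).2).
  by apply: ind => j; exact: (HA j).1.
have [km|mk] := ltnP k m; last first.
  by apply: IH fM _ => // j; rewrite leqNgt (leq_trans (ltn_ord j) mk).
pose j0 : 'I_m := Ordinal km.
have E1 (f' : 'I_m -> R -> R) w : x w * \prod_j f' j (V j w) =
    x w * \prod_(j | j != j0) f' j (V j w) * f' j0 (V j0 w).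
  by rewrite (bigD1 j0)//= mulrA mulrAC.
under eq_Rintegral do rewrite E1.
rewrite [in RHS](bigD1 j0)//= [X in _ * X]mulrC mulrA.
apply: (@replace_indicator _ _ _ (K * \prod_(j | j != j0) M j) (M j0)) => //.
- apply: measurable_funM => //.
  under eq_fun do rewrite -big_filter.
  apply: measurable_prod => j _; exact: measurableT_comp.
- by move=> w; rewrite normrM ler_pM// bigprod_norm_le.
move=> A mA.
pose f' j := if j == j0 then \1_A else f j.
have := IH f' (fun j => if j == j0 then 1 else M j).
rewrite (bigD1 j0)//= [X in _ * X]mulrC mulrA.
have f'N j : j != j0 -> f' j = f j by rewrite /f' => /negbTE ->.
have f'0 : f' j0 = \1_A by rewrite /f' eqxx.
under eq_Rintegral do rewrite E1 f'0.
rewrite f'0.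
move=> H.
transitivity (\int[P]_w (x w * \prod_(j | j != j0) f' j (V j w) * \1_A (V j0 w))).
  by apply: eq_Rintegral => w _; congr (_ * _ * _); apply: eq_bigr => j /f'N ->.
rewrite H.
- by congr (_ * _ * _); apply: eq_bigr => j /f'N ->.
- by move=> j; rewrite /f'; case: eqP => // _; exact: measurable_indic.
- move=> j y; rewrite /f'; case: eqP => // _.
  by rewrite indicE normr_nat lern1 leq_b1.
- move=> j kj; rewrite /f'; case: eqP => [_|/eqP jj0]; first by exists A.
  by apply: fA; rewrite ltn_neqAle kj andbT; apply: contra jj0 => /eqP h; apply/eqP/val_inj.
Qed.

End independence.

(** * Second moments of sums of mostly uncorrelated noise terms *)

Section second_moments.
Context {R : realType} d (T : measurableType d) (P : probability T R).

Lemma Rintegral_sum (I : Type) (s : seq I) (Q : pred I) (F : I -> T -> R) :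
  (forall i, P.-integrable setT (EFin \o F i)) ->
  P.-integrable setT (EFin \o (fun w => \sum_(i <- s | Q i) F i w)) /\
  \int[P]_w (\sum_(i <- s | Q i) F i w) = \sum_(i <- s | Q i) \int[P]_w F i w.
Proof.
move=> iF; elim: s => [|i s [IH1 IH2]].
  rewrite big_nil; under eq_fun do rewrite big_nil; split.
    by apply: (@bounded_integrable _ _ _ P _ 0) => // w; rewrite normr0.
  by rewrite Rintegral_prob_cst.
have E w : \sum_(j <- i :: s | Q j) F j w =
   (if Q i then F i w else 0) + \sum_(j <- s | Q j) F j w.
  by rewrite big_cons; case: (Q i); rewrite ?add0r.
under eq_fun do rewrite E.
rewrite big_cons; case: (Q i); last first.
  by under eq_fun do rewrite add0r.
split; last by rewrite RintegralD// IH2.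
by have := integrableD measurableT (iF i) IH1.
Qed.

(** In the expanded square only the products of terms related by [r] can have nonzero mean, and each
    of these is at most [K ^ 2]. The size of the sum is thus a matter of counting related pairs. *)
Lemma second_moment_sparse (I : finType) (Q : pred I) (r : rel I) (F : I -> T -> R) (K : R) :
  (forall i, measurable_fun setT (F i)) -> (forall i w, `|F i w| <= K) ->
  (forall i k, Q i -> Q k -> ~~ r i k -> \int[P]_w (F i w * F k w) = 0) ->
  \int[P]_w ((\sum_(i | Q i) F i w) ^+ 2) <=
  K ^+ 2 * \sum_(i | Q i) \sum_(k | Q k && r i k) 1.
Proof.
move=> mF FK orth.
have iFF i k : P.-integrable setT (EFin \o (fun w => F i w * F k w)).
  apply: (@bounded_integrable _ _ _ P _ (K * K)); first exact: measurable_funM.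
  by move=> w; rewrite normrM ler_pM.
have E w : (\sum_(i | Q i) F i w) ^+ 2 =
    \sum_(i | Q i) \sum_(k | Q k) F i w * F k w.
  by rewrite expr2 big_distrlr.
under eq_Rintegral do rewrite E.
have [_ ->] := Rintegral_sum (index_enum I) Q
  (fun i => (Rintegral_sum (index_enum I) Q (fun k => iFF i k)).1).
rewrite mulr_sumr; apply: ler_sum => i Qi.
have [_ ->] := Rintegral_sum (index_enum I) Q (fun k => iFF i k).
rewrite (bigID (r i))/= [X in _ + X]big1 ?addr0; last first.
  by move=> k /andP[Qk nr]; exact: orth.
rewrite mulr_sumr; apply: ler_sum => k _; rewrite mulr1.
rewrite -(Rintegral_prob_cst P (K ^+ 2)); apply: le_Rintegral => //.
  by apply: (@bounded_integrable _ _ _ P _ `|K ^+ 2|).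
by move=> w _; rewrite expr2 (le_trans (ler_norm _))// normrM ler_pM.
Qed.

End second_moments.

Section noise.
Context {R : realType} d (T : measurableType d) (P : probability T R).
Variables (m : nat) (V : 'I_m -> T -> R) (X : (T -> R) -> Prop).
Hypothesis mV : forall j, measurable_fun setT (V j).
Hypothesis mX : forall x, X x -> measurable_fun setT x.
Hypothesis XM : forall x y, X x -> X y -> X (fun w => x w * y w).
Hypothesis fact : forall (x : T -> R) (K : R) (f : 'I_m -> R -> R) (M : 'I_m -> R),
  X x -> (forall w, `|x w| <= K) ->
  (forall j, measurable_fun setT (f j)) -> (forall j y, `|f j y| <= M j) ->
  \int[P]_w (x w * \prod_j f j (V j w)) =
  \int[P]_w x w * \prod_j \int[P]_w f j (V j w).

(** The factorization hypothesis concerns products over all indices. Padding with the constant 1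
    brings products of two or four noise factors into this form. *)
Let at_index (u : R -> R) (l k : 'I_m) (y : R) := if k == l then u y else 1.

Let prod_at_index u l w : \prod_k at_index u l k (V k w) = u (V l w).
Proof. by rewrite /at_index -big_mkcond /= big_pred1_eq. Qed.

Let measurable_at_index u l k : measurable_fun setT u -> measurable_fun setT (at_index u l k).
Proof. by move=> mu; rewrite /at_index; case: eqP. Qed.

Let bounded_at_index u l k y : (forall y, `|u y| <= 2) -> `|at_index u l k y| <= 2.
Proof.
by move=> u2; rewrite /at_index; case: eqP => // _; rewrite normr1 ler1n.
Qed.

Variables (u v : R -> R).
Hypotheses (mu : measurable_fun setT u) (mv : measurable_fun setT v).
Hypotheses (u2 : forall y, `|u y| <= 2) (v2 : forall y, `|v y| <= 2).
Hypotheses (u0 : forall j, \int[P]_w u (V j w) = 0) (v0 : forall j, \int[P]_w v (V j w) = 0).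
Variables (nb : rel 'I_m) (g : 'I_m -> 'I_m -> T -> R).
Hypotheses (nb_irr : forall j l, nb j l -> j != l).
Hypotheses (gX : forall j l, X (g j l)) (g1 : forall j l w, `|g j l w| <= 1).

Let muV j : measurable_fun setT (fun w => u (V j w)).
Proof. exact: measurableT_comp. Qed.
Let mvV j : measurable_fun setT (fun w => v (V j w)).
Proof. exact: measurableT_comp. Qed.

(** Terms with distinct [l] are uncorrelated, because a centred factor then stands alone at its
    index. A term is thus related to at most [B] terms, and 4 is the square of the bound 2. The
    class [X] stands for the bounded coefficients that depend on the signal only. *)
Lemma linear_noise_second_moment (B : R) :
  (forall l, \sum_(j | nb j l) 1 <= B) ->
  \int[P]_w ((\sum_j \sum_(l | nb j l) g j l w * u (V l w)) ^+ 2) <=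
  4 * (B * \sum_j \sum_(l | nb j l) 1).
Proof.
move=> cB; under eq_Rintegral do rewrite pair_big_dep.
apply: (le_trans (@second_moment_sparse _ _ _ P _ (fun p => nb p.1 p.2)
  (fun p q => p.2 == q.2) (fun p w => g p.1 p.2 w * u (V p.2 w)) 2 _ _ _)).
- by move=> p; apply: measurable_funM => //; exact: mX.
- by move=> p w; rewrite normrM -[leRHS]mul1r ler_pM.
- move=> [j l] [j' l'] /= _ _ ll'.
  pose f k y := at_index u l k y * at_index u l' k y.
  transitivity (\int[P]_w ((g j l w * g j' l' w) * \prod_k f k (V k w))).
    apply: eq_Rintegral => w _; rewrite big_split/= !prod_at_index; ring.
  rewrite (@fact _ 1 _ (fun=> 4)).
  + apply/eqP; rewrite mulf_eq0; apply/orP; right.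
    apply/prodf_eq0; exists l => //; rewrite /f /at_index eqxx (negbTE ll').
    by under eq_Rintegral do rewrite mulr1; apply/eqP.
  + exact: XM.
  + by move=> w; rewrite normrM -[leRHS]mul1r ler_pM.
  + by move=> k; apply: measurable_funM; exact: measurable_at_index.
  + move=> k y; rewrite normrM (_ : 4 = 2 * 2 :> R); last by rewrite -natrM.
    by rewrite ler_pM// bounded_at_index.
- rewrite (_ : 2 ^+ 2 = 4 :> R); last by rewrite -natrX.
  rewrite ler_pM2l// [in leRHS]pair_big_dep/= mulr_sumr; apply: ler_sum => -[j l] /= _.
  rewrite mulr1 (le_trans _ (cB l))//.
  rewrite (eq_bigl (fun q => nb q.1 q.2 && (q.2 == l))); last first.
    by move=> q; rewrite eq_sym.
  rewrite -(pair_big_dep xpredT (fun j' l' => nb j' l' && (l' == l)) (fun _ _ => 1))/=.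
  rewrite [leRHS]big_mkcond; apply: ler_sum => j' _.
  rewrite big_mkcondl big_pred1_eq; by case: ifP.
Qed.

(** Terms are uncorrelated unless they come from the same unordered pair, so each is related to
    itself and its mirror image only: the constant is [4 ^ 2 * 2]. *)
Lemma quadratic_noise_second_moment :
  \int[P]_w ((\sum_j \sum_(l | nb j l) g j l w * (u (V l w) * v (V j w))) ^+ 2) <=
  32 * \sum_j \sum_(l | nb j l) 1.
Proof.
under eq_Rintegral do rewrite pair_big_dep.
pose r (p q : 'I_m * 'I_m) := (q == p) || (q == (p.2, p.1)).
apply: (le_trans (@second_moment_sparse _ _ _ P _ (fun p => nb p.1 p.2)
  r (fun p w => g p.1 p.2 w * (u (V p.2 w) * v (V p.1 w))) 4 _ _ _)).
- move=> p; apply: measurable_funM; first exact: mX.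
  exact: measurable_funM.
- move=> p w; rewrite normrM -[leRHS]mul1r ler_pM// normrM.
  by rewrite (_ : 4 = 2 * 2 :> R) ?ler_pM// -natrM.
- move=> [j l] [j' l'] /= /nb_irr jl /nb_irr jl'; rewrite /r/= !xpair_eqE/= => nr.
  pose f k y := at_index u l k y * at_index v j k y * at_index u l' k y * at_index v j' k y.
  transitivity (\int[P]_w ((g j l w * g j' l' w) * \prod_k f k (V k w))).
    apply: eq_Rintegral => w _; rewrite !big_split/= !prod_at_index; ring.
  rewrite (@fact _ 1 _ (fun=> 16)).
  + apply/eqP; rewrite mulf_eq0; apply/orP; right.
    (* If [j] or [l] occurs only once among the four indices, its centred factor makes the product
       of means vanish. If both occur again, [j != l] and [j' != l'] force the pairs to coincide up
       to order, which [nr] excludes. *)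
    have [hj|hj] := boolP ((j == j') || (j == l')); last first.
      move: hj; rewrite negb_or => /andP[/negbTE h1 /negbTE h2].
      apply/prodf_eq0; exists j => //; rewrite /f /at_index eqxx h1 h2 (negbTE jl).
      by under eq_Rintegral do rewrite mul1r !mulr1; apply/eqP.
    have [hl|hl] := boolP ((l == j') || (l == l')); last first.
      move: hl; rewrite negb_or => /andP[/negbTE h1 /negbTE h2].
      apply/prodf_eq0; exists l => //; rewrite /f /at_index eqxx h1 h2.
      rewrite [l == j]eq_sym (negbTE jl).
      by under eq_Rintegral do rewrite !mulr1; apply/eqP.
    exfalso; move: nr; apply/negP; rewrite negbK.
    move: hj hl jl jl' => /orP[]/eqP <- /orP[]/eqP <-; rewrite ?eqxx ?orbT//.
  + exact: XM.
  + by move=> w; rewrite normrM -[leRHS]mul1r ler_pM.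
  + by move=> k; do !apply: measurable_funM; exact: measurable_at_index.
  + move=> k y; rewrite !normrM (_ : 16 = 2 * 2 * 2 * 2 :> R); last by rewrite -!natrM.
    by rewrite !ler_pM ?mulr_ge0 ?bounded_at_index.
- rewrite (_ : 4 ^+ 2 = 16 :> R); last by rewrite -natrX.
  rewrite (_ : 32 = 16 * 2 :> R); last by rewrite -natrM.
  rewrite -mulrA ler_pM2l// [in leRHS]pair_big_dep/= mulr_sumr; apply: ler_sum => -[j l] /= _.
  rewrite mulr1 big_mkcondl/=.
  apply: (@le_trans _ _ (\sum_(q | r (j, l) q) 1)).
    by apply: ler_sum => q _; case: ifP.
  rewrite sumr_const ler_nat.
  rewrite (eq_card (B := pred2 (j, l) (l, j))) ?card2//; last first.
  by case: (_ != _).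
Qed.

End noise.

Lemma indicator_comp (R : realType) (S S' : Type) (A : set S') (u : S -> S') w :
  \1_A (u w) = \1_(u @^-1` A) w :> R.
Proof.
rewrite !indicE; by congr (nat_of_bool _)%:R.
Qed.

(** * Factorization of expectations over the errors, given the signal *)

Section error_model.
Context {R : realType} d (Omega : measurableType d) (P : probability Omega R).

(** The sigma-algebra generated by [H] is put on a copy of [Omega], so that the usual closure
    properties of measurable functions apply to functions of the signal. *)
Definition signal_measurable (H : set (set Omega)) (x : Omega -> R) :=
  measurable_fun setT (x : g_sigma_algebraType H -> R).

Variables (T : R) (g : nat -> R) (n : nat) (X U : R -> Omega -> R) (f : R -> R).
Hypothesis model : error_model T g n P X U f.
Hypothesis mX : forall t, 0 <= t <= T -> measurable_fun setT (X t).

Let H := \bigcup_(t in [set` `[0, T]]) preimage_set_system setT (X t) measurable.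

Lemma signal_measurable_X t : 0 <= t <= T -> signal_measurable H (X t).
Proof.
move=> tT _ A mA; apply: sub_gen_smallest; exists t; first by rewrite /= in_itv.
by exists A.
Qed.

Lemma signal_measurable_mfun x : signal_measurable H x -> measurable_fun setT x.
Proof.
move=> mx _ A mA; have := mx measurableT A mA.
apply: smallest_sub; first exact: sigma_algebra_measurable.
by move=> _ [t tT [B mB <-]]; apply: mX => //; rewrite /= in_itv in tT.
Qed.

Lemma error_measurable (j : 'I_n.+1) : measurable_fun setT (U (g j)).
Proof. by have [_ [mU _ _] _] := model; exact: mU. Qed.

Lemma error_factorization (x : Omega -> R) (K : R) (u : 'I_n.+1 -> R -> R) (M : 'I_n.+1 -> R) :
  signal_measurable H x -> (forall w, `|x w| <= K) ->
  (forall j, measurable_fun setT (u j)) -> (forall j y, `|u j y| <= M j) ->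
  \int[P]_w (x w * \prod_j u j (U (g j) w)) =
  \int[P]_w x w * \prod_j \int[P]_w u j (U (g j) w).
Proof.
move=> Hx xK mu uM.
have [_ [mU Ulaw Uind] ind] := model.
have mx := signal_measurable_mfun Hx.
apply: (expectation_prod mx xK mU _ mu uM) => A mA.
pose E := \bigcap_(j in [set: 'I_n.+1]) (U (g j)) @^-1` A j.
have mUA (j : 'I_n.+1) : measurable (U (g j) @^-1` A j).
  by rewrite -[_ @^-1` _]setTI; exact: mU.
have mE : measurable E by apply: fin_bigcap_measurable => // j _; exact: mUA.
have indE w : \prod_j \1_(A j) (U (g j) w) = \1_E w :> R.
  rewrite indicE; have [/set_mem Ew|Ew] := boolP (w \in E).
    by apply: big1 => j _; rewrite indicE mem_set//; exact: Ew.
  apply/eqP/prodf_eq0; have [j jE] : exists j : 'I_n.+1, ~ A j (U (g j) w).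
    apply/existsNP => h; move/negP : Ew; apply; apply/mem_set => j _; exact: h.
  by exists j => //; rewrite indicE memNset.
under eq_Rintegral do rewrite indE mulrC.
have PE : (\prod_j \int[P]_w (\1_(A j) (U (g j) w) : R)) = fine (P E).
  transitivity (\prod_(j < n.+1) fine (P (U (g j) @^-1` A j))).
    apply: eq_bigr => j _; rewrite -[RHS]Rintegral_indicator//.
  suff -> : P E = (\prod_(j < n.+1) fine (P (U (g j) @^-1` A j)))%:E by [].
  rewrite Uind// (big_morph EFin EFinM erefl).
  by apply: eq_bigr => j _; rewrite fineK// fin_num_measure.
rewrite PE mulrC.
(* [replace_indicator] expects a bounded function of [x]. The identity is not bounded, but its
   cut-off at [K] agrees with it at all values of [x]. *)
pose trunc y := Num.max (- K) (Num.min y K).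
have truncE w : trunc (x w) = x w.
  have := xK w; rewrite ler_norml /trunc => /andP[h1 h2].
  by rewrite (min_idPl h2) (max_idPr h1).
have K0 : 0 <= K by exact: le_trans (xK point).
have := @replace_indicator _ _ _ P \1_E x (fine (P E)) 1 K trunc.
move=> repl.
transitivity (\int[P]_w (\1_E w * trunc (x w))).
  by apply: eq_Rintegral => w _; rewrite truncE.
rewrite repl//.
- by congr (_ * _); apply: eq_Rintegral => w _; rewrite truncE.
- apply: measurable_maxr => //; exact: measurable_minr.
- by move=> w; rewrite indicE normr_nat lern1 leq_b1.
- move=> y; rewrite ler_norml /trunc le_max lexx/= ge_max ge_min lexx orbT andbT.
  by rewrite (le_trans _ K0)// oppr_le0.
- move=> B mB.
  have mxB : measurable (x @^-1` B) by rewrite -[_ @^-1` _]setTI; exact: mx.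
  have EB : P (E `&` x @^-1` B) = (P E * P (x @^-1` B))%E.
    apply: ind.
      rewrite /generated_by.
      have : measurable (E : set (g_sigma_algebraType (\bigcup_(i in [set: 'I_n.+1])
          preimage_set_system setT (U (g i)) measurable))).
        apply: fin_bigcap_measurable => // j _; apply: sub_gen_smallest.
        by exists j => //; exists (A j) => //; rewrite setTI.
      by [].
    by have := Hx measurableT B mB; rewrite setTI.
  transitivity (\int[P]_w (\1_(E `&` x @^-1` B) w : R)).
    by apply: eq_Rintegral => w _; rewrite indicI /= indicator_comp.
  rewrite Rintegral_indicator; last exact: measurableI.
  rewrite EB fineM ?fin_num_measure//; congr (_ * _).
  by rewrite -[LHS]Rintegral_indicator.
Qed.

Lemma error_expectation (j : 'I_n.+1) (u : R -> R) (M : R) : measurable_fun setT u ->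
  (forall y, `|u y| <= M) ->
  \int[P]_w u (U (g j) w) = \int[@lebesgue_measure R]_y (f y * u y).
Proof.
move=> mu uM.
have [[mf f0 f1] [mU Ulaw Uind] _] := model.
have fi : (@lebesgue_measure R).-integrable setT (EFin \o f).
  apply/integrableP; split; first exact/measurable_EFinP.
  by under eq_integral do rewrite /= ger0_norm//; rewrite f1 ltry.
transitivity (\int[P]_w (cst 1 w * u (U (g j) w))).
  by apply: eq_Rintegral => w _; rewrite mul1r.
apply: (@transfer_bounded _ _ _ _ Omega (measurableTypeR R) (measurableTypeR R) P
  (@lebesgue_measure R) (cst 1) f (U (g j)) id _ _ _ _ _ _ _ u M) => //.
- exact: mU.
- move=> A mA; have mUA : measurable (U (g j) @^-1` A).
    by rewrite -[_ @^-1` _]setTI; exact: mU.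
  transitivity (P (U (g j) @^-1` A)).
    rewrite -[in RHS](setIT (_ @^-1` _)) -integral_indic//; apply: eq_integral => w _.
    by rewrite mul1r indicator_comp.
  rewrite Ulaw// [LHS]integral_mkcond; apply: eq_integral => x _.
  by rewrite patchE indicE; case: ifP => _ /=; rewrite ?mulr1 ?mulr0.
- by apply: (@bounded_integrable _ _ _ P _ 1) => // w; rewrite normr1.
Qed.

End error_model.

(** * Second moments of Ito integrals and of increments of the signal *)

Section normal_moments.
Context {R : realType}.
Local Notation leb := (@lebesgue_measure R).

(* [x^2 exp(-x^2/2s^2)] is dominated by the density with variance [2 s^2]: no Gaussian moment
   has to be computed, at the price of the constant 8. *)
Lemma normal_second_moment_pointwise (s x : R) : 0 < s ->
  normal_pdf 0 s x * x ^+ 2 <= 8 * s ^+ 2 * normal_pdf 0 (Num.sqrt 2 * s) x.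
Proof.
move=> s0.
have r0 : 0 < Num.sqrt 2 * s :> R by rewrite mulr_gt0// sqrtr_gt0.
rewrite /normal_pdf !gt_eqF// /normal_peak /normal_fun !subr0.
rewrite exprMn sqr_sqrtr//.
set v := s ^+ 2; have v0 : 0 < v by rewrite exprn_gt0.
have -> : (2 * v * pi) *+ 2 = 2 * (v * pi *+ 2) by rewrite mulrnAr mulrA.
rewrite [Num.sqrt (2 * _)]sqrtrM// invfM.
set q := (Num.sqrt (v * pi *+ 2))^-1.
have q0 : 0 <= q by rewrite invr_ge0 sqrtr_ge0.
(* In this variable the two exponents are [- 2 u] and [- u], and the claim reduces to
   [u * exp (- u) <= 1 <= 2 / sqrt 2]. *)
set u := x ^+ 2 / (4 * v).
have u0 : 0 <= u by rewrite divr_ge0 ?sqr_ge0// mulr_ge0// ltW.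
have v0' : v != 0 by rewrite gt_eqF.
have xE : x ^+ 2 = 4 * v * u by rewrite /u; field.
have -> : - x ^+ 2 / (v *+ 2) = - u - u by rewrite xE -mulr_natr; field.
have -> : - x ^+ 2 / (2 * v *+ 2) = - u by rewrite xE -mulr_natr; field.
have u_exp : u <= expR u by rewrite (le_trans _ (expR_ge1Dx u))// lerDr.
have r2 : 2^-1 <= (Num.sqrt 2)^-1 :> R.
  rewrite lef_pV2 ?posrE ?sqrtr_gt0//.
  have h1 : Num.sqrt 2 ^+ 2 = 2 :> R by rewrite sqr_sqrtr.
  have h2 : 0 <= Num.sqrt 2 :> R by exact: sqrtr_ge0.
  by nra.
rewrite xE expRD.
have -> : q * (expR (- u) * expR (- u)) * (4 * v * u) =
   (q * v * expR (- u) * 4) * (u * expR (- u)) by ring.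
have -> : 8 * v * ((Num.sqrt 2)^-1 * q * expR (- u)) =
   (q * v * expR (- u) * 4) * (2 * (Num.sqrt 2)^-1) by ring.
rewrite ler_wpM2l//.
  by rewrite !mulr_ge0 ?expR_ge0// ltW.
apply: (@le_trans _ _ 1); last by rewrite -ler_pdivrMl// mulr1.
by rewrite expRN -ler_pdivlMr ?invr_gt0 ?expR_gt0// invrK mul1r.
Qed.

End normal_moments.

Section brownian.
Context {R : realType} d (Omega : measurableType d) (P : probability Omega R).
Variables (T : R) (F : R -> set (set Omega)) (B : R -> Omega -> R).
Hypothesis filtF : filtration T F.
Hypothesis BM : brownian_motion P T F B.
Local Notation leb := (@lebesgue_measure R).

(** As for the signal, measurability refers to a copy of [Omega]. For times in [[0, T]], [F t] is
    already a sigma-algebra and generating one from it changes nothing. *)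
Definition known (t : R) (f : Omega -> R) :=
  measurable_fun setT (f : g_sigma_algebraType (F t) -> R).

Lemma knownP t f : 0 <= t <= T -> known t f <-> measurable_wrt setT (F t) f.
Proof.
move=> tT; have [sF _ _] := filtF; split => mf.
  by move=> A mA; have := mf measurableT A mA; rewrite /measurable /= sigma_algebra_id//; exact: sF.
by move=> _ A mA; apply: sub_gen_smallest; exact: mf.
Qed.

Lemma known_measurable t f : 0 <= t <= T -> known t f -> measurable_fun setT f.
Proof.
move=> tT /(knownP _ tT) mf _ A mA; have [_ sF _] := filtF.
by apply: (sF t) => //; exact: mf.
Qed.

Lemma known_le s t f : 0 <= s -> s <= t -> t <= T -> known s f -> known t f.
Proof.
move=> s0 st tT; have [_ _ sF] := filtF.
have sT : 0 <= s <= T by rewrite s0 (le_trans st).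
have tT' : 0 <= t <= T by rewrite tT (le_trans s0).
move=> /(knownP _ sT) mf; apply/(knownP _ tT') => A mA.
by apply: (sF s t) => //; exact: mf.
Qed.

Lemma known_B t : 0 <= t <= T -> known t (B t).
Proof. by move=> tT; apply/(knownP _ tT); have [aB _ _ _ _] := BM; exact: aB. Qed.

Lemma measurable_B t : 0 <= t <= T -> measurable_fun setT (B t).
Proof. by move=> tT; apply: (known_measurable tT); exact: known_B. Qed.

Section increment.
Variables (s t : R).
Hypotheses (s0 : 0 <= s) (st : s < t) (tT : t <= T).

Let D w := B t w - B s w.

Let sT : 0 <= s <= T. Proof. by rewrite s0 (le_trans (ltW st)). Qed.
Let tT' : 0 <= t <= T. Proof. by rewrite tT (le_trans s0 (ltW st)). Qed.

Lemma measurable_increment : measurable_fun setT D.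
Proof. by apply: measurable_funB; exact: measurable_B. Qed.

Let sd : R := Num.sqrt (t - s).
Let sd0 : 0 < sd. Proof. by rewrite sqrtr_gt0 subr_gt0. Qed.

Lemma increment_law (h : R -> R) : measurable_fun setT h -> (forall x, 0 <= h x) ->
  (\int[P]_w (h (D w))%:E = \int[leb]_y (normal_pdf 0 sd y * h y)%:E)%E.
Proof.
move=> mh h0.
transitivity (\int[P]_w (cst 1 w * h (D w))%:E)%E.
  by apply: eq_integral => w _; rewrite mul1r.
apply: (@transfer_ge0 _ _ _ _ Omega (measurableTypeR R) (measurableTypeR R) P
  leb (cst 1) (normal_pdf 0 sd) D id _ _ _ _ _ _ _ h) => //.
- exact: measurable_normal_pdf.
- exact: measurable_increment.
- by move=> x; exact: normal_pdf_ge0.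
- move=> A mA; have mDA : measurable (D @^-1` A).
    by rewrite -[_ @^-1` _]setTI; exact: measurable_increment.
  transitivity (P (D @^-1` A)).
    rewrite -[in RHS](setIT (_ @^-1` _)) -integral_indic//; apply: eq_integral => w _.
    by rewrite mul1r indicator_comp.
  have [_ _ _ law _] := BM.
  rewrite [LHS](law s t A s0 st tT mA) /normal_prob [LHS]integral_mkcond.
  apply: eq_integral => x _.
  by rewrite patchE indicE; case: ifP => _ /=; rewrite ?mulr1 ?mulr0.
Qed.

Lemma increment_second_moment :
  (\int[P]_w (D w ^+ 2)%:E <= (8 * (t - s))%:E)%E.
Proof.
have mx2 : measurable_fun setT (fun x : R => x ^+ 2) by exact: measurable_funX.
rewrite (increment_law mx2); last by move=> x; exact: sqr_ge0.
have mpdf m r : measurable_fun setT (normal_pdf m r : R -> R) by exact: measurable_normal_pdf.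
apply: (@le_trans _ _ (\int[leb]_y ((8 * (t - s))%:E * (normal_pdf 0 (Num.sqrt 2 * sd) y)%:E))%E).
  apply: ge0_le_integral => //.
  - by move=> x _; rewrite lee_fin mulr_ge0 ?normal_pdf_ge0 ?sqr_ge0.
  - by apply/measurable_EFinP; exact: (measurable_funM (mpdf _ _) mx2).
  - by apply: measurable_funeM; apply/measurable_EFinP; exact: mpdf.
  - move=> x _; rewrite -EFinM lee_fin (le_trans (normal_second_moment_pointwise x sd0))//.
    by rewrite /sd sqr_sqrtr// subr_ge0 ltW.
rewrite ge0_integralZl//.
- rewrite integral_normal_pdf ?mule1// gt_eqF// mulr_gt0// sqrtr_gt0//.
- by apply/measurable_EFinP; exact: mpdf.
- by move=> x _; rewrite lee_fin normal_pdf_ge0.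
- by rewrite lee_fin mulr_ge0// subr_ge0 ltW.
Qed.

Definition pos_part (x : R) := Num.max x 0.

Lemma pos_part_ge0 x : 0 <= pos_part x.
Proof. by rewrite le_max lexx orbT. Qed.

Lemma measurable_pos_part : measurable_fun setT pos_part.
Proof. exact: measurable_maxr. Qed.

(** This takes the place of the increments having mean zero: positive and negative parts have the
    same integral, by symmetry of the normal density. *)
Lemma increment_symmetric :
  (\int[P]_w (pos_part (- D w))%:E = \int[P]_w (pos_part (D w))%:E)%E.
Proof.
have mN : measurable_fun setT (fun x : R => pos_part (- x)).
  by apply: (measurableT_comp measurable_pos_part).
rewrite (increment_law (h := fun x => pos_part (- x)))//; last by move=> x; exact: pos_part_ge0.
rewrite (increment_law measurable_pos_part); last exact: pos_part_ge0.
rewrite -[RHS]integralT_opp.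
- apply: eq_integral => x _ /=; rewrite /normal_pdf /normal_fun (gt_eqF sd0).
  by rewrite !subr0 sqrrN.
- apply/measurable_EFinP; apply: measurable_funM; first exact: measurable_normal_pdf.
  exact: measurable_pos_part.
- by move=> x; rewrite lee_fin mulr_ge0 ?normal_pdf_ge0 ?pos_part_ge0.
Qed.

Lemma increment_pos_part_fin : (\int[P]_w (pos_part (D w))%:E)%E \is a fin_num.
Proof.
rewrite ge0_fin_numE ?integral_ge0//; last by move=> w _; rewrite lee_fin pos_part_ge0.
apply: (@le_lt_trans _ _ (\int[P]_w (1 + (D w ^+ 2)%:E))%E).
  apply: ge0_le_integral => //.
  - by move=> w _; rewrite lee_fin pos_part_ge0.
  - by apply/measurable_EFinP; exact: (measurableT_comp measurable_pos_part measurable_increment).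
  - by apply: emeasurable_funD => //; apply/measurable_EFinP; apply: measurable_funX; exact: measurable_increment.
  - move=> w _; rewrite -EFinD lee_fin /pos_part ge_max addr_ge0 ?sqr_ge0// andbT.
    by nra.
rewrite ge0_integralD//; last 2 first.
- by move=> w _; rewrite lee_fin sqr_ge0.
- by apply/measurable_EFinP; apply: measurable_funX; exact: measurable_increment.
rewrite integral_cst// [X in (_ * X)%E]probability_setT mule1.
by rewrite (@le_lt_trans _ _ (1 + (8 * (t - s))%:E)%E)// ?leeD2l// ?increment_second_moment// -EFinD ltry.
Qed.

Lemma increment_indep (W : Omega -> R) (h k : R -> R) : known s W ->
  measurable_fun setT h -> measurable_fun setT k ->
  (forall x, 0 <= h x) -> (forall x, 0 <= k x) ->
  (\int[P]_w (h (W w))%:E < +oo)%E ->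
  (\int[P]_w (h (W w) * k (D w))%:E =
   \int[P]_w (h (W w))%:E * \int[P]_w (k (D w))%:E)%E.
Proof.
move=> kW mh mk h0 k0 hfin; apply: indep_mul_ge0 => //.
- exact: (known_measurable sT).
- exact: measurable_increment.
- move=> A A' mA mA'; have [_ _ _ _ ind] := BM.
  apply: (ind s t A' (W @^-1` A)) => //.
  by have /(knownP _ sT)/(_ A mA) := kW; rewrite setTI.
Qed.

End increment.
End brownian.

(** * Discrete stochastic integrals *)

Section discrete_ito.
Context {R : realType} d (Omega : measurableType d) (P : probability Omega R).
Variables (T : R) (F : R -> set (set Omega)) (B : R -> Omega -> R).
Hypothesis filtF : filtration T F.
Hypothesis BM : brownian_motion P T F B.

Section martingale_transform.
Variables (u : nat -> R) (z : nat -> Omega -> R) (K : R).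
Hypotheses (u0 : forall i, 0 <= u i) (uT : forall i, u i <= T).
Hypothesis (u_nd : forall i, u i <= u i.+1).
Hypothesis (z_meas : forall i, measurable_fun setT (z i)).
Hypothesis (z_known : forall i, u i < u i.+1 -> known F (u i) (z i)).
Hypothesis (z_bound : forall i w, `|z i w| <= K).

Definition discrete_integral k (w : Omega) := \sum_(i < k) z i w * (B (u i.+1) w - B (u i) w).

(** The predictable quadratic variation of [discrete_integral]. *)
Definition bracket k (w : Omega) := \sum_(i < k) z i w ^+ 2 * (u i.+1 - u i).

Let uT' i : 0 <= u i <= T. Proof. by rewrite u0 uT. Qed.

(** Steps of length zero are set apart because [z] is adapted only at nondegenerate steps. A grid
    projected onto [[s, t]] does have degenerate steps, and they contribute nothing. *)
Lemma discrete_integral_known k : known F (u k) (discrete_integral k).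
Proof.
elim: k => [|k IH].
  have -> : discrete_integral 0 = cst 0 by apply/funext => w; rewrite /discrete_integral big_ord0.
  exact: measurable_cst.
have -> : discrete_integral k.+1 = (fun w => discrete_integral k w + z k w * (B (u k.+1) w - B (u k) w)).
  by apply/funext => w; rewrite /discrete_integral big_ord_recr.
apply: measurable_funD; first exact: (known_le filtF (u0 k) (u_nd k) (uT _)).
move: (u_nd k); rewrite le_eqVlt => /predU1P[<-|lt_u].
  under eq_fun do rewrite subrr mulr0; exact: measurable_cst.
apply: measurable_funM.
  by apply: (known_le filtF (u0 k) (u_nd k) (uT _)); exact: z_known.
apply: measurable_funB; first exact: (known_B filtF BM (uT' _)).
by apply: (known_le filtF (u0 k) (u_nd k) (uT _)); exact: (known_B filtF BM (uT' _)).
Qed.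

Lemma discrete_integral_measurable k : measurable_fun setT (discrete_integral k).
Proof. exact: (known_measurable filtF (uT' k) (@discrete_integral_known k)). Qed.

Lemma bracket_ge0 k w : 0 <= bracket k w.
Proof. by apply: sumr_ge0 => i _; rewrite mulr_ge0 ?sqr_ge0// subr_ge0. Qed.

Lemma bracket_measurable k : measurable_fun setT (bracket k).
Proof.
apply: measurable_sum => i; apply: measurable_funM => //; exact: measurable_funX.
Qed.

Lemma bracket_recr k w : bracket k.+1 w = bracket k w + z k w ^+ 2 * (u k.+1 - u k).
Proof. by rewrite /bracket big_ord_recr. Qed.

Lemma bracket_bound k w : bracket k w <= K ^+ 2 * (u k - u 0%N).
Proof.
elim: k => [|k IH]; first by rewrite /bracket big_ord0 subrr mulr0.
rewrite bracket_recr (_ : K ^+ 2 * (u k.+1 - u 0%N) =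
  K ^+ 2 * (u k - u 0%N) + K ^+ 2 * (u k.+1 - u k)); last by ring.
apply: lerD => //.
rewrite ler_wpM2r ?subr_ge0// -[z k w ^+ 2]real_normK ?num_real//.
by rewrite lerXn2r ?nnegrE// (le_trans _ (z_bound k w)).
Qed.

(** The Ito isometry as an inequality, by induction on the number of steps: the cross term
    integrates to zero, and the square of the new term factorizes by independence. The factor 8 is
    that of [increment_second_moment]. *)
Lemma discrete_integral_second_moment k :
  (\int[P]_w (discrete_integral k w ^+ 2)%:E <= 8%:E * \int[P]_w (bracket k w)%:E)%E.
Proof.
elim: k => [|k IH].
  rewrite [X in (X <= _)%E](_ : _ = 0)%E.
    by rewrite mule_ge0// integral_ge0// => w _; rewrite lee_fin bracket_ge0.
  under eq_integral do rewrite /discrete_integral big_ord0 expr0n.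
  exact: integral0.
have brE : (\int[P]_w (bracket k.+1 w)%:E = \int[P]_w (bracket k w)%:E +
    \int[P]_w (z k w ^+ 2 * (u k.+1 - u k))%:E)%E.
  rewrite -ge0_integralD//.
  - by apply: eq_integral => w _; rewrite bracket_recr EFinD.
  - by move=> w _; rewrite lee_fin bracket_ge0.
  - by apply/measurable_EFinP; exact: bracket_measurable.
  - by move=> w _; rewrite lee_fin mulr_ge0 ?sqr_ge0// subr_ge0.
  - by apply/measurable_EFinP; apply: measurable_funM => //; exact: measurable_funX.
have trE w : discrete_integral k.+1 w = discrete_integral k w + z k w * (B (u k.+1) w - B (u k) w).
  by rewrite /discrete_integral big_ord_recr.
rewrite brE ge0_muleDr; last 2 first.
- by apply: integral_ge0 => w _; rewrite lee_fin bracket_ge0.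
- by apply: integral_ge0 => w _; rewrite lee_fin mulr_ge0 ?sqr_ge0// subr_ge0.
move: (u_nd k); rewrite le_eqVlt => /predU1P[uE|lt_u].
  rewrite [X in (_ <= _ + _ * X)%E](_ : _ = 0)%E.
    rewrite mule0 adde0; under eq_integral do rewrite trE -uE subrr mulr0 addr0.
    exact: IH.
  by apply: integral0_eq => w _; rewrite -uE subrr mulr0.
pose D w := B (u k.+1) w - B (u k) w.
pose W w := discrete_integral k w * z k w.
have mS := discrete_integral_measurable k.
have mD : measurable_fun setT D by exact: (measurable_increment filtF BM).
have kW : known F (u k) W.
  by apply: measurable_funM; [exact: discrete_integral_known|exact: z_known].
have mW : measurable_fun setT W by exact: measurable_funM.
have mpp := @measurable_pos_part R.
have mnp : measurable_fun setT (fun x : R => pos_part (- x)).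
  exact: (measurableT_comp mpp).
have mpW : measurable_fun setT (fun w => pos_part (W w)) by exact: measurableT_comp.
have mnW : measurable_fun setT (fun w => pos_part (- W w)) by exact: (measurableT_comp mnp).
have mpD : measurable_fun setT (fun w => pos_part (D w)) by exact: measurableT_comp.
have mnD : measurable_fun setT (fun w => pos_part (- D w)) by exact: (measurableT_comp mnp).
have K0 : 0 <= K by exact: le_trans (z_bound 0%N point).
have Sfin : (\int[P]_w (discrete_integral k w ^+ 2)%:E < +oo)%E.
  apply: (le_lt_trans IH); rewrite lte_mul_pinfty//.
  apply: (@le_lt_trans _ _ (\int[P]_w (K ^+ 2 * (u k - u 0%N))%:E)%E).
    apply: ge0_le_integral => //.
    - by move=> w _; rewrite lee_fin bracket_ge0.
    - by apply/measurable_EFinP; exact: bracket_measurable.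
    - by move=> w _; rewrite lee_fin bracket_bound.
  rewrite integral_cst//.
  by rewrite [X in (_ * X)%E]probability_setT mule1 ltry.
(* [|S z| <= K (1 + S ^ 2)], where [S] is the integral so far and has a finite second moment by
   induction. *)
have Wfin (h : R -> R) : measurable_fun setT (fun w => h (W w)) -> (forall x, 0 <= h x <= `|x|) ->
    (\int[P]_w (h (W w))%:E < +oo)%E.
  move=> mh hx; apply: (@le_lt_trans _ _ (\int[P]_w (K%:E * (1 + (discrete_integral k w ^+ 2)%:E)))%E).
    apply: ge0_le_integral => //.
    - by move=> w _; rewrite lee_fin; case/andP: (hx (W w)).
    - exact/measurable_EFinP.
    - by apply: measurable_funeM; apply: emeasurable_funD => //; apply/measurable_EFinP; exact: measurable_funX.
    - move=> w _; rewrite -EFinD -EFinM lee_fin.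
      case/andP: (hx (W w)) => _ hW; rewrite (le_trans hW)// /W normrM mulrC.
      rewrite ler_pM// -[discrete_integral k w ^+ 2]real_normK ?num_real//.
      by have := sqr_ge0 (`|discrete_integral k w| - 1); nra.
  rewrite ge0_integralZl//; last 2 first.
  - by apply: emeasurable_funD => //; apply/measurable_EFinP; exact: measurable_funX.
  - by move=> w _; rewrite -EFinD lee_fin addr_ge0 ?sqr_ge0.
  rewrite lte_mul_pinfty// ge0_integralD//; last 2 first.
  - by move=> w _; rewrite lee_fin sqr_ge0.
  - by apply/measurable_EFinP; exact: measurable_funX.
  rewrite integral_cst// [X in (_ * X)%E]probability_setT mul1e.
  by rewrite lte_add_pinfty// ltry.
have WPfin := Wfin _ mpW; have WNfin := Wfin (fun x => pos_part (- x)) mnW.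
have {}WPfin : (\int[P]_w (pos_part (W w))%:E < +oo)%E.
  apply: WPfin => x; rewrite pos_part_ge0 /pos_part ge_max ler_norm normr_ge0//.
have {}WNfin : (\int[P]_w (pos_part (- W w))%:E < +oo)%E.
  by apply: WNfin => x; rewrite pos_part_ge0 /pos_part ge_max -normrN ler_norm normr_ge0.
pose a := (\int[P]_w (pos_part (D w))%:E)%E.
have a_fin : a \is a fin_num by exact: (increment_pos_part_fin filtF BM).
have aN : (\int[P]_w (pos_part (- D w))%:E = a)%E.
  exact: (increment_symmetric filtF BM).
have ind (h k' : R -> R) : measurable_fun setT h -> measurable_fun setT k' ->
    (forall x, 0 <= h x) -> (forall x, 0 <= k' x) ->
    (\int[P]_w (h (W w))%:E < +oo)%E ->
    (\int[P]_w (h (W w) * k' (D w))%:E =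
      \int[P]_w (h (W w))%:E * \int[P]_w (k' (D w))%:E)%E.
  by apply: (increment_indep filtF BM (u0 k) lt_u (uT _) kW).
pose np (x : R) : R := pos_part (- x).
have np0 x : 0 <= np x by exact: pos_part_ge0.
have pp0 x : 0 <= pos_part x :> R by exact: pos_part_ge0.
have I1 := ind _ _ mpp mpp pp0 pp0 WPfin.
have I2 := ind _ np mpp mnp pp0 np0 WPfin.
have I3 := ind np _ mnp mpp np0 pp0 WNfin.
have I4 := ind np np mnp mnp np0 np0 WNfin.
rewrite -/a in I1 I3; rewrite /np aN in I2 I4.
have zfin : (\int[P]_w (z k w ^+ 2)%:E < +oo)%E.
  apply: (@le_lt_trans _ _ (\int[P]_w (K ^+ 2)%:E)%E).
    apply: ge0_le_integral => //.
    - by move=> w _; rewrite lee_fin sqr_ge0.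
    - by apply/measurable_EFinP; exact: measurable_funX.
    - move=> w _; rewrite lee_fin -[z k w ^+ 2]real_normK ?num_real//.
      by rewrite lerXn2r ?nnegrE// (le_trans _ (z_bound k w)).
  by rewrite integral_cst// [X in (_ * X)%E]probability_setT mule1 ltry.
have mx2 : measurable_fun setT (fun x : R => x ^+ 2) by exact: measurable_funX.
have I5 : (\int[P]_w (z k w ^+ 2 * D w ^+ 2)%:E =
    \int[P]_w (z k w ^+ 2)%:E * \int[P]_w (D w ^+ 2)%:E)%E.
  apply: (increment_indep filtF BM (u0 k) lt_u (uT _) (z_known lt_u) mx2 mx2 _ _ zfin).
    by move=> x; exact: sqr_ge0.
  by move=> x; exact: sqr_ge0.
have ge0D (f1 f2 : Omega -> R) : (forall w, 0 <= f1 w) -> (forall w, 0 <= f2 w) ->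
    measurable_fun setT f1 -> measurable_fun setT f2 ->
    (\int[P]_w (f1 w + f2 w)%:E = \int[P]_w (f1 w)%:E + \int[P]_w (f2 w)%:E)%E.
  move=> f10 f20 m1 m2; rewrite -ge0_integralD//.
  - by move=> w _; rewrite lee_fin.
  - exact/measurable_EFinP.
  - by move=> w _; rewrite lee_fin.
  - exact/measurable_EFinP.
(* The cross term is split into positive and negative parts, so that only integrals of
   nonnegative functions occur. *)
pose c w := 2 * (pos_part (W w) * pos_part (D w) + pos_part (- W w) * pos_part (- D w)).
pose c' w := 2 * (pos_part (W w) * pos_part (- D w) + pos_part (- W w) * pos_part (D w)).
have mc : measurable_fun setT c.
  by apply: measurable_funM => //; apply: measurable_funD; exact: measurable_funM.
have mc' : measurable_fun setT c'.
  by apply: measurable_funM => //; apply: measurable_funD; exact: measurable_funM.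
have c0 w : 0 <= c w by rewrite /c mulr_ge0// addr_ge0// mulr_ge0.
have c0' w : 0 <= c' w by rewrite /c' mulr_ge0// addr_ge0// mulr_ge0.
have intc : (\int[P]_w (c w)%:E = \int[P]_w (c' w)%:E)%E.
  rewrite /c /c'; under eq_integral do rewrite EFinM.
  under [in RHS]eq_integral do rewrite EFinM.
  have m1 := measurable_funM mpW mpD; have m2 := measurable_funM mnW mnD.
  have m3 := measurable_funM mpW mnD; have m4 := measurable_funM mnW mpD.
  rewrite !ge0_integralZl//.
  - congr (_ * _)%E; rewrite !ge0D//; try by move=> w; rewrite mulr_ge0.
    by rewrite I1 I2 I3 I4.
  - by apply/measurable_EFinP; exact: measurable_funD.
  - by move=> w _; rewrite lee_fin addr_ge0// mulr_ge0.
  - by apply/measurable_EFinP; exact: measurable_funD.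
  - by move=> w _; rewrite lee_fin addr_ge0// mulr_ge0.
have c_fin : (\int[P]_w (c' w)%:E)%E \is a fin_num.
  rewrite /c'; under eq_integral do rewrite EFinM.
  have m3 := measurable_funM mpW mnD; have m4 := measurable_funM mnW mpD.
  rewrite ge0_integralZl//; last 2 first.
  - by apply/measurable_EFinP; exact: measurable_funD.
  - by move=> w _; rewrite lee_fin addr_ge0// mulr_ge0.
  rewrite ge0D//; try by move=> w; rewrite mulr_ge0.
  have f1 : (\int[P]_w (pos_part (W w))%:E)%E \is a fin_num.
    by rewrite ge0_fin_numE// integral_ge0// => w _; rewrite lee_fin.
  have f2 : (\int[P]_w (pos_part (- W w))%:E)%E \is a fin_num.
    by rewrite ge0_fin_numE// integral_ge0// => w _; rewrite lee_fin.
  by rewrite I2 I3 fin_numM// fin_numD !fin_numM.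
have mS2 : measurable_fun setT (fun w => discrete_integral k w ^+ 2) by exact: measurable_funX.
have mzD : measurable_fun setT (fun w => z k w ^+ 2 * D w ^+ 2).
  by apply: measurable_funM; exact: measurable_funX.
have mS1 : measurable_fun setT (fun w => discrete_integral k.+1 w ^+ 2).
  by apply: measurable_funX; exact: discrete_integral_measurable.
have ppE (x : R) : x = pos_part x - pos_part (- x).
  rewrite /pos_part; case: (leP 0 x) => x0.
    by rewrite (max_idPr _) ?subr0// oppr_le0.
  by rewrite (max_idPl _) ?opprK ?add0r// oppr_ge0 ltW.
(* The part [c'] of the cross term that enters with a minus sign is moved to the left, which leaves
   an identity between nonnegative functions. Its integral is finite and equals that of [c], so that
   the two cancel. *)
have key w : discrete_integral k.+1 w ^+ 2 + c' w = discrete_integral k w ^+ 2 + c w + z k w ^+ 2 * D w ^+ 2.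
  rewrite trE -/(D w) /c /c'.
  have hD := ppE (D w); have hW := ppE (W w).
  have : discrete_integral k w * z k w * D w =
     (pos_part (W w) - pos_part (- W w)) * (pos_part (D w) - pos_part (- D w)).
    by rewrite -hD -hW.
  set p1 := pos_part (W w); set p2 := pos_part (- W w).
  set p3 := pos_part (D w); set p4 := pos_part (- D w) => E.
  have -> : (discrete_integral k w + z k w * D w) ^+ 2 = discrete_integral k w ^+ 2 +
     2 * (discrete_integral k w * z k w * D w) + z k w ^+ 2 * D w ^+ 2 by ring.
  by rewrite E; ring.
have total : (\int[P]_w (discrete_integral k.+1 w ^+ 2)%:E + \int[P]_w (c' w)%:E =
   \int[P]_w (discrete_integral k w ^+ 2)%:E + \int[P]_w (z k w ^+ 2)%:E * \int[P]_w (D w ^+ 2)%:E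
   + \int[P]_w (c' w)%:E)%E.
  rewrite -ge0D//; last by move=> w; exact: sqr_ge0.
  under eq_integral do rewrite key.
  rewrite ge0D//; last 3 first.
  - by move=> w; rewrite addr_ge0// sqr_ge0.
  - by move=> w; rewrite mulr_ge0 ?sqr_ge0.
  - exact: measurable_funD.
  rewrite ge0D//; last by move=> w; exact: sqr_ge0.
  by rewrite intc I5 addeAC.
have {}total : (\int[P]_w (discrete_integral k.+1 w ^+ 2)%:E = \int[P]_w (discrete_integral k w ^+ 2)%:E +
    \int[P]_w (z k w ^+ 2)%:E * \int[P]_w (D w ^+ 2)%:E)%E.
  by have := congr1 (fun x => x - \int[P]_w (c' w)%:E)%E total; rewrite /= !addeK.
rewrite total leeD//.
under [in leRHS]eq_integral do rewrite EFinM.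
rewrite ge0_integralZr//; last 3 first.
- by apply/measurable_EFinP; exact: measurable_funX.
- by move=> w _; rewrite lee_fin sqr_ge0.
- by rewrite lee_fin subr_ge0.
rewrite muleCA lee_wpmul2l//.
  by apply: integral_ge0 => w _; rewrite lee_fin sqr_ge0.
by rewrite -EFinM; exact: (increment_second_moment filtF BM).
Qed.

End martingale_transform.
End discrete_ito.

(** * Truncation of the integrand by its energy *)

Section truncation.
Context {R : realType} d (Omega : measurableType d) (P : probability Omega R).
Variables (T : R) (F : R -> set (set Omega)) (B : R -> Omega -> R).
Hypothesis filtF : filtration T F.
Hypothesis BM : brownian_motion P T F B.
Variables (u : nat -> R) (z : nat -> Omega -> R) (K : R).
Hypotheses (u0 : forall i, 0 <= u i) (uT : forall i, u i <= T).
Hypothesis (u_nd : forall i, u i <= u i.+1).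
Hypothesis (z_meas : forall i, measurable_fun setT (z i)).
Hypothesis (z_known : forall i, u i < u i.+1 -> known F (u i) (z i)).
Hypothesis (z_bound : forall i w, `|z i w| <= K).
Variable L : R.
Hypothesis L_ge0 : 0 <= L.

Local Notation bracket := (bracket u).

(* [bracket z i.+1] involves [z i] but no later value, so truncating preserves adaptedness. *)
Definition truncated i w := if bracket z i.+1 w <= L then z i w else 0.

Lemma bracket_nondecreasing i k w : (i <= k)%N -> bracket z i w <= bracket z k w.
Proof.
elim: k => [|k IH]; first by rewrite leqn0 => /eqP ->.
rewrite leq_eqVlt => /predU1P[->//|]; rewrite ltnS => /IH h; apply: (le_trans h).
by rewrite bracket_recr lerDl mulr_ge0 ?sqr_ge0// subr_ge0.
Qed.

Lemma u_nondecreasing i k : (i <= k)%N -> u i <= u k.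
Proof.
elim: k => [|k IH]; first by rewrite leqn0 => /eqP ->.
by rewrite leq_eqVlt => /predU1P[->//|]; rewrite ltnS => /IH h; exact: (le_trans h).
Qed.

Lemma bracket_known i : known F (u i) (bracket z i.+1).
Proof.
apply: measurable_sum => -[j ji] /=.
have ui : 0 <= u i <= T by rewrite u0 uT.
move: (u_nd j); rewrite le_eqVlt => /predU1P[<-|lt_u].
  by under eq_fun do rewrite subrr mulr0; exact: measurable_cst.
apply: measurable_funM => //; apply: measurable_funX.
apply: (known_le filtF (u0 j) _ (uT i) (@z_known j lt_u)).
by apply: u_nondecreasing; rewrite -ltnS.
Qed.

Lemma truncated_known i : u i < u i.+1 -> known F (u i) (truncated i).
Proof.
move=> lt_u; apply: measurable_fun_ifT.
- apply: measurable_fun_ler => //; exact: bracket_known.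
- exact: z_known.
- exact: measurable_cst.
Qed.

Lemma truncated_measurable i : measurable_fun setT (truncated i).
Proof.
apply: measurable_fun_ifT => //.
by apply: measurable_fun_ler => //; exact: bracket_measurable.
Qed.

Lemma truncated_bound i w : `|truncated i w| <= K.
Proof.
rewrite /truncated; case: ifP => // _; rewrite normr0.
exact: le_trans (z_bound i w).
Qed.

(** Both parts go through one induction: as long as the bracket stays below [L] nothing has been cut
    and the brackets agree, which yields the bound; beyond [L] every further term is 0. *)
Lemma bracket_truncated k w :
  (bracket z k w <= L -> bracket truncated k w = bracket z k w) /\
  bracket truncated k w <= L.
Proof.
elim: k => [|k [IH1 IH2]].
  by rewrite /bracket !big_ord0.
rewrite ![bracket _ k.+1 w]bracket_recr /truncated bracket_recr.
case: ifPn => h; last by rewrite expr0n mul0r addr0; split=> // h'; rewrite h' in h.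
split=> [_|].
  by rewrite IH1// (le_trans _ h)// lerDl mulr_ge0 ?sqr_ge0// subr_ge0.
by rewrite IH1// (le_trans _ h)// lerDl mulr_ge0 ?sqr_ge0// subr_ge0.
Qed.

Lemma bracket_truncated_le k w : bracket truncated k w <= bracket z k w.
Proof.
apply: ler_sum => i _; rewrite ler_wpM2r ?subr_ge0// /truncated.
by case: ifP => // _; rewrite expr0n sqr_ge0.
Qed.

Lemma discrete_integral_truncated k w : bracket z k w <= L ->
  discrete_integral B u truncated k w = discrete_integral B u z k w.
Proof.
move=> h; apply: eq_bigr => i _; rewrite /truncated ifT//.
by rewrite (le_trans _ h)// bracket_nondecreasing.
Qed.

End truncation.

(** * Increments of simple integrals as discrete integrals *)

Section simple.
Context {R : realType} d (Omega : measurableType d) (P : probability Omega R).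
Variables (T : R) (F : R -> set (set Omega)) (B : R -> Omega -> R).
Hypothesis filtF : filtration T F.
Variables (H : simple_process T F) (s t : R).
Hypotheses (s0 : 0 <= s) (st : s <= t) (tT : t <= T).

(** Constant beyond the last index, so that the times form an infinite nondecreasing sequence in
    [[0, T]], as [discrete_integral] expects. *)
Definition simple_grid i := sp_time H (minn i (sp_size H)).
(** The grid projected onto [[s, t]]; on it the increment of the simple integral from [s] to [t] is
    again a discrete integral. *)
Definition clamped i := Num.max s (Num.min t (simple_grid i)).
(** A simple process says nothing about its values beyond [sp_size]; they are set to 0 to have
    measurability and a bound at all indices. *)
Definition simple_value i w := if (i < sp_size H)%N then sp_val H i w else 0.

Lemma simple_grid_nd i : simple_grid i <= simple_grid i.+1.
Proof.
rewrite /simple_grid; have [lt_i|ge_i] := ltnP i (sp_size H).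
  by rewrite (minn_idPl lt_i) sp_time_le.
by rewrite (minn_idPr (leqW ge_i)).
Qed.

Lemma simple_grid_le i k : (i <= k)%N -> simple_grid i <= simple_grid k.
Proof.
elim: k => [|k IH]; first by rewrite leqn0 => /eqP ->.
rewrite leq_eqVlt => /predU1P[->//|]; rewrite ltnS => /IH h.
exact: (le_trans h (simple_grid_nd k)).
Qed.

Lemma simple_grid0 : simple_grid 0 = 0. Proof. by rewrite /simple_grid min0n sp_time0. Qed.
Lemma simple_grid_size : simple_grid (sp_size H) = T. Proof. by rewrite /simple_grid minnn sp_timeT. Qed.

Lemma simple_grid_bounds i : 0 <= simple_grid i <= T.
Proof.
rewrite -{1}simple_grid0 simple_grid_le//= -simple_grid_size.
have [le_i|ge_i] := leqP i (sp_size H); first exact: simple_grid_le.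
by rewrite /simple_grid (minn_idPr (ltnW ge_i)) minnn.
Qed.

Lemma clamped_ge0 i : 0 <= clamped i.
Proof. by rewrite le_max s0. Qed.

Lemma clamped_leT i : clamped i <= T.
Proof. by rewrite ge_max (le_trans st)// ge_min tT. Qed.

Lemma clamped_nd i : clamped i <= clamped i.+1.
Proof.
rewrite ge_max !le_max lexx/=; apply/orP; right.
by rewrite le_min !ge_min lexx/= simple_grid_nd orbT.
Qed.

(** The source of adaptedness: if the projected step is nondegenerate, the original time has not
    passed [t], so the projection has not moved it backwards and the value is known by then. *)
Lemma clamped_lt i : clamped i < clamped i.+1 -> simple_grid i <= clamped i /\ simple_grid i < t.
Proof.
rewrite /clamped => h; have gi : simple_grid i < t.
  rewrite ltNge; apply/negP => tg; move: h.
  by rewrite (min_idPl tg) (min_idPl (le_trans tg (simple_grid_nd i))) ltxx.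
by rewrite (min_idPr (ltW gi)) le_max lexx orbT.
Qed.

Lemma simple_value_known i : clamped i < clamped i.+1 -> known F (clamped i) (simple_value i).
Proof.
move=> /clamped_lt[gi _]; rewrite /simple_value.
have [lt_i|_] := ltnP i (sp_size H); last exact: measurable_cst.
apply: (known_le filtF _ gi (clamped_leT i)); first by case/andP: (simple_grid_bounds i).
apply: (proj2 (knownP filtF _ (simple_grid_bounds i))).
by rewrite /simple_grid (minn_idPl (ltnW lt_i)); exact: sp_adapted.
Qed.

Lemma simple_value_measurable i : measurable_fun setT (simple_value i).
Proof.
rewrite /simple_value; have [lt_i|_] := ltnP i (sp_size H); last exact: measurable_cst.
apply: (known_measurable filtF (simple_grid_bounds i)).
apply: (proj2 (knownP filtF _ (simple_grid_bounds i))).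
by rewrite /simple_grid (minn_idPl (ltnW lt_i)); exact: sp_adapted.
Qed.

Lemma simple_value_bounded : exists K, forall i w, `|simple_value i w| <= K.
Proof.
have [K HK] := sp_bounded H; exists (Num.max K 0) => i w; rewrite /simple_value.
by case: ifP => h; rewrite le_max ?normr0 ?lexx ?orbT// HK.
Qed.

Lemma simple_increment w :
  simple_integral H B t w - simple_integral H B s w =
  discrete_integral B clamped simple_value (sp_size H) w.
Proof.
rewrite /simple_integral /discrete_integral -sumrB; apply: eq_bigr => -[i lt_i] _ /=.
rewrite /simple_value lt_i -mulrBr; congr (_ * _).
have gE : sp_time H i = simple_grid i by rewrite /simple_grid (minn_idPl (ltnW lt_i)).
have gE' : sp_time H i.+1 = simple_grid i.+1 by rewrite /simple_grid (minn_idPl lt_i).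
rewrite gE gE' /clamped; have := simple_grid_nd i.
set a := simple_grid i; set b := simple_grid i.+1 => ab.
have [sa|as_] := leP s a; have [sb|bs] := leP s b.
- rewrite [Num.max s (Num.min t b)](max_idPr _); last by rewrite le_min st.
  rewrite [Num.max s (Num.min t a)](max_idPr _); last by rewrite le_min st.
  by rewrite subrr subr0.
- by have := lt_le_trans bs sa; rewrite ltNge ab.
- rewrite [Num.max s (Num.min t b)](max_idPr _); last by rewrite le_min st.
  rewrite [Num.min t a](min_idPr _); last by rewrite (le_trans (ltW as_)).
  rewrite [Num.max s a](max_idPl (ltW as_)); ring.
- rewrite [Num.min t b](min_idPr _); last by rewrite (le_trans (ltW bs)).
  rewrite [Num.min t a](min_idPr _); last by rewrite (le_trans (ltW as_)).
  by rewrite (max_idPl (ltW bs)) (max_idPl (ltW as_)); ring.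
Qed.

Lemma simple_eval_on i r w : (i < sp_size H)%N -> clamped i < r -> r <= clamped i.+1 ->
  simple_eval H r w = simple_value i w.
Proof.
move=> lt_i ir ri.
have sr : s < r by rewrite (le_lt_trans _ ir)// le_max lexx.
have [rt rg] : r <= t /\ r <= simple_grid i.+1.
  by move: ri; rewrite le_max leNgt sr/= le_min => /andP[].
have gr : simple_grid i < r.
  by move: ir; rewrite gt_max sr/= gt_min ltNge rt.
rewrite /simple_eval (bigD1 (Ordinal lt_i))//= big1 ?addr0.
  rewrite /simple_value lt_i indicE mem_set ?mulr1//= in_itv/=.
  by move: gr rg; rewrite /simple_grid (minn_idPl (ltnW lt_i)) (minn_idPl lt_i) => -> ->.
move=> [j lt_j] /= ji; rewrite indicE memNset ?mulr0//= in_itv/= => /andP[h1 h2].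
have gE : sp_time H j = simple_grid j by rewrite /simple_grid (minn_idPl (ltnW lt_j)).
have gE' : sp_time H j.+1 = simple_grid j.+1 by rewrite /simple_grid (minn_idPl lt_j).
have := ji; rewrite -val_eqE/= neq_ltn => /orP[jl|jl].
  have := le_trans h2 _; rewrite gE' => /(_ _ (simple_grid_le jl)).
  by rewrite leNgt gr.
have := le_lt_trans (simple_grid_le jl); rewrite -gE => /(_ _ h1).
by rewrite ltNge rg.
Qed.

Lemma clamped0 : clamped 0 = s.
Proof. by rewrite /clamped simple_grid0 (min_idPr _) ?(le_trans s0)// (max_idPl s0). Qed.

Lemma clamped_size : clamped (sp_size H) = t.
Proof. by rewrite /clamped simple_grid_size (min_idPl tT) (max_idPr st). Qed.

Lemma measurable_simple_eval w : measurable_fun setT (fun r => simple_eval H r w).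
Proof.
apply: measurable_sum => i; apply: measurable_funM => //.
Qed.

Lemma bracket_integral k w : (k <= sp_size H)%N ->
  ((bracket clamped simple_value k w)%:E =
   \int[@lebesgue_measure R]_(r in `]s, clamped k]) (simple_eval H r w ^+ 2)%:E)%E.
Proof.
elim: k => [_|k IH lt_k].
  by rewrite /bracket big_ord0 clamped0 set_itvoc0 integral_set0.
rewrite bracket_recr EFinD IH; last exact: ltnW.
have sk : s <= clamped k by rewrite le_max lexx.
have -> : `]s, clamped k.+1]%classic = `]s, clamped k] `|` `]clamped k, clamped k.+1].
  rewrite -itv_bndbnd_setU//; rewrite bnd_simp//; exact: clamped_nd.
have mE : measurable_fun setT (fun r => (simple_eval H r w ^+ 2)%:E).
  by apply/measurable_EFinP; apply: measurable_funX; exact: measurable_simple_eval.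
rewrite ge0_integral_setU//.
- congr (_ + _)%E; transitivity (\int[@lebesgue_measure R]_(r in `]clamped k, clamped k.+1])
     (simple_value k w ^+ 2)%:E)%E.
    rewrite integral_cst//= lebesgue_measure_itv/= lte_fin.
    have := clamped_nd k; rewrite le_eqVlt => /predU1P[<-|lt_c].
      by rewrite ltxx mule0 subrr mulr0.
    by rewrite lt_c -EFinM.
  apply: eq_integral => r; rewrite inE/= in_itv/= => /andP[h1 h2].
  by rewrite (simple_eval_on _ lt_k h1 h2).
- exact: measurable_funS mE.
- by move=> r _; rewrite lee_fin sqr_ge0.
- apply/disj_set2P; rewrite -subset0 => r [] /=; rewrite !in_itv/= => /andP[_ h1] /andP[h2 _].
  by have := lt_le_trans h2 h1; rewrite ltxx.
Qed.

End simple.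

Section partial_integral.
Context {R : realType} d1 d2 (T1 : measurableType d1) (T2 : measurableType d2).
Variables (m1 : {sigma_finite_measure set T1 -> \bar R})
  (m2 : {sigma_finite_measure set T2 -> \bar R}).
Variables (f : T1 * T2 -> \bar R) (D : set T2).
Hypotheses (mD : measurable D) (mf : measurable_fun setT f) (f0 : forall p, (0 <= f p)%E).

Let g (p : T1 * T2) := (f p * (\1_D p.2)%:E)%E.

Let mg : measurable_fun setT g.
Proof.
apply: emeasurable_funM => //; apply/measurable_EFinP.
by apply: measurableT_comp => //; exact: measurable_snd.
Qed.

Let g0 p : (0 <= g p)%E. Proof. by rewrite mule_ge0// lee_fin. Qed.

Let gE w : (\int[m2]_(r in D) f (w, r) = \int[m2]_r g (w, r))%E.
Proof.
rewrite integral_mkcond; apply: eq_integral => r _.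
by rewrite epatch_indic.
Qed.

Lemma measurable_partial_integral :
  measurable_fun setT (fun w => \int[m2]_(r in D) f (w, r))%E.
Proof.
under eq_fun do rewrite gE.
exact: (@measurable_fun_fubini_tonelli_F _ _ _ _ _ m2 g mg g0).
Qed.

Lemma tonelli_partial :
  (\int[m1]_w \int[m2]_(r in D) f (w, r) = \int[m2]_(r in D) \int[m1]_w f (w, r))%E.
Proof.
under eq_integral do rewrite gE.
rewrite (@fubini_tonelli _ _ _ _ _ m1 m2 g mg g0) [RHS]integral_mkcond.
apply: eq_integral => r _; rewrite epatch_indic -ge0_integralZr//.
  by apply: measurableT_comp.
by rewrite lee_fin.
Qed.

End partial_integral.

(** * Second moments of increments of Ito integrals *)

Section ito_bound.
Context {R : realType} d (Omega : measurableType d) (P : probability Omega R).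
Variables (T : R) (F : R -> set (set Omega)) (B : R -> Omega -> R).
Hypothesis filtF : filtration T F.
Hypothesis BM : brownian_motion P T F B.
Local Notation leb := (@lebesgue_measure R).
Variables (sigma : R -> Omega -> R) (Sig : Omega * measurableTypeR R -> R).
Hypothesis mSig : measurable_fun setT Sig.
Hypothesis SigE : forall r w, 0 <= r <= T -> Sig (w, r) = sigma r w.
Variables (s t : R).
Hypotheses (s0 : 0 <= s) (st : s <= t) (tT : t <= T).

(** [Sig] is a jointly measurable function that agrees with [sigma] on [[0, T]]; with it the energy
    is measurable in [w] and Tonelli's theorem applies. *)
Definition energy w := (\int[leb]_(r in `]s, t]) (Sig (w, r) ^+ 2)%:E)%E.

Lemma measurable_energy : measurable_fun setT energy.
Proof.
apply: (@measurable_partial_integral _ _ _ _ _ leb (fun p => (Sig p ^+ 2)%:E)) => //.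
- by apply/measurable_EFinP; exact: measurable_funX.
- by move=> p; rewrite lee_fin sqr_ge0.
Qed.

Lemma energy_ge0 w : (0 <= energy w)%E.
Proof. by apply: integral_ge0 => r _; rewrite lee_fin sqr_ge0. Qed.

Section step.
Variable H : simple_process T F.

Definition discrepancy w :=
  (\int[leb]_(r in `[0%R, T]) ((simple_eval H r w - Sig (w, r)) ^+ 2)%:E)%E.

Lemma measurable_simple_eval2 :
  measurable_fun setT (fun p : Omega * measurableTypeR R => simple_eval H p.2 p.1).
Proof.
apply: measurable_sum => -[i lt_i] /=; apply: measurable_funM.
  have mv : measurable_fun setT (sp_val H i).
    by have := simple_value_measurable filtF H i; rewrite /simple_value lt_i.
  by apply: measurableT_comp => //; exact: measurable_fst.
have mI : measurable_fun setT (\1_(`]sp_time H i, sp_time H i.+1]) : measurableTypeR R -> R).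
  exact: measurable_indic.
by apply: (measurableT_comp mI); exact: measurable_snd.
Qed.

Lemma measurable_discrepancy : measurable_fun setT discrepancy.
Proof.
apply: (@measurable_partial_integral _ _ _ _ _ leb
   (fun p => ((simple_eval H p.2 p.1 - Sig p) ^+ 2)%:E)) => //.
- apply/measurable_EFinP; apply: measurable_funX; apply: measurable_funB => //.
  exact: measurable_simple_eval2.
- by move=> p; rewrite lee_fin sqr_ge0.
Qed.

Lemma discrepancyE w :
  discrepancy w = (\int[leb]_(r in `[0%R, T]) ((simple_eval H r w - sigma r w) ^+ 2)%:E)%E.
Proof. by apply: eq_integral => r; rewrite inE/= in_itv/= => /SigE ->. Qed.

Lemma bracket_energy w :
  ((bracket (clamped H s t) (simple_value H) (sp_size H) w)%:E <=
   2%:E * discrepancy w + 2%:E * energy w)%E.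
Proof.
rewrite (bracket_integral s0 st)// clamped_size//.
have mE : measurable_fun setT (fun r => simple_eval H r w).
  exact: measurable_simple_eval.
have mS : measurable_fun setT (fun r : measurableTypeR R => Sig (w, r)).
  exact: measurableT_comp.
have -> : (2%:E * energy w =
    \int[leb]_(r in `]s, t]) (2 * Sig (w, r) ^+ 2)%:E)%E.
  rewrite -ge0_integralZl//.
  - by apply: measurable_funTS; apply/measurable_EFinP; exact: measurable_funX.
  - by move=> r _; rewrite lee_fin sqr_ge0.
apply: (@le_trans _ _ (\int[leb]_(r in `]s, t]) (2 * (simple_eval H r w - Sig (w, r)) ^+ 2)%:E +
   \int[leb]_(r in `]s, t]) (2 * Sig (w, r) ^+ 2)%:E)%E).
  rewrite -ge0_integralD//.
  - apply: ge0_le_integral => //.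
    + by move=> r _; rewrite lee_fin sqr_ge0.
    + apply: measurable_funTS; apply/measurable_EFinP; exact: measurable_funX.
    + apply: emeasurable_funD; apply: measurable_funTS; apply/measurable_EFinP;
        apply: measurable_funM => //; apply: measurable_funX => //.
      exact: measurable_funB.
    + move=> r _; rewrite -EFinD lee_fin.
      set x := simple_eval _ _ _; set y := Sig _.
      have := sqr_ge0 (x - 2 * y); nra.
  - by move=> r _; rewrite lee_fin mulr_ge0// sqr_ge0.
  - apply: measurable_funTS; apply/measurable_EFinP;
        apply: measurable_funM => //; apply: measurable_funX => //.
    exact: measurable_funB.
  - by move=> r _; rewrite lee_fin mulr_ge0// sqr_ge0.
  - by apply: measurable_funTS; apply/measurable_EFinP;
        apply: measurable_funM => //; apply: measurable_funX.
apply: leeD => //.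
have mD : measurable_fun setT (fun r : measurableTypeR R => ((simple_eval H r w - Sig (w, r)) ^+ 2)%:E).
  by apply/measurable_EFinP; apply: measurable_funX; exact: measurable_funB.
under eq_integral do rewrite EFinM.
rewrite ge0_integralZl//.
- apply: lee_wpmul2l => //; apply: ge0_subset_integral => //.
  + exact: measurable_funTS.
  + by move=> r _; rewrite lee_fin sqr_ge0.
  + move=> r /=; rewrite !in_itv/= => /andP[h1 h2].
    by rewrite (le_trans s0 (ltW h1)) (le_trans h2).
- exact: measurable_funTS.
- by move=> r _; rewrite lee_fin sqr_ge0.
Qed.

Variables (J : R -> Omega -> R) (a eps dlt L Kc : R).
Hypotheses (mJs : measurable_fun setT (J s)) (mJt : measurable_fun setT (J t)).
Hypothesis energy_le : (\int[P]_w energy w <= a%:E)%E.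
Hypotheses (eps0 : 0 < eps) (dlt0 : 0 < dlt) (L0 : 0 < L) (Kc0 : 0 < Kc).
Hypothesis discrepancy_small : (P [set w | eps%:E <= discrepancy w] <= dlt%:E)%E.
Hypothesis increment_small_s :
  (P [set w | (eps <= `|simple_integral H B s w - J s w|)%R] <= dlt%:E)%E.
Hypothesis increment_small_t :
  (P [set w | (eps <= `|simple_integral H B t w - J t w|)%R] <= dlt%:E)%E.

Let far r := [set w | eps <= `|simple_integral H B r w - J r w|].
Let rough := [set w | (eps%:E <= discrepancy w)%E].
Let bad := far s `|` far t `|` rough.
Let V := discrete_integral B (clamped H s t) (simple_value H) (sp_size H).
Let V' := discrete_integral B (clamped H s t)
  (truncated (clamped H s t) (simple_value H) L) (sp_size H).
Let br := bracket (clamped H s t) (simple_value H) (sp_size H).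
Let br' := bracket (clamped H s t)
  (truncated (clamped H s t) (simple_value H) L) (sp_size H).
Let cnd := clamped_nd H s t.
Let c0 := clamped_ge0 H t s0.
Let cT := clamped_leT H st tT.
Let zk := @simple_value_known _ _ _ _ _ filtF H _ _ st tT.
Let zm := simple_value_measurable filtF H.

Let m_integral r : 0 <= r <= T -> measurable_fun setT (simple_integral H B r).
Proof.
move=> rT; apply: measurable_sum => -[i lt_i] /=.
have [h0 hT] := andP rT.
have mB q : 0 <= q <= T -> measurable_fun setT (B (Num.min r q)).
  move=> /andP[q0 qT]; apply: (measurable_B filtF BM).
  by rewrite le_min h0 q0 ge_min hT.
have gE : sp_time H i = simple_grid H i by rewrite /simple_grid (minn_idPl (ltnW lt_i)).
have gE' : sp_time H i.+1 = simple_grid H i.+1 by rewrite /simple_grid (minn_idPl lt_i).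
apply: measurable_funM.
  by have := simple_value_measurable filtF H i; rewrite /simple_value lt_i.
by apply: measurable_funB; rewrite ?gE ?gE'; apply: mB; exact: simple_grid_bounds.
Qed.

Let m_far r : 0 <= r <= T -> measurable_fun setT (J r) -> measurable (far r).
Proof.
move=> rT mJ; rewrite -[far r]setTI; apply: measurable_fun_le => //.
by apply: measurableT_comp => //; apply: measurable_funB => //; exact: m_integral.
Qed.

Let m_rough : measurable rough.
Proof.
rewrite -[rough]setTI; apply: emeasurable_fun_c_infty => //.
exact: measurable_discrepancy.
Qed.

Let sT : 0 <= s <= T. Proof. by rewrite s0 (le_trans st). Qed.
Let tT' : 0 <= t <= T. Proof. by rewrite tT (le_trans s0). Qed.

Let m_bad : measurable bad.
Proof. by apply: measurableU => //; apply: measurableU; exact: m_far. Qed.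

Let P_bad : (P bad <= (3 * dlt)%:E)%E.
Proof.
apply: (le_trans (measureU2 P _ m_rough)); first by apply: measurableU; exact: m_far.
apply: (@le_trans _ _ (dlt%:E + dlt%:E + dlt%:E)%E); last first.
  by rewrite -!EFinD lee_fin; lra.
apply: leeD => //; apply: (le_trans (measureU2 P _ _)); try exact: m_far.
by apply: leeD.
Qed.

Let P_rough : (P rough <= (3 * dlt)%:E)%E.
Proof. by apply: (le_trans discrepancy_small); rewrite lee_fin ler_peMl ?ler1n// ltW. Qed.

Let br_ge0 w : 0 <= br w.
Proof. exact: bracket_ge0. Qed.

(** Outside [rough] the truncation is given up and the bracket is compared with the true energy. On
    [rough], where that comparison fails, the truncation caps the bracket by [L], and the event has
    small probability. *)
Let br'_bound w : ((br' w)%:E <= (2 * eps + L * \1_rough w)%:E + 2%:E * energy w)%E.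
Proof.
have [br1 br2] := bracket_truncated (simple_value H) cnd (ltW L0) (sp_size H) w.
have [E|E] := pselect (rough w).
  rewrite indicE mem_set// mulr1 -[leLHS]addr0 leeD ?mule_ge0 ?energy_ge0//.
  by rewrite lee_fin (le_trans br2)// lerDr mulr_ge0// ltW.
rewrite indicE memNset// mulr0 addr0.
apply: le_trans (le_trans (bracket_energy w) _).
  by rewrite lee_fin; exact: bracket_truncated_le.
rewrite leeD2r// EFinM lee_wpmul2l// ltW// ltNge.
exact/negP.
Qed.

(** Three cases. On [bad] the cut-off [Kc] is the bound. Otherwise, if the bracket is at most [L],
    the truncated integral is the actual one and lies within [2 eps] of the increment of [J]. If the
    bracket exceeds [L], then [Kc <= Kc / L * br w] in the manner of Markov's inequality, and the
    bracket is bounded by the energy. *)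
Let pointwise w : ((Num.min Kc ((J t w - J s w) ^+ 2))%:E <=
  (2 * V' w ^+ 2)%:E + (8 * eps ^+ 2 + Kc / L * (2 * eps) + Kc * \1_bad w)%:E
   + (Kc / L * 2)%:E * energy w)%E.
Proof.
have KL0 : 0 < Kc / L by rewrite divr_gt0.
have e2 : 0 <= eps ^+ 2 by exact: sqr_ge0.
have V2 : 0 <= V' w ^+ 2 by exact: sqr_ge0.
have e3 : 0 <= Kc / L * (2 * eps) by rewrite (mulr_ge0 (ltW KL0))// mulr_ge0// ltW.
have en : (0 <= (Kc / L * 2)%:E * energy w)%E.
  by rewrite mule_ge0 ?energy_ge0// lee_fin mulr_ge0// ltW.
have [E|E] := pselect (bad w).
  rewrite indicE mem_set// mulr1 -[leLHS]addr0 leeD// -EFinD lee_fin.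
  by rewrite ge_min; apply/orP; left; lra.
rewrite indicE memNset// mulr0 addr0.
have [fs ft nr] : [/\ `|simple_integral H B s w - J s w| < eps,
    `|simple_integral H B t w - J t w| < eps & (discrepancy w < eps%:E)%E].
  by split; rewrite ltNge; apply/negP => h; apply: E; [left; left|left; right|right].
have [brL|brL] := leP (br w) L.
  rewrite -[leLHS]addr0 leeD// -EFinD lee_fin ge_min; apply/orP; right.
  have -> : V' w = V w by exact: discrete_integral_truncated.
  have VE := simple_increment B H st w; rewrite -/V in VE.
  set D := J t w - J s w; have VD : `|V w - D| <= 2 * eps.
    rewrite -[V w]VE /D.
    rewrite [X in `|X|](_ : _ = (simple_integral H B t w - J t w)
       - (simple_integral H B s w - J s w)); last by ring.
    by rewrite (le_trans (ler_normB _ _))//; lra.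
  have : (V w - D) ^+ 2 <= (2 * eps) ^+ 2.
    rewrite -real_normK ?num_real// lerXn2r// nnegrE//.
    by rewrite mulr_ge0// ltW.
  have := sqr_ge0 (2 * V w - D); nra.
apply: (@le_trans _ _ (Kc / L * br w)%:E).
  rewrite lee_fin ge_min; apply/orP; left.
  by rewrite -mulrA ler_peMr ?(ltW Kc0)// mulrC ler_pdivlMr// mul1r ltW.
rewrite EFinM; apply: (@le_trans _ _ ((Kc / L)%:E * (2%:E * eps%:E + 2%:E * energy w))%E).
  rewrite lee_wpmul2l ?lee_fin ?(ltW KL0)//.
  by apply: (le_trans (bracket_energy w)); rewrite leeD2r// lee_wpmul2l// ltW.
rewrite ge0_muleDr ?mule_ge0 ?energy_ge0 ?lee_fin ?(ltW eps0)//.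
rewrite (muleA (Kc / L)%:E 2%:E (energy w)) -!EFinM; apply: leeD => //.
by rewrite -EFinD lee_fin; lra.
Qed.

Let m_V' : measurable_fun setT V'.
Proof.
apply: (discrete_integral_measurable filtF BM) => //.
by move=> i; exact: (truncated_known filtF c0 cT cnd zk).
Qed.

Let m_br' : measurable_fun setT br'.
Proof. by apply: bracket_measurable => i; exact: truncated_measurable. Qed.

Let V'_second_moment :
  (\int[P]_w (V' w ^+ 2)%:E <= (8 * (2 * eps + L * (3 * dlt) + 2 * a))%:E)%E.
Proof.
have [K HK] := simple_value_bounded H.
apply: (@le_trans _ _ (8%:E * \int[P]_w (br' w)%:E)%E).
  apply: (discrete_integral_second_moment filtF BM (K := K)) => //.
  - by move=> i; exact: truncated_measurable.
  - by move=> i; exact: (truncated_known filtF c0 cT cnd zk).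
  - by move=> i w; exact: truncated_bound.
rewrite EFinM lee_wpmul2l//.
have mL : measurable_fun setT (fun w => (2 * eps + L * \1_rough w)%:E).
  by apply/measurable_EFinP; apply: measurable_funD => //; exact: measurable_funM.
apply: (@le_trans _ _ (\int[P]_w ((2 * eps + L * \1_rough w)%:E + 2%:E * energy w))%E).
  apply: ge0_le_integral => //.
  - by move=> w _; rewrite lee_fin; exact: bracket_ge0.
  - exact/measurable_EFinP.
  - by apply: emeasurable_funD => //; apply: measurable_funeM; exact: measurable_energy.
have L1 w : 0 <= 2 * eps + L * \1_rough w.
  by rewrite addr_ge0// mulr_ge0// ltW.
rewrite ge0_integralD//; last 3 first.
- by move=> w _; rewrite lee_fin.
- by move=> w _; rewrite mule_ge0// energy_ge0.
- by apply: measurable_funeM; exact: measurable_energy.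
rewrite [leRHS]EFinD; apply: leeD.
  under eq_integral do rewrite EFinD.
  rewrite ge0_integralD//; last 3 first.
  - by move=> w _; rewrite lee_fin mulr_ge0// ltW.
  - by move=> w _; rewrite lee_fin mulr_ge0// ltW.
  - by apply/measurable_EFinP; exact: measurable_funM.
  rewrite integral_cst// [X in (_ * X)%E]probability_setT mule1 EFinD leeD2l//.
  under eq_integral do rewrite EFinM.
  rewrite ge0_integralZl//; last 2 first.
  - by apply/measurable_EFinP.
  - by rewrite lee_fin ltW.
  by rewrite integral_indic// setIT EFinM lee_wpmul2l ?lee_fin ?(ltW L0).
rewrite ge0_integralZl//; last 2 first.
- exact: measurable_energy.
- by move=> w _; exact: energy_ge0.
by rewrite EFinM lee_wpmul2l.
Qed.

(* The simple processes only converge in probability, so that their own second moments are not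
   controlled: the increment is cut off at [Kc] and the energy at [L]. *)
Lemma ito_step : (\int[P]_w (Num.min Kc ((J t w - J s w) ^+ 2))%:E <=
  (16 * (2 * eps + L * (3 * dlt) + 2 * a) + 8 * eps ^+ 2 + Kc / L * (2 * eps)
   + Kc * (3 * dlt) + Kc / L * 2 * a)%:E)%E.
Proof.
have KL0 : 0 < Kc / L by rewrite divr_gt0.
have cst0 w : 0 <= 8 * eps ^+ 2 + Kc / L * (2 * eps) + Kc * \1_bad w.
  by rewrite ?addr_ge0 ?(mulr_ge0 (ltW KL0)) ?mulr_ge0 ?sqr_ge0 ?(ltW Kc0) ?(ltW eps0).
have cst1 : 0 <= 8 * eps ^+ 2 + Kc / L * (2 * eps) .
  by rewrite ?addr_ge0 ?(mulr_ge0 (ltW KL0)) ?mulr_ge0 ?sqr_ge0 ?(ltW Kc0) ?(ltW eps0).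
have mV2 : measurable_fun setT (fun w => (2 * V' w ^+ 2)%:E).
  by apply/measurable_EFinP; apply: measurable_funM => //; exact: measurable_funX.
have mc : measurable_fun setT
   (fun w => (8 * eps ^+ 2 + Kc / L * (2 * eps) + Kc * \1_bad w)%:E).
  by apply/measurable_EFinP; apply: measurable_funD => //; exact: measurable_funM.
have V0 w : 0 <= 2 * V' w ^+ 2 by rewrite mulr_ge0 ?sqr_ge0.
have en w : (0 <= (Kc / L * 2)%:E * energy w)%E.
  by rewrite mule_ge0 ?energy_ge0// lee_fin mulr_ge0// ltW.
have me : measurable_fun setT (fun w => (Kc / L * 2)%:E * energy w)%E.
  by apply: measurable_funeM; exact: measurable_energy.
apply: (@le_trans _ _ (\int[P]_w ((2 * V' w ^+ 2)%:E +
  (8 * eps ^+ 2 + Kc / L * (2 * eps) + Kc * \1_bad w)%:E + (Kc / L * 2)%:E * energy w))%E).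
  apply: ge0_le_integral => //.
  - by move=> w _; rewrite lee_fin le_min (ltW Kc0) sqr_ge0.
  - apply/measurable_EFinP; apply: measurable_minr => //.
    by apply: measurable_funX; exact: measurable_funB.
  - by apply: emeasurable_funD => //; exact: emeasurable_funD.
rewrite ge0_integralD//; last 2 first.
- by move=> w _; rewrite adde_ge0 ?lee_fin.
- exact: emeasurable_funD.
rewrite ge0_integralD//; last 2 first.
- by move=> w _; rewrite lee_fin.
- by move=> w _; rewrite lee_fin.
rewrite [leRHS](_ : _ = (16 * (2 * eps + L * (3 * dlt) + 2 * a))%:E +
   (8 * eps ^+ 2 + Kc / L * (2 * eps) + Kc * (3 * dlt))%:E + (Kc / L * 2 * a)%:E)%E; last first.
  by rewrite -!EFinD; congr _%:E; ring.
apply: leeD; first apply: leeD.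
- under eq_integral do rewrite EFinM.
  rewrite ge0_integralZl//; last 2 first.
  + by apply/measurable_EFinP; exact: measurable_funX.
  + by move=> w _; rewrite lee_fin sqr_ge0.
  apply: (@le_trans _ _ (2%:E * (8 * (2 * eps + L * (3 * dlt) + 2 * a))%:E)%E).
    by rewrite lee_wpmul2l.
  by rewrite -EFinM lee_fin; lra.
- under eq_integral do rewrite EFinD.
  rewrite ge0_integralD//; last 2 first.
  + by move=> w _; rewrite lee_fin mulr_ge0// ltW.
  + by apply/measurable_EFinP; exact: measurable_funM.
  rewrite integral_cst// [X in (_ * X)%E]probability_setT mule1 [leRHS]EFinD leeD2l//.
  under eq_integral do rewrite EFinM.
  rewrite ge0_integralZl//; last 2 first.
  + by apply/measurable_EFinP.
  + by rewrite lee_fin ltW.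
  by rewrite integral_indic// setIT EFinM lee_wpmul2l ?lee_fin ?(ltW Kc0).
- rewrite ge0_integralZl//; last 3 first.
  + exact: measurable_energy.
  + by move=> w _; exact: energy_ge0.
  + by rewrite lee_fin mulr_ge0// ltW.
  by rewrite [leRHS]EFinM lee_wpmul2l// lee_fin mulr_ge0// ltW.
Qed.

End step.

Let eventually_small (p : nat -> \bar R) e : p n @[n --> \oo] --> 0%E -> 0 < e ->
  \forall n \near \oo, (p n <= e%:E)%E.
Proof.
move=> /fine_cvgP[p_fin p0] e0.
have p_le : \forall n \near \oo, (fine \o p) n <= e by exact: (cvgr_le (0 : R) p0).
near=> n; rewrite -(@fineK _ (p n)); last by near: n.
by rewrite lee_fin; near: n.
Unshelve. all: by end_near. Qed.

Lemma ito_second_moment (J : R -> Omega -> R) (a : R) : 0 <= a ->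
  ito_integral P T F B sigma J -> (\int[P]_w energy w <= a%:E)%E ->
  (\int[P]_w ((J t w - J s w) ^+ 2)%:E <= (32 * a)%:E)%E.
Proof.
move=> a0 [aJ cJ [Hm [Hm1 Hm2]]] ea.
have sT : 0 <= s <= T by rewrite s0 (le_trans st).
have tT' : 0 <= t <= T by rewrite tT (le_trans s0).
have mJ r : 0 <= r <= T -> measurable_fun setT (J r).
  by move=> rT; apply: (known_measurable filtF rT); apply/(knownP filtF _ rT); exact: aJ.
pose D2 w := (J t w - J s w) ^+ 2.
have mD2 : measurable_fun setT D2.
  by apply: measurable_funX; apply: measurable_funB; exact: mJ.
(* The bound is shown for the increment cut off at [n.+1], uniformly in [n]. *)
apply: (@fatou_bound _ _ _ _ (fun n w => (Num.min n.+1%:R (D2 w))%:E)).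
- by move=> n; apply/measurable_EFinP; exact: measurable_minr.
- by move=> n w; rewrite lee_fin le_min ler0n sqr_ge0.
- move=> w; apply/fine_cvgP; split; first exact: nearW.
  apply: cvg_near_cst; near=> n => /=; apply/min_idPr.
  rewrite (le_trans (ltW (truncnS_gt _)))// ler_nat ltnS.
  by near: n; exact: nbhs_infty_ge.
move=> n; set Kc : R := n.+1%:R.
have Kc0 : 0 < Kc by rewrite ltr0n.
apply/lee_addgt0Pr => r r0.
(* With the cut-off [Kc] fixed, [L] is chosen so that [Kc / L = e], and then [dl] so that the terms
   containing it add up to [e]. The bound of [ito_step] becomes
   [e + 32 e + 32 a + 10 e ^ 2 + 2 a e], at most [32 a + (43 + 2 a) e]; the index [m] of the simple
   process is taken last. *)
pose e := Num.min 1 (r / (43 + 2 * a)).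
have c0 : 0 < 43 + 2 * a by rewrite ltr_pwDl// mulr_ge0.
have e0 : 0 < e by rewrite lt_min ltr01 divr_gt0.
have e1 : e <= 1 by rewrite ge_min lexx.
have er : (43 + 2 * a) * e <= r by rewrite mulrC -ler_pdivlMr// ge_min lexx orbT.
pose L := Kc / e; have L0 : 0 < L by rewrite divr_gt0.
pose dl := e / (48 * L + 3 * Kc).
have dd0 : 0 < 48 * L + 3 * Kc by rewrite addr_gt0// mulr_gt0.
have dl0 : 0 < dl by rewrite divr_gt0.
have small r' : 0 <= r' <= T -> \forall m \near \oo,
    (P [set w | (e <= `|simple_integral (Hm m) B r' w - J r' w|)%R] <= dl%:E)%E.
  by move=> rT; apply: eventually_small dl0; exact: Hm2.
have small' : \forall m \near \oo, (P [set w | (e%:E <= discrepancy (Hm m) w)%E] <= dl%:E)%E.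
  apply: eventually_small dl0; apply: cvg_trans (Hm1 _ e0).
  apply: near_eq_cvg; apply: nearW => m.
  by congr (P _); apply/funext => w; rewrite /= discrepancyE.
have [m [m1 m2 m3]] : exists m,
   [/\ (P [set w | (e <= `|simple_integral (Hm m) B s w - J s w|)%R] <= dl%:E)%E,
       (P [set w | (e <= `|simple_integral (Hm m) B t w - J t w|)%R] <= dl%:E)%E &
       (P [set w | (e%:E <= discrepancy (Hm m) w)%E] <= dl%:E)%E].
  near \oo => m; exists m; split; near: m; [exact: small|exact: small|exact: small'].
apply: (le_trans (ito_step (mJ s sT) (mJ t tT') ea e0 dl0 L0 Kc0 m3 m1 m2)).
rewrite -EFinD lee_fin.
have KL : Kc / L = e by rewrite /L invfM invrK mulrA mulfV ?mul1r// gt_eqF.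
have dlE : 16 * (L * (3 * dl)) + Kc * (3 * dl) = e.
  have -> : 16 * (L * (3 * dl)) + Kc * (3 * dl) = (48 * L + 3 * Kc) * dl by ring.
  by rewrite /dl mulrCA mulfV ?mulr1// gt_eqF.
rewrite KL.
have ee : e ^+ 2 <= e by rewrite expr2 ler_piMl// ltW.
have -> : 16 * (2 * e + L * (3 * dl) + 2 * a) + 8 * e ^+ 2 + e * (2 * e) + Kc * (3 * dl) + e * 2 * a
  = (16 * (L * (3 * dl)) + Kc * (3 * dl)) + 32 * e + 32 * a + 10 * e ^+ 2 + 2 * a * e by ring.
by rewrite dlE; nra.
Unshelve. all: by end_near. Qed.

End ito_bound.

(** * Joint measurability of volatility and drift *)

Section measurable_processes.
Context {R : realType} d (Omega : measurableType d) (T : R).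
Variable F : R -> set (set Omega).
Hypothesis filtF : filtration T F.
Hypothesis T0 : 0 <= T.

Definition clamp (r : R) := Num.max 0 (Num.min T r).

Lemma clamp_bounds r : 0 <= clamp r <= T.
Proof. by rewrite le_max lexx/= ge_max T0 ge_min lexx. Qed.

Lemma clamp_id r : 0 <= r <= T -> clamp r = r.
Proof. by move=> /andP[r0 rT]; rewrite /clamp (min_idPr rT) (max_idPr r0). Qed.

Lemma measurable_clamp : measurable_fun setT (clamp : measurableTypeR R -> R).
Proof.
by apply: measurable_maxr => //; apply: measurable_minr => //; exact: measurable_id.
Qed.

(* Points approaching [clamp r] strictly from the right, as right-continuity requires. *)
Definition right_approx (m : nat) (r : R) :=
  Num.min T ((Num.truncn (clamp r * m.+1%:R)).+1%:R / m.+1%:R).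

Lemma right_approx_gt m r : clamp r < T -> clamp r < right_approx m r.
Proof.
by move=> rT; rewrite lt_min rT/= ltr_pdivlMr ?ltr0n// truncnS_gt.
Qed.

Lemma right_approx_le m r : right_approx m r <= clamp r + m.+1%:R^-1.
Proof.
have /andP[r0 _] := clamp_bounds r.
rewrite ge_min; apply/orP; right; rewrite ler_pdivrMr ?ltr0n// mulrDl mulVf ?pnatr_eq0//.
by rewrite -addn1 natrD lerD2r truncn_le mulr_ge0.
Qed.

Lemma cvg_right_approx (f : R -> R) r : cadlag T f ->
  f (right_approx m r) @[m --> \oo] --> f (clamp r).
Proof.
move=> [fr _]; have /andP[r0 rT] := clamp_bounds r.
(* At time [T] right-continuity says nothing, but there the minimum with [T] makes the approximation
   constant. *)
move: rT; rewrite le_eqVlt => /predU1P[rT|rT].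
  have -> : (fun m => f (right_approx m r)) = cst (f (clamp r)); last exact: cvg_cst.
  apply/funext => m; rewrite /right_approx rT (min_idPl _)//=.
  by rewrite ler_pdivlMr ?ltr0n// ltW// truncnS_gt.
have h0 : 0 <= clamp r < T by rewrite r0 rT.
have /cvg_at_rightP h := fr _ h0.
apply: h => //; split; first by move=> m; exact: right_approx_gt.
apply: (@squeeze_cvgr _ _ _ _ (cst (clamp r)) (fun m => clamp r + m.+1%:R^-1)).
- by apply: nearW => m; rewrite (ltW (right_approx_gt m rT)) right_approx_le.
- exact: cvg_cst.
- rewrite -[X in _ --> X]addr0; apply: cvgD; [exact: cvg_cst|exact: cvg_harmonic].
Qed.

(** Sampled at the times [right_approx m], the process is a finite sum of products of a function of
    time and a function of the outcome. Right-continuity makes it the pointwise limit of such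
    sums. *)
Lemma cadlag_jointly_measurable (Z : R -> Omega -> R) : adapted T F Z ->
  (forall w, cadlag T (Z ^~ w)) ->
  measurable_fun setT (fun p : Omega * measurableTypeR R => Z (clamp p.2) p.1).
Proof.
move=> aZ cZ.
have mZ r : 0 <= r <= T -> measurable_fun setT (Z r).
  by move=> rT; apply: (known_measurable filtF rT); apply/(knownP filtF _ rT); exact: aZ.
apply: (@measurable_fun_cvg _ _ _ _
  (fun m (p : Omega * measurableTypeR R) => Z (right_approx m p.2) p.1)); last first.
  by move=> [w r] _; exact: (@cvg_right_approx (Z ^~ w) r (cZ w)).
move=> m; pose M := Num.truncn (T * m.+1%:R).
pose v k := Num.min T (k.+1%:R / m.+1%:R).
pose I k := (`[k%:R, k.+1%:R[%classic : set R).
have -> : (fun p : Omega * measurableTypeR R => Z (right_approx m p.2) p.1) =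
    (fun p => \sum_(k < M.+1) \1_(I k) (clamp p.2 * m.+1%:R) * Z (v k) p.1).
  apply/funext => -[w r] /=; have /andP[r0 rT] := clamp_bounds r.
  have rm0 : 0 <= clamp r * m.+1%:R by rewrite mulr_ge0.
  have kM : (Num.truncn (clamp r * m.+1%:R) < M.+1)%N.
    by rewrite ltnS; apply: le_truncn; rewrite ler_wpM2r.
  rewrite (bigD1 (Ordinal kM))//= big1 ?addr0.
    by rewrite indicE mem_set ?mul1r// /I/= in_itv/= truncn_itv.
  move=> [k lek] /= kk; rewrite indicE memNset ?mul0r// /I/= in_itv/= => /truncn_def kE.
  by move: kk; rewrite -val_eqE/= kE eqxx.
apply: measurable_sum => k; apply: measurable_funM.
  have mI : measurable_fun setT (\1_(I k) : R -> R) by apply: measurable_indic; exact: measurable_itv.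
  apply: (measurableT_comp mI); apply: measurable_funM => //.
  exact: (measurableT_comp measurable_clamp measurable_snd).
have vT : 0 <= v k <= T by rewrite le_min T0 divr_ge0//= ge_min lexx.
by apply: (measurableT_comp (mZ _ vT)); exact: measurable_fst.
Qed.

Lemma progressive_jointly_measurable (Z : R -> Omega -> R) :
  progressively_measurable T F Z ->
  measurable_fun setT (((fun p : Omega * measurableTypeR R => Z p.2 p.1)
    \_ ([set: Omega] `*` `[0, T]))).
Proof.
move=> pZ; set D := [set: Omega] `*` `[0, T].
have mD : measurable (D : set (Omega * measurableTypeR R)) by exact: measurableX.
apply/(measurable_restrictT _ mD) => _ A mA.
have TT : 0 <= T <= T by rewrite T0 lexx.
have [_ Fm _] := filtF.
(* [progressive_sets T] lies in every sigma-algebra that contains its generating rectangles; it is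
   compared with the product-measurable sets contained in the strip. *)
apply: (pZ T TT A mA (fun E => measurable (E : set (Omega * measurableTypeR R)))).
split.
  split; first exact: measurable0.
  - by move=> E mE; exact: measurableD.
  - by move=> E mE; exact: bigcup_measurable.
move=> E [A' [I [FA mI] ->]]; apply: measurableX; first exact: (Fm T).
by apply: measurableI => //; exact: measurable_itv.
Qed.

End measurable_processes.

(** Integrate [2 lam |f| <= lam ^ 2 + f ^ 2] and take the optimal [lam = I / l]. The integral of
    [f ^ 2] may be infinite, in which case there is nothing to show. *)
Lemma cauchy_schwarz_Rintegral d (T : measurableType d) (R : realType)
    (mu : {measure set T -> \bar R}) (A : set T) (l : R) (f : T -> R) :
  measurable A -> 0 < l -> mu A = l%:E -> mu.-integrable A (EFin \o f) ->
  (((\int[mu]_(x in A) f x) ^+ 2)%:E <= l%:E * \int[mu]_(x in A) (f x ^+ 2)%:E)%E.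
Proof.
move=> mA l0 muA intf.
have mf : measurable_fun A f by case/integrableP : intf => /measurable_EFinP.
pose I := \int[mu]_(x in A) `|f x|; have I0 : 0 <= I by exact: Rintegral_ge0.
have IE : (\int[mu]_(x in A) `|f x|%:E)%E = I%:E.
  by rewrite fineK//; apply: integrable_fin_num => //; exact: integrable_norm.
have If : (\int[mu]_(x in A) f x) ^+ 2 <= I ^+ 2.
  rewrite -[leLHS]real_normK ?num_real// lerXn2r// ?nnegrE//.
  exact: le_normr_Rintegral.
pose lam := I / l; have lam0 : 0 <= lam by rewrite divr_ge0// ltW.
have mf2 : measurable_fun A (fun x => f x ^+ 2) by exact: measurable_funX.
have : ((2 * lam * I)%:E <= (lam ^+ 2 * l)%:E + \int[mu]_(x in A) (f x ^+ 2)%:E)%E.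
  rewrite EFinM -IE -ge0_integralZl//; last 2 first.
  - by apply/measurable_EFinP; exact: measurableT_comp.
  - by rewrite lee_fin mulr_ge0.
  rewrite EFinM -muA -integral_cst// -ge0_integralD//; last 3 first.
  - by move=> x _; rewrite lee_fin sqr_ge0.
  - by move=> x _; rewrite lee_fin sqr_ge0.
  - exact/measurable_EFinP.
  apply: ge0_le_integral => //.
  - by move=> x _; rewrite -EFinM lee_fin mulr_ge0// mulr_ge0.
  - by apply: measurable_funeM; apply/measurable_EFinP; exact: measurableT_comp.
  - by apply: emeasurable_funD => //; exact/measurable_EFinP.
  move=> x _; rewrite -EFinM -EFinD lee_fin.
  rewrite -[f x ^+ 2]real_normK ?num_real//.
  by have := sqr_ge0 (lam - `|f x|); nra.
have [q0|q0] := leP +oo%E (\int[mu]_(x in A) (f x ^+ 2)%:E)%E.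
  move: q0; rewrite leye_eq => /eqP ->; rewrite gt0_muley// ?leey// lte_fin//.
have q_fin : (\int[mu]_(x in A) (f x ^+ 2)%:E)%E \is a fin_num.
  by rewrite ge0_fin_numE// integral_ge0// => x _; rewrite lee_fin sqr_ge0.
rewrite -(fineK q_fin) -EFinD -EFinM !lee_fin => h.
apply: (le_trans If); rewrite -ler_pdivrMl//.
move: h; rewrite -lerBlDl; apply: le_trans.
by rewrite le_eqVlt; apply/orP; left; apply/eqP; rewrite /lam; field; rewrite gt_eqF.
Qed.

(** * Mean square increments of the signal *)

Section signal_increments.
Context {R : realType} d (Omega : measurableType d) (P : probability Omega R).
Variables (T C1 : R).
Local Notation leb := (@lebesgue_measure R).
Hypotheses (T0 : 0 <= T) (C10 : 0 <= C1).

(** The fourth moments enter through [x ^ 2 <= 1 + x ^ 4], whence the factor [1 + C1]. *)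
Lemma energy_second_moment (Z : R -> Omega -> R) (Zr : Omega * measurableTypeR R -> R)
    (s t : R) : measurable_fun setT Zr ->
  (forall r w, 0 <= r <= T -> Zr (w, r) = Z r w) ->
  (forall r, 0 <= r <= T -> ('E_P[(fun w => Z r w ^+ 4)%R] <= C1%:E)%E) ->
  0 <= s -> s <= t -> t <= T ->
  (\int[P]_w energy Zr s t w <= ((t - s) * (1 + C1))%:E)%E.
Proof.
move=> mZr ZE Z4 s0 st tT.
have m1 r : measurable_fun setT (fun w => Zr (w, r)).
  exact: (@measurable_fun_pair1 _ _ _ _ _ _ Zr).
rewrite (@tonelli_partial _ _ _ _ _ P leb (fun p => (Zr p ^+ 2)%:E))//; last 2 first.
- by apply/measurable_EFinP; exact: measurable_funX.
- by move=> p; rewrite lee_fin sqr_ge0.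
apply: (@le_trans _ _ (\int[leb]_(r in `]s, t]) (1 + C1)%:E)%E).
  apply: ge0_le_integral => //.
  - by move=> r _; apply: integral_ge0 => w _; rewrite lee_fin sqr_ge0.
  - apply: measurable_funTS.
    apply: (@measurable_fun_fubini_tonelli_G _ _ _ _ _ P (fun p => (Zr p ^+ 2)%:E)).
    + by apply/measurable_EFinP; exact: measurable_funX.
    + by move=> p; rewrite lee_fin sqr_ge0.
  move=> r; rewrite /= in_itv/= => /andP[sr rt].
  have rT : 0 <= r <= T by rewrite (le_trans s0 (ltW sr)) (le_trans rt).
  apply: (@le_trans _ _ (\int[P]_w (1%:E + (Zr (w, r) ^+ 4)%:E))%E).
    apply: ge0_le_integral => //.
    - by move=> w _; rewrite lee_fin sqr_ge0.
    - by apply/measurable_EFinP; exact: measurable_funX.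
    - by apply: emeasurable_funD => //; apply/measurable_EFinP; exact: measurable_funX.
    - move=> w _; rewrite -EFinD lee_fin; set x := Zr _.
      have := sqr_ge0 (x ^+ 2 - 2^-1); rewrite -[x ^+ 4]/(x ^+ (2 * 2)) exprM; nra.
  rewrite ge0_integralD//; last 2 first.
  - by move=> w _; rewrite lee_fin exprn_even_ge0.
  - by apply/measurable_EFinP; exact: measurable_funX.
  rewrite integral_cst// [X in (_ * X)%E]probability_setT mule1 EFinD leeD2l//.
  have := Z4 r rT; rewrite unlock; apply: le_trans.
  by rewrite le_eqVlt; apply/orP; left; apply/eqP; apply: eq_integral => w _; rewrite ZE.
rewrite integral_cst//= lebesgue_measure_itv/= lte_fin.
case: ltP => st'; first by rewrite -EFinM mulrC.
by rewrite mule0 lee_fin mulr_ge0 ?subr_ge0// addr_ge0.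
Qed.

(** The increment splits into drift and stochastic integral, at the cost of a factor 2 on each
    square. Cauchy-Schwarz gives [(t - s) ^ 2 (1 + C1)] for the drift, and one factor [t - s] is
    bounded by [T]; the martingale part contributes [2 * 32]. *)
Lemma signal_increments (X : R -> Omega -> R) : class_X T C1 P X ->
  (forall t, 0 <= t <= T -> measurable_fun setT (X t)) /\
  forall s t, 0 <= s -> s <= t -> t <= T ->
    (\int[P]_w ((X t w - X s w) ^+ 2)%:E <= ((2 * T + 64) * (1 + C1) * (t - s))%:E)%E.
Proof.
move=> [F [B [mu [sigma [[filtF BM] [_ pmu] [_ _ [asigma csigma _]]
  [aX [J itoJ XE]] moments]]]]].
have mX t : 0 <= t <= T -> measurable_fun setT (X t).
  by move=> tT; apply: (known_measurable filtF tT); apply/(knownP filtF _ tT); exact: aX.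
split => // s t s0 st tT.
move: (st); rewrite le_eqVlt => /predU1P[<-|st'].
  under eq_integral do rewrite subrr expr0n/=.
  by rewrite integral0 subrr mulr0.
have sT : 0 <= s <= T by rewrite s0 (le_trans st).
have tT' : 0 <= t <= T by rewrite tT (le_trans s0).
pose Sig (p : Omega * measurableTypeR R) := sigma (clamp T p.2) p.1.
pose Mu := (fun p : Omega * measurableTypeR R => mu p.2 p.1)
    \_ ([set: Omega] `*` `[0, T]).
have mSig : measurable_fun setT Sig by exact: (cadlag_jointly_measurable filtF).
have mMu : measurable_fun setT Mu by exact: (progressive_jointly_measurable filtF).
have SigE r w : 0 <= r <= T -> Sig (w, r) = sigma r w.
  by move=> rT; rewrite /Sig/= clamp_id.
have MuE r w : 0 <= r <= T -> Mu (w, r) = mu r w.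
  by move=> rT; rewrite /Mu patchE mem_set//=; split => //=; rewrite in_itv.
have eSig a b : 0 <= a -> a <= b -> b <= T ->
    (\int[P]_w energy Sig a b w <= ((b - a) * (1 + C1))%:E)%E.
  move=> a0 ab bT; apply: (energy_second_moment mSig SigE) => // r rT.
  by have [] := moments r rT.
have eMu a b : 0 <= a -> a <= b -> b <= T ->
    (\int[P]_w energy Mu a b w <= ((b - a) * (1 + C1))%:E)%E.
  move=> a0 ab bT; apply: (energy_second_moment mMu MuE) => // r rT.
  by have [] := moments r rT.
have ts0 : 0 < t - s by rewrite subr_gt0.
have J2 : (\int[P]_w ((J t w - J s w) ^+ 2)%:E <= (32 * ((t - s) * (1 + C1)))%:E)%E.
  apply: (ito_second_moment filtF BM mSig SigE s0 st tT) => //.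
  - by rewrite mulr_ge0 ?(ltW ts0)// addr_ge0.
  - exact: eSig.
have mJ r : 0 <= r <= T -> measurable_fun setT (J r).
  move=> rT; have [aJ _ _] := itoJ.
  by apply: (known_measurable filtF rT); apply/(knownP filtF _ rT); exact: aJ.
have mJ2 : measurable_fun setT (fun w => (2 * (J t w - J s w) ^+ 2)%:E).
  apply/measurable_EFinP; apply: measurable_funM => //; apply: measurable_funX.
  by apply: measurable_funB; exact: mJ.
have mE : measurable_fun setT (fun w => (2 * (t - s))%:E * energy Mu s t w)%E.
  by apply: measurable_funeM; exact: measurable_energy.
have E0 w : (0 <= (2 * (t - s))%:E * energy Mu s t w)%E.
  by rewrite mule_ge0 ?energy_ge0// lee_fin mulr_ge0// ltW.
have JJ0 w : (0 <= (2 * (J t w - J s w) ^+ 2)%:E)%E.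
  by rewrite lee_fin mulr_ge0// sqr_ge0.
apply: (@le_trans _ _ (\int[P]_w ((2 * (t - s))%:E * energy Mu s t w +
    (2 * (J t w - J s w) ^+ 2)%:E))%E); last first.
  rewrite ge0_integralD// ge0_integralZl//; last 3 first.
  - exact: measurable_energy.
  - by move=> w _; exact: energy_ge0.
  - by rewrite lee_fin mulr_ge0// ltW.
  under [X in (_ + X)%E]eq_integral do rewrite EFinM.
  rewrite [X in (_ + X)%E]ge0_integralZl//; last 2 first.
  - apply/measurable_EFinP; apply: measurable_funX.
    by apply: measurable_funB; exact: mJ.
  - by move=> w _; rewrite lee_fin sqr_ge0.
  apply: (@le_trans _ _ ((2 * (t - s))%:E * ((t - s) * (1 + C1))%:E +
     2%:E * (32 * ((t - s) * (1 + C1)))%:E)%E).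
    apply: leeD; rewrite lee_wpmul2l ?lee_fin ?mulr_ge0 ?(ltW ts0)//.
    exact: eMu.
  rewrite -!EFinM -EFinD lee_fin.
  have tsT : t - s <= T by rewrite (le_trans _ tT)// lerBlDr lerDl.
  rewrite (_ : _ + _ = (2 * (t - s) + 64) * ((1 + C1) * (t - s))); last by ring.
  rewrite -mulrA ler_wpM2r ?mulr_ge0 ?(ltW ts0) ?addr_ge0//.
  by rewrite lerD2r ler_wpM2l.
(* Finite energy on [[0, T]] makes almost every path of the drift integrable, which is needed to
   subtract its integrals up to [s] and up to [t]. *)
have finE : {ae P, forall w, (energy Mu 0 T w < +oo)%E}.
  have iE : P.-integrable setT (energy Mu 0 T).
    apply/integrableP; split; first exact: measurable_energy.
    under eq_integral do rewrite gee0_abs ?energy_ge0//.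
    by apply: le_lt_trans (eMu 0 T _ _ _) _ => //; exact: ltry.
  apply: filterS (integrable_ae measurableT iE) => w /(_ Logic.I).
  by rewrite ge0_fin_numE ?energy_ge0.
apply: ae_ge0_le_integral => //.
- by move=> w _; rewrite lee_fin sqr_ge0.
- by apply/measurable_EFinP; apply: measurable_funX; apply: measurable_funB; exact: mX.
- by move=> w _; rewrite adde_ge0.
- exact: emeasurable_funD.
move: finE XE; apply: filterS2 => w fin Xw _.
have mMuw : measurable_fun setT (fun r : measurableTypeR R => Mu (w, r)).
  exact: (@measurable_fun_pair2 _ _ _ _ _ _ Mu).
have iMu : leb.-integrable `[0, T] (fun r => (Mu (w, r))%:E).
  apply/integrableP; split; first by apply: measurable_funTS; exact/measurable_EFinP.
  have mab : measurable_fun setT (fun r : measurableTypeR R => (`|Mu (w, r)|)%:E).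
    by apply/measurable_EFinP; exact: measurableT_comp.
  rewrite -integral_itv_obnd_cbnd; last exact: measurable_funTS.
  apply: (@le_lt_trans _ _ (\int[leb]_(r in `]0%R, T]) (1%:E + (Mu (w, r) ^+ 2)%:E))%E).
    apply: ge0_le_integral => //.
    - exact: measurable_funTS.
    - apply: emeasurable_funD => //; apply: measurable_funTS.
      by apply/measurable_EFinP; exact: measurable_funX.
    - move=> r _; rewrite -EFinD lee_fin -[Mu _ ^+ 2]real_normK ?num_real//.
      by have := sqr_ge0 (`|Mu (w, r)| - 1); nra.
  rewrite ge0_integralD//; last 2 first.
  - by move=> r _; rewrite lee_fin sqr_ge0.
  - by apply: measurable_funTS; apply/measurable_EFinP; exact: measurable_funX.
  rewrite integral_cst//= lebesgue_measure_itv/= lte_fin.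
  by apply: lte_add_pinfty => //; case: ifP => _; rewrite ?mule0 ?mul1e ?ltry.
have iMut : leb.-integrable `[0, t] (fun r => (Mu (w, r))%:E).
  by apply: integrableS iMu => // r; rewrite /= !in_itv/= => /andP[-> /le_trans]; exact.
have muE a : 0 <= a <= T -> \int[leb]_(r in `[0, a]) mu r w = \int[leb]_(r in `[0, a]) Mu (w, r).
  move=> /andP[a0 aT]; apply: eq_Rintegral => r; rewrite inE/= in_itv/= => /andP[r0 ra].
  by rewrite MuE// r0 (le_trans ra).
have -> : X t w - X s w = \int[leb]_(r in `]s, t]) Mu (w, r) + (J t w - J s w).
  rewrite (Xw t tT') (Xw s sT) !muE//.
  by rewrite -(@Rintegral_itvB _ _ (BLeft 0) (BRight t) s)//; ring.
set I := \int[leb]_(r in _) _; set D := J t w - J s w.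
have CS : ((I ^+ 2)%:E <= (t - s)%:E * energy Mu s t w)%E.
  apply: cauchy_schwarz_Rintegral => //.
    by rewrite /= lebesgue_measure_itv/= lte_fin st'.
  apply: integrableS iMut => // r; rewrite /= !in_itv/= => /andP[sr ->].
  by rewrite (le_trans s0 (ltW sr)).
apply: (@le_trans _ _ ((2 * I ^+ 2)%:E + (2 * D ^+ 2)%:E)%E).
  by rewrite -EFinD lee_fin; have := sqr_ge0 (I - D); nra.
by rewrite leeD2r// !EFinM -muleA lee_wpmul2l.
Qed.

End signal_increments.

(** * The empirical characteristic function *)

Section pointwise.
Context {R : realType}.

(** The power [x ^ 2], in place of the sharper order [x ^ 4] near 0, is what a second moment of the
    increments can control. *)
Lemma sqr_1Bcos_le (x : R) : (1 - cos x) ^+ 2 <= x ^+ 2.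
Proof.
wlog x0 : x / 0 <= x.
  move=> h; have [|/ltW x0] := leP 0 x; first exact: h.
  by rewrite -cosN -[x ^+ 2]sqrrN h// oppr_ge0.
have [c _] := @MVT_segment R cos (fun y => - sin y) 0 x x0
  (fun y _ => is_derive_cos y) (continuous_subspaceT (@continuous_cos R)).
rewrite cos0 subr0 => e.
rewrite -[1 - _]opprB e sqrrN exprMn sqrrN ler_piMl ?sqr_ge0//.
Qed.

(** Here [z] is the distance between root and target, and [v] their sum. If [Q <= phi * D], division
    by [phi] is harmless and [z <= 2 D]. Otherwise [z <= v] gives [z ^ 2 <= phi * D + Q < 2 Q],
    without any division by the possibly tiny [phi]. *)
Let perturbation_arith (z D Q phi v : R) : 0 < phi -> 0 <= z -> 0 <= D -> 0 <= Q ->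
  phi <= v -> z <= v -> z * v <= phi * D + Q -> z ^+ 2 <= 4 * D ^+ 2 + 2 * Q.
Proof.
move=> phi0 z0 D0 Q0 phiv zv dist.
have zphi : z * phi <= phi * D + Q by apply: le_trans dist; exact: ler_wpM2l.
have zz : z ^+ 2 <= phi * D + Q by apply: le_trans dist; rewrite expr2 ler_wpM2l.
have [QD|DQ] := leP Q (phi * D).
  have : z * phi <= (2 * D) * phi by lra.
  by rewrite ler_pM2r// => zD; nra.
by have := sqr_ge0 D; lra.
Qed.

Lemma sqrt_perturbation (phi D Q : R) : 0 < phi ->
  (Num.sqrt `|phi ^+ 2 + phi * D + Q| - phi) ^+ 2 <= 4 * D ^+ 2 + 2 * `|Q|.
Proof.
move=> phi0; set y := Num.sqrt _; have y0 : 0 <= y by exact: sqrtr_ge0.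
have y2 : y ^+ 2 = `|phi ^+ 2 + phi * D + Q| by rewrite sqr_sqrtr.
have dist : `|y ^+ 2 - phi ^+ 2| <= phi * `|D| + `|Q|.
  rewrite y2 -[X in `|_ - X|]ger0_norm ?sqr_ge0//.
  apply: (le_trans (ler_dist_dist _ _)).
  rewrite (_ : _ - _ = phi * D + Q); last by ring.
  by rewrite (le_trans (ler_normD _ _))// normrM gtr0_norm.
have yphi0 : 0 <= y + phi by rewrite addr_ge0// ltW.
rewrite subr_sqr normrM [X in _ * X]ger0_norm// in dist.
rewrite -[(y - phi) ^+ 2]real_normK ?num_real// -[D ^+ 2]real_normK ?num_real//.
have zy : `|y - phi| <= y + phi.
  by rewrite (le_trans (ler_normB _ _))// !ger0_norm// ltW.
by apply: (perturbation_arith phi0 _ _ _ _ zy dist) => //; rewrite lerDr.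
Qed.

Section pair_sums.
Variables (m : nat) (nb : rel 'I_m).
Hypothesis nb_sym : forall j l, nb j l = nb l j.
Implicit Types F G : 'I_m -> 'I_m -> R.

Definition pair_sum F : R := \sum_j \sum_(l | nb j l) F j l.

Lemma pair_sumD F G : pair_sum (fun j l => F j l + G j l) = pair_sum F + pair_sum G.
Proof.
by rewrite -big_split; apply: eq_bigr => j _; rewrite -big_split.
Qed.

Lemma pair_sumZ a F : pair_sum (fun j l => a * F j l) = a * pair_sum F.
Proof.
by rewrite /pair_sum mulr_sumr; apply: eq_bigr => j _; rewrite mulr_sumr.
Qed.

Lemma pair_sumC F : pair_sum (fun j l => F l j) = pair_sum F.
Proof.
rewrite /pair_sum (exchange_big_dep xpredT)//=.
by apply: eq_bigr => j _; apply: eq_bigl => l; rewrite nb_sym.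
Qed.

Lemma ler_pair_sum F G : (forall j l, nb j l -> F j l <= G j l) -> pair_sum F <= pair_sum G.
Proof. by move=> FG; apply: ler_sum => j _; apply: ler_sum => l; exact: FG. Qed.

Lemma eq_pair_sum F G : (forall j l, F j l = G j l) -> pair_sum F = pair_sum G.
Proof. by move=> FG; apply: eq_bigr => j _; apply: eq_bigr => l _; exact: FG. Qed.

(** Jensen's inequality for the mean over pairs, from the nonnegativity of the empirical
    variance. *)
Lemma sqr_mean_pair_sum F : 0 < pair_sum (fun _ _ => 1) ->
  ((pair_sum (fun _ _ => 1))^-1 * pair_sum F) ^+ 2 <=
  (pair_sum (fun _ _ => 1))^-1 * pair_sum (fun j l => F j l ^+ 2).
Proof.
set N := pair_sum (fun _ _ => 1) => N0; set a := N^-1 * _.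
have NE : pair_sum F = N * a by rewrite /a mulrA mulfV ?mul1r// gt_eqF.
have : 0 <= pair_sum (fun j l => (F j l - a) ^+ 2).
  by apply: sumr_ge0 => j _; apply: sumr_ge0 => l _; exact: sqr_ge0.
rewrite (@eq_pair_sum _ (fun j l => F j l ^+ 2 + (- (2 * a) * F j l + a ^+ 2 * 1))); last first.
  by move=> j l; ring.
rewrite 2!pair_sumD !pair_sumZ -/N NE => h.
rewrite ler_pdivlMl//; nra.
Qed.

(* [cos (s (x l + u l - x j - u j))] expanded around the value [phi] of the mean of [cos (s u)];
   the symmetry of [nb] merges the terms obtained by exchanging [j] and [l]. *)
Lemma cosine_decomposition (s phi : R) (x u : 'I_m -> R) :
  let c j l := cos (s * (x l - x j)) in
  let e j l := sin (s * (x l - x j)) in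
  let eta j := cos (s * u j) - phi in
  let b j := sin (s * u j) in
  pair_sum (fun j l => cos (s * (x l + u l - (x j + u j)))) =
  phi ^+ 2 * pair_sum c +
  2 * phi * (pair_sum (fun j l => c j l * eta l) - pair_sum (fun j l => e j l * b l)) +
  (pair_sum (fun j l => c j l * (eta l * eta j)) + pair_sum (fun j l => c j l * (b l * b j))
   - 2 * pair_sum (fun j l => e j l * (b l * eta j))).
Proof.
move=> c e eta b.
have cC j l : c j l = c l j by rewrite /c -cosN; congr cos; ring.
have eC j l : e j l = - e l j by rewrite /e -sinN; congr sin; ring.
rewrite (@eq_pair_sum _ (fun j l => phi ^+ 2 * c j l +
  (phi * (c j l * eta l) + (phi * (c j l * eta j) + ((- phi) * (e j l * b l) +
   (phi * (e j l * b j) + (c j l * (eta l * eta j) + (c j l * (b l * b j) +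
    ((-1) * (e j l * (b l * eta j)) + 1 * (e j l * (eta l * b j))))))))))); last first.
  move=> j l; rewrite (_ : s * _ = s * (x l - x j) + (s * u l - s * u j)); last by ring.
  rewrite cosD cosB sinB -/(c j l) -/(e j l) /eta -/(b l) -/(b j).
  by ring.
rewrite 8!pair_sumD !pair_sumZ.
have -> : pair_sum (fun j l => c j l * eta j) = pair_sum (fun j l => c j l * eta l).
  by rewrite -pair_sumC; apply: eq_pair_sum => j l; rewrite cC.
have -> : pair_sum (fun j l => e j l * b j) = - pair_sum (fun j l => e j l * b l).
  rewrite -pair_sumC -mulN1r -pair_sumZ.
  by apply: eq_pair_sum => j l; rewrite eC; ring.
have -> : pair_sum (fun j l => e j l * (eta l * b j)) =
    - pair_sum (fun j l => e j l * (b l * eta j)).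
  rewrite -pair_sumC -mulN1r -pair_sumZ.
  by apply: eq_pair_sum => j l; rewrite eC; ring.
by ring.
Qed.

End pair_sums.
End pointwise.

(** * Mean square error at a fixed frequency *)

Section pointwise_risk.
Context {R : realType} d (Omega : measurableType d) (P : probability Omega R).
Variables (T : R) (g : nat -> R) (n : nat) (X U : R -> Omega -> R) (f : R -> R).
Hypothesis model : error_model T g n P X U f.
Hypothesis mX : forall t, 0 <= t <= T -> measurable_fun setT (X t).
Hypothesis gT : forall j : 'I_n.+1, 0 <= g j <= T.
Variables (K : R) (xi s B : R).
Hypothesis K0 : 0 <= K.
Hypothesis incr : forall a b, 0 <= a -> a <= b -> b <= T ->
  (\int[P]_w ((X b w - X a w) ^+ 2)%:E <= (K * (b - a))%:E)%E.
Hypothesis B_ge : forall l : 'I_n.+1, (nb_neighbours g n xi l)%:R <= B.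
Local Notation leb := (@lebesgue_measure R).

Let phi := cosine_transform f s.
Let nb (j l : 'I_n.+1) := neighbour g xi j l.
Let N : R := (nb_pairs g n xi)%:R.
Hypotheses (phi0 : 0 < phi) (N0 : 0 < N).

Let NE : N = pair_sum nb (fun _ _ => 1). Proof. exact: nb_pairs_sum. Qed.

Let nb_sym j l : nb j l = nb l j.
Proof. by rewrite /nb /neighbour distrC eq_sym. Qed.

Let nb_irr j l : nb j l -> j != l.
Proof. by rewrite /nb /neighbour eq_sym => /andP[]. Qed.

Let nb_le l : \sum_(j | nb j l) 1 <= B.
Proof.
apply: le_trans (B_ge l); rewrite /nb_neighbours -sum1_card natr_sum.
by rewrite le_eqVlt; apply/orP; left; apply/eqP; apply: eq_bigl => j; exact: nb_sym.
Qed.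

Let df : density f. Proof. by have [] := model. Qed.
Let fi := density_integrable df.

Let phi1 : phi <= 1.
Proof.
apply: (le_trans (ler_norm _)); apply: (le_trans (cosine_transform_bound fi s)).
have [mf f0 f1] := df.
under eq_Rintegral do rewrite ger0_norm//.
by rewrite /Rintegral f1.
Qed.

Let eta (y : R) := cos (s * y) - phi.
Let b (y : R) := sin (s * y).

Let mcos : measurable_fun setT (fun y : R => cos (s * y)).
Proof. exact: measurable_cosM. Qed.
Let mb : measurable_fun setT b. Proof. exact: measurable_sinM. Qed.
Let meta : measurable_fun setT eta. Proof. exact: measurable_funB. Qed.

Let eta2 y : `|eta y| <= 2.
Proof.
rewrite (le_trans (ler_normB _ _))// (gtr0_norm phi0).
by have := cos_max (s * y); have := phi1; lra.
Qed.

Let b2 y : `|b y| <= 2.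
Proof. by rewrite (le_trans (sin_max _))// ler1n. Qed.

Let mU (j : 'I_n.+1) : measurable_fun setT (U (g j)) := error_measurable model j.

Let Eeta (j : 'I_n.+1) : \int[P]_w eta (U (g j) w) = 0.
Proof.
have icos : P.-integrable setT (EFin \o (fun w => cos (s * U (g j) w))).
  apply: (@bounded_integrable _ _ _ P _ 1); last by move=> w; exact: cos_max.
  exact: (measurableT_comp mcos).
rewrite RintegralB//; last first.
  by apply: (@bounded_integrable _ _ _ P _ `|phi|).
rewrite Rintegral_prob_cst.
rewrite (error_expectation model j (u := fun y => cos (s * y)) (M := 1))//; last first.
  by move=> y; exact: cos_max.
rewrite [X in X - _](_ : _ = phi) ?subrr//.
by apply: eq_Rintegral => y _; rewrite mulrC [s * y]mulrC mulrC.
Qed.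

Hypothesis f_real : real_nonvanishing_fourier f.

Let Eb (j : 'I_n.+1) : \int[P]_w b (U (g j) w) = 0.
Proof.
rewrite (error_expectation model j (u := b) (M := 1))//; last first.
  by move=> y; exact: sin_max.
have [h _] := f_real s; rewrite Im_fourier in h; rewrite -[RHS]h.
by apply: eq_Rintegral => y _; rewrite /b [s * y]mulrC.
Qed.

Let H := \bigcup_(t in [set` `[0, T]]) preimage_set_system setT (X t) measurable.

Let c (j l : 'I_n.+1) w := cos (s * (X (g l) w - X (g j) w)).
Let e (j l : 'I_n.+1) w := sin (s * (X (g l) w - X (g j) w)).

Let Hdiff (j l : 'I_n.+1) : signal_measurable H (fun w => X (g l) w - X (g j) w).
Proof. by apply: measurable_funB; exact: signal_measurable_X. Qed.

Let Hc j l : signal_measurable H (c j l).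
Proof. exact: (measurableT_comp mcos (Hdiff j l)). Qed.

Let He j l : signal_measurable H (e j l).
Proof. exact: (measurableT_comp mb (Hdiff j l)). Qed.

Let Hmul (x y : Omega -> R) : signal_measurable H x -> signal_measurable H y ->
  signal_measurable H (fun w => x w * y w).
Proof. by move=> mx my; exact: measurable_funM. Qed.

Let c1 j l w : `|c j l w| <= 1. Proof. exact: cos_max. Qed.
Let e1 j l w : `|e j l w| <= 1. Proof. exact: sin_max. Qed.

Let mH (x : Omega -> R) : signal_measurable H x -> measurable_fun setT x.
Proof. exact: signal_measurable_mfun. Qed.

Let fact := error_factorization model mX.

Let linear (u : R -> R) (k : 'I_n.+1 -> 'I_n.+1 -> Omega -> R) : (forall y, `|u y| <= 2) -> measurable_fun setT u ->
  (forall j : 'I_n.+1, \int[P]_w u (U (g j) w) = 0) ->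
  (forall j l, signal_measurable H (k j l)) -> (forall j l w, `|k j l w| <= 1) ->
  \int[P]_w (pair_sum nb (fun j l => k j l w * u (U (g l) w)) ^+ 2) <= 4 * (B * N).
Proof.
move=> u2 mu u0 Hk k1; rewrite NE.
exact: (linear_noise_second_moment mU mH Hmul fact mu u2 u0 Hk k1 nb_le).
Qed.

Let quadratic (u v : R -> R) (k : 'I_n.+1 -> 'I_n.+1 -> Omega -> R) : (forall y, `|u y| <= 2) -> (forall y, `|v y| <= 2) ->
  measurable_fun setT u -> measurable_fun setT v ->
  (forall j : 'I_n.+1, \int[P]_w u (U (g j) w) = 0) ->
  (forall j : 'I_n.+1, \int[P]_w v (U (g j) w) = 0) ->
  (forall j l, signal_measurable H (k j l)) -> (forall j l w, `|k j l w| <= 1) ->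
  \int[P]_w (pair_sum nb (fun j l => k j l w * (u (U (g l) w) * v (U (g j) w))) ^+ 2) <= 32 * N.
Proof.
move=> u2 v2 mu mv u0 v0 Hk k1; rewrite NE.
exact: (quadratic_noise_second_moment mU mH Hmul fact mu mv u2 v2 u0 v0 nb_irr Hk k1).
Qed.

Let mean_gap w := N^-1 * pair_sum nb (fun j l => 1 - c j l w).

Let mc j l : measurable_fun setT (c j l). Proof. exact: mH. Qed.
Let me j l : measurable_fun setT (e j l). Proof. exact: mH. Qed.

Let m_pair_sum (h : 'I_n.+1 -> 'I_n.+1 -> Omega -> R) :
  (forall j l, measurable_fun setT (h j l)) ->
  measurable_fun setT (fun w => pair_sum nb (fun j l => h j l w)).
Proof.
move=> mh; rewrite (_ : (fun w => _) = (fun w => \sum_j \sum_l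
    (if nb j l then h j l w else 0))).
  apply: measurable_sum => j; apply: measurable_sum => l.
  by case: (nb j l).
by apply/funext => w; apply: eq_bigr => j _; rewrite big_mkcond.
Qed.

Let pair_sum_bound (h : 'I_n.+1 -> 'I_n.+1 -> Omega -> R) M w :
  (forall j l, `|h j l w| <= M) -> `|pair_sum nb (fun j l => h j l w)| <= M * N.
Proof.
move=> hM; rewrite NE -pair_sumZ.
apply: (le_trans (ler_norm_sum _ _ _)); apply: ler_sum => j _.
apply: (le_trans (ler_norm_sum _ _ _)); apply: ler_sum => l _.
by rewrite mulr1.
Qed.

Let increment_sqr (j l : 'I_n.+1) : nb j l ->
  (\int[P]_w ((X (g l) w - X (g j) w) ^+ 2)%:E <= (K * xi)%:E)%E.
Proof.
move=> /andP[dist _].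
have [/andP[j0 jT] /andP[l0 lT]] := (gT j, gT l).
have [jl|/ltW lj] := leP (g j) (g l).
  apply: (le_trans (incr j0 jl lT)); rewrite lee_fin ler_wpM2l//.
  by rewrite (le_trans _ dist)// ler_norm.
under eq_integral do rewrite -sqrrN opprB.
apply: (le_trans (incr l0 lj jT)); rewrite lee_fin ler_wpM2l//.
by rewrite (le_trans _ dist)// distrC ler_norm.
Qed.

(** The bias: Jensen moves the square inside the mean over pairs, then [1 - cos] is bounded by its
    argument. Neighbours are at most [xi] apart in time, so each squared increment has mean at most
    [K * xi]. *)
Let gap_second_moment : \int[P]_w (mean_gap w ^+ 2) <= s ^+ 2 * (K * xi).
Proof.
pose G j l w := (1 - c j l w) ^+ 2.
have G4 j l w : `|G j l w| <= 4.
  have := c1 j l w; rewrite ler_norml => /andP[h1 h2].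
  by rewrite ger0_norm ?sqr_ge0// /G; nra.
have mG j l : measurable_fun setT (G j l).
  by apply: measurable_funX; exact: measurable_funB.
have iG j l : P.-integrable setT (EFin \o G j l) by exact: bounded_integrable (G4 j l).
have EG j l : nb j l -> \int[P]_w G j l w <= s ^+ 2 * (K * xi).
  move=> jl; rewrite -lee_fin /Rintegral fineK; last exact: integrable_fin_num (iG j l).
  apply: (@le_trans _ _ (\int[P]_w ((s ^+ 2)%:E * ((X (g l) w - X (g j) w) ^+ 2)%:E))%E).
    apply: ge0_le_integral => //.
    - by move=> w _; rewrite lee_fin sqr_ge0.
    - exact/measurable_EFinP.
    - by apply: measurable_funeM; apply/measurable_EFinP; apply: measurable_funX; exact: mH.
    - by move=> w _; rewrite -EFinM lee_fin -exprMn; exact: sqr_1Bcos_le.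
  rewrite ge0_integralZl//; last 3 first.
  - by apply/measurable_EFinP; apply: measurable_funX; exact: mH.
  - by move=> w _; rewrite lee_fin sqr_ge0.
  - by rewrite lee_fin sqr_ge0.
  by rewrite [leRHS]EFinM lee_wpmul2l ?lee_fin ?sqr_ge0//; exact: increment_sqr.
pose S w := pair_sum nb (fun j l => G j l w).
have [iS ES] : P.-integrable setT (EFin \o S) /\
    \int[P]_w S w = pair_sum nb (fun j l => \int[P]_w G j l w).
  have h j := Rintegral_sum (index_enum 'I_n.+1) (nb j) (iG j).
  have [h1 h2] := Rintegral_sum (index_enum 'I_n.+1) xpredT (fun j => (h j).1).
  by split => //; rewrite h2; apply: eq_bigr => j _; rewrite (h j).2.
apply: (@le_trans _ _ (\int[P]_w (N^-1 * S w))).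
  apply: le_Rintegral => //.
  - apply: (@bounded_integrable _ _ _ P _ ((N^-1 * (2 * N)) ^+ 2)).
      apply: measurable_funX; apply: measurable_funM => //.
      by apply: m_pair_sum => j l; exact: measurable_funB.
    move=> w; rewrite ger0_norm ?sqr_ge0// -real_normK ?num_real// lerXn2r// ?nnegrE//.
      by rewrite mulr_ge0 ?invr_ge0 ?mulr_ge0// ltW.
    rewrite normrM ger0_norm ?invr_ge0 ?(ltW N0)// ler_wpM2l ?invr_ge0 ?(ltW N0)//.
    apply: (@pair_sum_bound (fun j l w => 1 - c j l w)) => j l.
    rewrite (le_trans (ler_normB _ _))// normr1.
    by have := c1 j l w; lra.
  - apply: (eq_integrable measurableT (fun w => N^-1%:E * (EFin \o S) w)%E) => //.
    exact: integrableZl.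
  - by move=> w _; rewrite /mean_gap NE; apply: sqr_mean_pair_sum => //; rewrite -NE.
rewrite RintegralZl// ES ler_pdivrMl// NE mulrC -pair_sumZ.
by apply: ler_pair_sum => j l jl; rewrite mulr1; exact: EG.
Qed.

(** Integrability is carried along with the bound, so that the final estimate can be assembled by
    sums and nonnegative multiples. *)
Let mean_below (G : Omega -> R) v :=
  P.-integrable setT (EFin \o G) /\ \int[P]_w G w <= v.

Let mean_belowD G1 G2 v1 v2 : mean_below G1 v1 -> mean_below G2 v2 ->
  mean_below (fun w => G1 w + G2 w) (v1 + v2).
Proof.
move=> [i1 h1] [i2 h2]; split; last by rewrite RintegralD// lerD.
apply: (eq_integrable measurableT (fun w => (EFin \o G1) w + (EFin \o G2) w)%E) => //.
exact: integrableD.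
Qed.

Let mean_belowZ k G v : 0 <= k -> mean_below G v -> mean_below (fun w => k * G w) (k * v).
Proof.
move=> k0 [iG h]; split; last by rewrite RintegralZl// ler_wpM2l.
apply: (eq_integrable measurableT (fun w => k%:E * (EFin \o G) w)%E) => //.
exact: integrableZl.
Qed.

Let mean_below_cst v : mean_below (cst v) v.
Proof.
by split; [exact: (@bounded_integrable _ _ _ P _ `|v|)|rewrite Rintegral_prob_cst].
Qed.

(** The constants: [4 D ^ 2 <= 8 phi ^ 2 gap ^ 2 + 64 (L1 ^ 2 + L2 ^ 2) / N ^ 2], where each linear
    term has second moment at most [4 B N], which gives 512. The term [48 / sqrt N] bounds
    [2 E|Q|]. *)
Lemma fourier_hat_pointwise_risk :
  (\int[P]_w ((fourier_hat g n xi (fun j => X (g j) w + U (g j) w) s - phi) ^+ 2)%:E <=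
   (8 * phi ^+ 2 * (s ^+ 2 * (K * xi)) + 512 * (B / N) + 48 / Num.sqrt N)%:E)%E.
Proof.
pose L1 w := pair_sum nb (fun j l => c j l w * eta (U (g l) w)).
pose L2 w := pair_sum nb (fun j l => e j l w * b (U (g l) w)).
pose Q1 w := pair_sum nb (fun j l => c j l w * (eta (U (g l) w) * eta (U (g j) w))).
pose Q2 w := pair_sum nb (fun j l => c j l w * (b (U (g l) w) * b (U (g j) w))).
pose Q3 w := pair_sum nb (fun j l => e j l w * (b (U (g l) w) * eta (U (g j) w))).
have EL1 : \int[P]_w (L1 w ^+ 2) <= 4 * (B * N) by exact: linear.
have EL2 : \int[P]_w (L2 w ^+ 2) <= 4 * (B * N) by exact: linear.
have EQ1 : \int[P]_w (Q1 w ^+ 2) <= 32 * N by exact: quadratic.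
have EQ2 : \int[P]_w (Q2 w ^+ 2) <= 32 * N by exact: quadratic.
have EQ3 : \int[P]_w (Q3 w ^+ 2) <= 32 * N by exact: quadratic.
have mu (u : R -> R) (j : 'I_n.+1) : measurable_fun setT u ->
    measurable_fun setT (fun w => u (U (g j) w)).
  by move=> muu; exact: (measurableT_comp muu).
have isq (h : 'I_n.+1 -> 'I_n.+1 -> Omega -> R) M :
    (forall j l, measurable_fun setT (h j l)) -> (forall j l w, `|h j l w| <= M) ->
    P.-integrable setT (EFin \o (fun w => pair_sum nb (fun j l => h j l w) ^+ 2)).
  move=> mh hM; apply: (@bounded_integrable _ _ _ P _ ((M * N) ^+ 2)).
    by apply: measurable_funX; exact: m_pair_sum.
  move=> w; rewrite ger0_norm ?sqr_ge0// -real_normK ?num_real// lerXn2r// ?nnegrE//.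
    by rewrite mulr_ge0 ?(ltW N0)// (le_trans _ (hM ord0 ord0 w)).
  exact: pair_sum_bound.
have me' (u v : R -> R) (j l : 'I_n.+1) : measurable_fun setT u -> measurable_fun setT v ->
    measurable_fun setT (fun w => u (U (g l) w) * v (U (g j) w)).
  by move=> mu' mv'; apply: measurable_funM; exact: mu.
have b4 (k u v : R) : `|k| <= 1 -> `|u| <= 2 -> `|v| <= 2 -> `|k * (u * v)| <= 4.
  move=> k1 u2 v2; rewrite !normrM -[4]mul1r; apply: ler_pM => //.
  by rewrite (_ : 4 = 2 * 2) ?ler_pM//; ring.
have b2' (k u : R) : `|k| <= 1 -> `|u| <= 2 -> `|k * u| <= 2.
  by move=> k1 u2; rewrite normrM -[2]mul1r ler_pM.
have BL1 : mean_below (fun w => L1 w ^+ 2) (4 * (B * N)).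
  split=> //; apply: (isq _ 2) => [j l|j l w]; last exact: b2'.
  by apply: measurable_funM => //; exact: mu.
have BL2 : mean_below (fun w => L2 w ^+ 2) (4 * (B * N)).
  split=> //; apply: (isq _ 2) => [j l|j l w]; last exact: b2'.
  by apply: measurable_funM => //; exact: mu.
have BQ1 : mean_below (fun w => Q1 w ^+ 2) (32 * N).
  split=> //; apply: (isq _ 4) => [j l|j l w]; last exact: b4.
  by apply: measurable_funM => //; exact: me'.
have BQ2 : mean_below (fun w => Q2 w ^+ 2) (32 * N).
  split=> //; apply: (isq _ 4) => [j l|j l w]; last exact: b4.
  by apply: measurable_funM => //; exact: me'.
have BQ3 : mean_below (fun w => Q3 w ^+ 2) (32 * N).
  split=> //; apply: (isq _ 4) => [j l|j l w]; last exact: b4.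
  by apply: measurable_funM => //; exact: me'.
have Bgap : mean_below (fun w => mean_gap w ^+ 2) (s ^+ 2 * (K * xi)).
  split=> //; have iG : P.-integrable setT (EFin \o (fun w =>
      pair_sum nb (fun j l => 1 - c j l w) ^+ 2)).
    apply: (isq _ 2) => [j l|j l w]; first exact: measurable_funB.
    rewrite (le_trans (ler_normB _ _))// normr1; have := c1 j l w; lra.
  apply: (eq_integrable measurableT _ _ _ (integrableZl measurableT (N^-1 ^+ 2) iG)) => //.
  by move=> w _; rewrite /= -EFinM exprMn.
(* [2 |Q| <= lam + Q ^ 2 / lam], and [E (Q ^ 2) <= 3 * 6 * 32 / N = 576 / N]. This [lam] minimizes
   the resulting bound [lam + 576 / (lam N)]. *)
pose lam := 24 / Num.sqrt N.
have sN0 : 0 < Num.sqrt N by rewrite sqrtr_gt0.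
have lam0 : 0 < lam by rewrite divr_gt0.
have Ni0 : 0 <= N^-1 ^+ 2 by rewrite sqr_ge0.
have k0 : 0 <= 8 * phi ^+ 2 by rewrite mulr_ge0 ?sqr_ge0.
have k1 : 0 <= 64 * N^-1 ^+ 2 by rewrite mulr_ge0.
have k2 : 0 <= 3 / lam * N^-1 ^+ 2 by rewrite mulr_ge0// divr_ge0// ltW.
have [iG EG] := mean_belowD (mean_belowZ k0 Bgap)
  (mean_belowD (mean_belowZ k1 (mean_belowD BL1 BL2))
  (mean_belowD (mean_below_cst lam)
  (mean_belowZ k2 (mean_belowD BQ1 (mean_belowD BQ2 (mean_belowZ (ler0n _ 4) BQ3)))))).
move: iG EG; set G := (fun w => _ + _) => iG EG.
apply: (@le_trans _ _ (\int[P]_w (G w)%:E)%E).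
  apply: ge0_le_integral => //.
  - by move=> w _; rewrite lee_fin sqr_ge0.
  - apply/measurable_EFinP; apply: measurable_funX; apply: measurable_funB => //.
    apply: measurableT_comp.
      by apply: continuous_measurable_fun; exact: sqrt_continuous.
    apply: measurableT_comp => //; apply: measurable_funM => //.
    apply: (@m_pair_sum (fun j l w => cos (s * (X (g l) w + U (g l) w - (X (g j) w + U (g j) w))))).
    move=> j l; apply: (measurableT_comp mcos).
    by apply: measurable_funB; apply: measurable_funD; (exact: mU || exact: mX).
  - exact: measurable_int iG.
  move=> w _; rewrite lee_fin.
  (* Both the bias and the linear noise have a factor [phi], which [sqrt_perturbation] wants in
     front of [D]. *)
  pose D := - phi * mean_gap w + 2 * N^-1 * (L1 w - L2 w).
  pose Q := N^-1 * (Q1 w + Q2 w - 2 * Q3 w).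
  have -> : fourier_hat g n xi (fun j => X (g j) w + U (g j) w) s =
      Num.sqrt `|phi ^+ 2 + phi * D + Q|.
    congr (Num.sqrt `|_|).
    rewrite [X in _ * X](cosine_decomposition nb_sym s phi
       (fun j => X (g j) w) (fun j => U (g j) w)).
    have cE : pair_sum nb (fun j l => c j l w) = N - N * mean_gap w.
      rewrite /mean_gap mulrA mulfV ?gt_eqF// mul1r NE -[X in _ - X]/(pair_sum _ _).
      rewrite (_ : pair_sum nb (fun j l => 1 - c j l w) =
        pair_sum nb (fun j l => 1 + (-1) * c j l w)); last first.
        by apply: eq_pair_sum => j l; rewrite mulN1r.
      by rewrite pair_sumD pair_sumZ; ring.
    rewrite [X in phi ^+ 2 * X]cE /D /Q -/(L1 w) -/(L2 w) -/(Q1 w) -/(Q2 w) -/(Q3 w).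
    by rewrite -/N; field; rewrite gt_eqF.
  apply: (le_trans (sqrt_perturbation D Q phi0)).
  have DE : 4 * D ^+ 2 <= 8 * phi ^+ 2 * mean_gap w ^+ 2 +
      64 * N^-1 ^+ 2 * (L1 w ^+ 2 + L2 w ^+ 2).
    rewrite /D; set p := phi * mean_gap w; set q := N^-1.
    have h1 := sqr_ge0 (- p - 2 * q * (L1 w - L2 w)).
    have h2 := sqr_ge0 (q * L1 w + q * L2 w).
    rewrite (_ : 8 * phi ^+ 2 * mean_gap w ^+ 2 = 8 * p ^+ 2); last by rewrite /p; ring.
    rewrite mulNr -/p; nra.
  have Qlam : 2 * `|Q| <= lam + lam^-1 * Q ^+ 2.
    rewrite -[Q ^+ 2]real_normK ?num_real//.
    rewrite -subr_ge0 (_ : _ - _ = lam^-1 * (lam - `|Q|) ^+ 2).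
      by rewrite mulr_ge0 ?sqr_ge0// invr_ge0 ltW.
    by field; rewrite gt_eqF.
  have Q2E : Q ^+ 2 <= 3 * N^-1 ^+ 2 * (Q1 w ^+ 2 + (Q2 w ^+ 2 + 4 * Q3 w ^+ 2)).
    rewrite (_ : Q ^+ 2 = N^-1 ^+ 2 * (Q1 w + Q2 w - 2 * Q3 w) ^+ 2); last by rewrite /Q exprMn.
    rewrite (_ : 3 * N^-1 ^+ 2 * (Q1 w ^+ 2 + (Q2 w ^+ 2 + 4 * Q3 w ^+ 2)) =
      N^-1 ^+ 2 * (3 * (Q1 w ^+ 2 + (Q2 w ^+ 2 + 4 * Q3 w ^+ 2)))); last first.
      by rewrite -mulrA mulrCA.
    apply: ler_wpM2l => //.
    have h1 := sqr_ge0 (Q1 w - Q2 w); have h2 := sqr_ge0 (Q1 w + 2 * Q3 w).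
    have h3 := sqr_ge0 (Q2 w + 2 * Q3 w); nra.
  have Qlam2 : lam^-1 * Q ^+ 2 <=
      3 / lam * N^-1 ^+ 2 * (Q1 w ^+ 2 + (Q2 w ^+ 2 + 4 * Q3 w ^+ 2)).
    rewrite [3 / lam]mulrC -2!mulrA ler_wpM2l ?invr_ge0 ?(ltW lam0)//.
    by rewrite mulrA.
  rewrite /G /=; lra.
rewrite -[leLHS]fineK; last exact: integrable_fin_num iG.
rewrite lee_fin; apply: (le_trans EG); rewrite le_eqVlt; apply/orP; left; apply/eqP.
have NE2 : N = Num.sqrt N ^+ 2 by rewrite sqr_sqrtr// ltW.
rewrite /lam; move: sN0 NE2 N0; move: (Num.sqrt N) => q q0 -> _.
by field; rewrite gt_eqF.
Qed.

End pointwise_risk.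

(** * The integrated risk *)

Section power_integrals.
Context {R : realType}.
Local Notation leb := (@lebesgue_measure R).
Implicit Types p q s a : R.

Lemma is_derive_powR1D q s : 0 <= s ->
  is_derive s (1 : R) (fun x => (1 + x) `^ q) (q * (1 + s) `^ (q - 1)).
Proof.
move=> s0; have s1 : (1 + s) \in `]0, +oo[%R by rewrite in_itv/= andbT ltr_pwDl.
have d1 : is_derive (1 + s) (1 : R) (fun x : R => x `^ q) (q * (1 + s) `^ (q - 1)).
  apply: DeriveDef; first exact: derivable_powR.
  by rewrite -derive1E powR_derive1.
have d2 : is_derive s (1 : R) (fun x => 1 + x) 1.
  have d2 := is_deriveD (is_derive_cst (1 : R) s (1 : R)) (is_derive_id s (1 : R)).
  by apply: (is_derive_eq d2); rewrite add0r.
have := @is_derive1_comp R (fun x : R => x `^ q) (fun x => 1 + x) s _ _ d1 d2.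
by rewrite mulr1.
Qed.

Lemma cvg_powR1DN q : 0 < q -> (1 + x) `^ (- q) @[x --> +oo] --> (0 : R).
Proof.
move=> q0; apply/cvgrPdist_le => e e0; near=> x.
have e1 : 0 < e^-1 by rewrite invr_gt0.
have x0 : e^-1 `^ (q^-1) <= x by near: x; apply: nbhs_pinfty_ge; exact: num_real.
have x1 : 0 <= x by rewrite (le_trans _ x0)// powR_ge0.
rewrite sub0r normrN ger0_norm ?powR_ge0// powRN.
rewrite -[e]invrK lef_pV2 ?posrE//; last by rewrite powR_gt0// ltr_pwDl.
apply: (@le_trans _ _ ((e^-1 `^ (q^-1)) `^ q)).
  by rewrite -powRrM mulVf ?gt_eqF// powRr1// ltW.
apply: ge0_ler_powR; rewrite ?(ltW q0)//.
- by rewrite nnegrE powR_ge0.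
- by rewrite nnegrE addr_ge0.
- by rewrite (le_trans x0)// lerDr.
Unshelve. all: by end_near. Qed.

Lemma integral_power_tail p a : 1 < p -> 0 <= a ->
  (\int[leb]_(s in `[a, +oo[) ((1 + s) `^ (- p))%:E =
   ((1 + a) `^ (1 - p) / (p - 1))%:E)%E.
Proof.
move=> p1 a0; have q0 : 0 < p - 1 by rewrite subr_gt0.
pose F s := - ((1 + s) `^ (1 - p) / (p - 1)).
transitivity ((0 - F a)%:E); last by rewrite /F sub0r opprK.
apply: (@ge0_FTC2y _ _ F).
- by move=> s _; exact: powR_ge0.
- move=> s as_; have s0 : 0 <= s by exact: le_trans as_.
  have d := is_derive_powR1D (1 - p) s0.
  rewrite /F (_ : (fun s => _) = (fun s => (- (p - 1)^-1) * (1 + s) `^ (1 - p))); last first.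
    by apply/funext => x; rewrite mulrC mulNr.
  have := is_deriveM (is_derive_cst (- (p - 1)^-1) s 1) d.
  move=> d'; apply: (is_derive_eq d').
  rewrite scaler0 addr0 /GRing.scale/= mulrA -[1 - p]opprB mulrNN mulVf ?gt_eqF// mul1r.
  by congr (_ `^ _); ring.
- move=> s as_; have s0 : 0 <= s by exact: le_trans as_.
  exact: is_derive_continuous (is_derive_powR1D (- p) s0).
- rewrite /F -[X in _ --> X]oppr0; apply: cvgN; rewrite -(mul0r (p - 1)^-1).
  by apply: cvgM; [rewrite -[1 - p]opprB; exact: cvg_powR1DN|exact: cvg_cst].
Qed.

Lemma measurable_power p : measurable_fun setT (fun s => (1 + `|s|) `^ (- p)).
Proof.
apply: (measurableT_comp (measurable_powR (- p))).
exact: measurable_funD.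
Qed.

(** The integrand is dominated by a one-sided tail plus its reflection, so no splitting of the line
    at 0 is needed. *)
Lemma integral_even_power_tail p a : 1 < p -> 0 <= a ->
  (\int[leb]_s ((a <= `|s|)%R%:R * (1 + `|s|) `^ (- p))%:E <=
   (2 * ((1 + a) `^ (1 - p) / (p - 1)))%:E)%E.
Proof.
move=> p1 a0.
pose F := (fun s => ((1 + `|s|) `^ (- p))%:E) \_ `[a, +oo[%classic.
have mF : measurable_fun setT F.
  have mI : measurable (`[a, +oo[%classic : set R) by exact: measurable_itv.
  apply: (proj1 (measurable_restrictT _ mI)).
  by apply: measurable_funTS; apply/measurable_EFinP; exact: measurable_power.
have F0 s : (0 <= F s)%E.
  by rewrite /F patchE; case: ifP => // _; rewrite lee_fin powR_ge0.
have mFN : measurable_fun setT (fun s => F (- s)).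
  by apply: measurableT_comp => //; exact: oppr_measurable.
have IF : (\int[leb]_s F s = ((1 + a) `^ (1 - p) / (p - 1))%:E)%E.
  rewrite -integral_power_tail// /F -integral_mkcond; apply: eq_integral => s.
  by rewrite inE/= in_itv/= andbT => as_; rewrite ger0_norm// (le_trans a0).
apply: (@le_trans _ _ (\int[leb]_s (F s + F (- s)%R))%E).
  apply: ge0_le_integral => //.
  - apply/measurable_EFinP; apply: measurable_funM; last exact: measurable_power.
    rewrite (_ : (fun s => _) = (fun s : R => if a <= `|s| then 1 else 0)); last first.
      by apply/funext => s; case: (a <= `|s|).
    apply: measurable_fun_ifT => //; exact: measurable_fun_ler.
  - exact: emeasurable_funD.
  move=> s _; case: (leP a `|s|) => h /=; last by rewrite mul0r adde_ge0.
  rewrite mul1r; have [s0|s0] := leP 0 s.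
    rewrite -[leLHS]adde0; apply: leeD => //.
    by rewrite /F patchE mem_set//= in_itv/= andbT; rewrite ger0_norm in h.
  rewrite -[leLHS]add0e; apply: leeD => //.
  by rewrite /F patchE mem_set ?normrN//= in_itv/= andbT; rewrite ltr0_norm in h.
by rewrite ge0_integralD// integralT_opp// IF -EFinD lee_fin; lra.
Qed.

End power_integrals.

(** * Positivity and integrability of the characteristic function *)

Section characteristic_function.
Context {R : realType}.
Local Notation leb := (@lebesgue_measure R).
Variables (f : R -> R) (alpha C2 : R).
Hypotheses (df : density f) (rf : real_nonvanishing_fourier f).
Hypothesis ff : class_F1 alpha C2 f.

Let phi := cosine_transform f.

Lemma cabs_ge_Re (z : R[i]) : `|complex.Re z| <= cabs z.
Proof.
have h : 0 <= cabs z by case: z => a b; exact: sqrtr_ge0.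
rewrite -(ger0_norm h) -ler_sqr ?nnegrE// !real_normK ?num_real//.
by rewrite cabs_sqr lerDl sqr_ge0.
Qed.

Lemma cosine_transform_decay s : `|phi s| <= C2 * (1 + `|s|) `^ (- alpha).
Proof. by rewrite /phi -Re_fourier (le_trans (cabs_ge_Re _)). Qed.

Lemma cosine_transform_neq0 s : phi s != 0.
Proof.
have [im0 n0] := rf s; apply: contra n0 => /eqP h.
have {}h : complex.Re (fourier f s) = 0 by rewrite Re_fourier.
by move: im0 h; case: (fourier f s) => a b /= -> ->.
Qed.

Lemma continuous_cosine_transform_density : continuous phi.
Proof. exact: continuous_cosine_transform (density_integrable df). Qed.

Lemma cosine_transform0 : phi 0 = 1.
Proof.
have [_ _ f1] := df; rewrite /phi /cosine_transform.
under eq_Rintegral do rewrite mulr0 cos0 mulr1.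
by rewrite /Rintegral f1.
Qed.

(** [phi] is continuous, equals 1 at 0 and never vanishes, so the intermediate value theorem
    excludes negative values. Positivity is why the root of an estimate of [phi ^ 2] recovers [phi]
    itself. *)
Lemma cosine_transform_gt0 s : 0 < phi s.
Proof.
rewrite lt0r cosine_transform_neq0/= leNgt; apply/negP => neg.
have [x x_root] : exists x, phi x = 0.
  have cont a b : {within `[a, b], continuous phi}.
    exact: continuous_subspaceT continuous_cosine_transform_density.
  have [s0|s0] := leP 0 s.
    have [|x _ <-] := IVT s0 (cont 0 s) (v := 0); last by exists x.
    by rewrite cosine_transform0 ge_min le_max (ltW neg) ler01 orbT.
  have [|x _ <-] := IVT (ltW s0) (cont s 0) (v := 0); last by exists x.
  by rewrite cosine_transform0 ge_min le_max (ltW neg) ler01 orbT.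
by have := cosine_transform_neq0 x; rewrite x_root eqxx.
Qed.

Hypotheses (alpha_gt : 3 / 2 < alpha) (C2_ge0 : 0 <= C2).

Lemma integrable_cosine_transform_density : leb.-integrable setT (EFin \o phi).
Proof.
have mphi : measurable_fun setT phi.
  by apply: continuous_measurable_fun; exact: continuous_cosine_transform_density.
apply/integrableP; split; first exact/measurable_EFinP.
have a1 : 1 < alpha by have := alpha_gt; lra.
have mp := @measurable_power R alpha.
apply: (@le_lt_trans _ _ (C2%:E * \int[leb]_s ((0 <= `|s|)%R%:R * (1 + `|s|) `^ (- alpha))%:E)%E).
  rewrite -ge0_integralZl//.
  - apply: ge0_le_integral => //.
    + by apply/measurable_EFinP; exact: measurableT_comp.
    + apply: measurable_funeM; apply/measurable_EFinP.
      by under eq_fun do rewrite normr_ge0 mul1r.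
    + by move=> s _; rewrite normr_ge0 mul1r -EFinM lee_fin cosine_transform_decay.
  - by apply/measurable_EFinP; under eq_fun do rewrite normr_ge0 mul1r.
apply: lte_mul_pinfty => //.
exact: le_lt_trans (integral_even_power_tail a1 (lexx 0)) (ltry _).
Qed.

End characteristic_function.

(** The integral of a nonnegative function is a supremum over simple functions below it, hence
    monotone without any measurability. This spares a proof that the squared norm of the error is
    measurable in the outcome. *)
Lemma ge0_le_integralT d (T : measurableType d) (R : realType)
    (mu : {measure set T -> \bar R}) (f1 f2 : T -> \bar R) :
  (forall x, 0 <= f1 x)%E -> (forall x, f1 x <= f2 x)%E ->
  (\int[mu]_x f1 x <= \int[mu]_x f2 x)%E.
Proof.
move=> f10 f12; have f20 x : (0 <= f2 x)%E by exact: le_trans (f12 x).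
rewrite !ge0_integralTE//; apply/ge_ereal_sup => _ [h hf <-].
by apply: ereal_sup_ubound; exists h => // x; exact: le_trans (f12 x).
Qed.

(** * Integration over the frequencies *)

Section risk_bound.
Context {R : realType} d (Omega : measurableType d) (P : probability Omega R).
Variables (T : R) (g : nat -> R) (n : nat) (X U : R -> Omega -> R) (f : R -> R).
Hypothesis model : error_model T g n P X U f.
Hypothesis mX : forall t, 0 <= t <= T -> measurable_fun setT (X t).
Hypothesis gT : forall j : 'I_n.+1, 0 <= g j <= T.
Variables (K xi B h alpha C2 : R).
Hypothesis K0 : 0 <= K.
Hypothesis incr : forall a b, 0 <= a -> a <= b -> b <= T ->
  (\int[P]_w ((X b w - X a w) ^+ 2)%:E <= (K * (b - a))%:E)%E.
Hypothesis B_ge : forall l : 'I_n.+1, (nb_neighbours g n xi l)%:R <= B.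
Local Notation leb := (@lebesgue_measure R).
Let N : R := (nb_pairs g n xi)%:R.
Hypotheses (N0 : 0 < N) (xi0 : 0 <= xi) (h0 : 0 < h).
Hypotheses (f_real : real_nonvanishing_fourier f) (f_decay : class_F1 alpha C2 f).
Hypotheses (alpha_gt : 3 / 2 < alpha) (C20 : 0 <= C2).

Let phi := cosine_transform f.
Let y w j := X (g j) w + U (g j) w.
Let psi (p : Omega * measurableTypeR R) :=
  truncated_fourier_hat g n xi h (y p.1) p.2 - phi p.2.
Let V := 512 * (B / N) + 48 / Num.sqrt N.

Let df : density f. Proof. by have [] := model. Qed.

Let B0 : 0 <= B. Proof. exact: le_trans (B_ge ord0). Qed.
Let V0 : 0 <= V.
Proof. have NN : 0 <= N := ltW N0.
apply: addr_ge0; first by apply: mulr_ge0; [exact: ler0n|exact: divr_ge0].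
by apply: divr_ge0; [exact: ler0n|exact: sqrtr_ge0]. Qed.

Let mpsi : measurable_fun setT psi.
Proof.
apply: measurable_funB; last first.
  have mphi : measurable_fun setT phi.
    by apply: continuous_measurable_fun; exact: continuous_cosine_transform_density.
  exact: (measurableT_comp mphi measurable_snd).
apply: measurable_funM; last first.
  have ms : measurable_fun setT (fun s : R => sinc_kernel_fourier (s * h)).
    rewrite (_ : (fun s => _) = (fun s : R => if `|s * h| <= 1 then 1 else 0)); last first.
      by apply/funext => s; rewrite /sinc_kernel_fourier; case: (`|_| <= 1).
    apply: measurable_fun_ifT => //; apply: measurable_fun_ler => //.
    by apply: measurableT_comp => //; exact: measurable_funM.
  exact: (measurableT_comp ms measurable_snd).
apply: measurableT_comp.
  by apply: continuous_measurable_fun; exact: sqrt_continuous.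
apply: measurableT_comp => //; apply: measurable_funM => //.
rewrite (_ : (fun p => _) = (fun p : Omega * measurableTypeR R =>
  \sum_(j < n.+1) \sum_(l < n.+1)
    (if neighbour g xi j l then cos (p.2 * (y p.1 l - y p.1 j)) else 0))); last first.
  by apply/funext => p; apply: eq_bigr => j _; rewrite big_mkcond.
apply: measurable_sum => j; apply: measurable_sum => l.
case: (neighbour g xi j l) => //.
have my (k : 'I_n.+1) : measurable_fun setT (fun w => y w k).
  by apply: measurable_funD; [exact: mX|exact: (error_measurable model k)].
have mc : measurable_fun setT (@cos R).
  by apply: continuous_measurable_fun; exact: continuous_cos.
apply: (measurableT_comp mc); apply: measurable_funM; first exact: measurable_snd.
by apply: measurable_funB;
  [exact: (measurableT_comp (my l) measurable_fst)
  |exact: (measurableT_comp (my j) measurable_fst)].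
Qed.

Let power (q s : R) := (1 + `|s|) `^ (- q) : R.

Let phi_sqr s : phi s ^+ 2 <= C2 ^+ 2 * power (2 * alpha) s.
Proof.
have -> : C2 ^+ 2 * power (2 * alpha) s = (C2 * (1 + `|s|) `^ (- alpha)) ^+ 2.
  rewrite exprMn -[_ `^ _ ^+ 2]powR_mulrn ?powR_ge0// -powRrM.
  by congr (_ * _ `^ _); ring.
rewrite -real_normK ?num_real// lerXn2r ?nnegrE//; last exact: cosine_transform_decay.
by rewrite mulr_ge0// powR_ge0.
Qed.

(** The exponent [2 * alpha - 2] exceeds 1 exactly when [alpha > 3 / 2]: the bias is then integrable
    over the whole line. *)
Let phi_sqr_s s : phi s ^+ 2 * s ^+ 2 <= C2 ^+ 2 * power (2 * alpha - 2) s.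
Proof.
have -> : power (2 * alpha - 2) s = power (2 * alpha) s * (1 + `|s|) ^+ 2.
  rewrite /power -[(_ + _) ^+ 2]powR_mulrn ?addr_ge0// -powRD; last first.
    by apply/implyP => _; rewrite gt_eqF// ltr_pwDl.
  by congr (_ `^ _); ring.
rewrite mulrA ler_pM ?sqr_ge0//.
by rewrite -real_normK ?num_real// lerXn2r ?nnegrE ?addr_ge0// lerDr.
Qed.

(** Bias, noise and truncation error. The test [0 <= |s|] always holds; it brings the first term
    into the shape of [integral_even_power_tail] with [a = 0]. *)
Let bound s := 8 * (K * xi) * C2 ^+ 2 * ((0 <= `|s|)%R%:R * power (2 * alpha - 2) s)
  + V * \1_(`[- h^-1, h^-1]) s
  + C2 ^+ 2 * ((h^-1 <= `|s|)%R%:R * power (2 * alpha) s).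

Let psi_second_moment s : (\int[P]_w (psi (w, s) ^+ 2)%:E <= (bound s)%:E)%E.
Proof.
have pw q : 0 <= power q s by exact: powR_ge0.
have KC : 0 <= 8 * (K * xi) * C2 ^+ 2 by rewrite !mulr_ge0// sqr_ge0.
have shE : (`|s * h| <= 1) = (`|s| <= h^-1).
  by rewrite normrM (gtr0_norm h0) -ler_pdivlMr// div1r.
have [sh|sh] := boolP (`|s| <= h^-1).
  have -> : (\int[P]_w (psi (w, s) ^+ 2)%:E = \int[P]_w
      ((fourier_hat g n xi (y w) s - phi s) ^+ 2)%:E)%E.
    apply: eq_integral => w _.
    by rewrite /psi /truncated_fourier_hat /sinc_kernel_fourier shE sh mulr1.
  apply: (le_trans (fourier_hat_pointwise_risk model mX gT K0 incr B_ge
    (cosine_transform_gt0 df f_real s) N0 f_real)).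
  rewrite lee_fin /bound indicE mem_set; last by rewrite /= in_itv/= -ler_norml.
  rewrite mulr1 normr_ge0 mul1r -!addrA; apply: lerD.
    rewrite (_ : 8 * _ * _ = 8 * (K * xi) * (phi s ^+ 2 * s ^+ 2)); last by rewrite /phi; ring.
    by rewrite -[leRHS]mulrA ler_wpM2l// !mulr_ge0.
  by rewrite [leRHS]addrA lerDl !mulr_ge0// sqr_ge0.
have -> : (\int[P]_w (psi (w, s) ^+ 2)%:E = \int[P]_w (phi s ^+ 2)%:E)%E.
  apply: eq_integral => w _.
  by rewrite /psi /truncated_fourier_hat /sinc_kernel_fourier shE (negbTE sh) mulr0 sub0r sqrrN.
rewrite integral_cst// [X in (_ * X)%E]probability_setT mule1 lee_fin /bound.
rewrite -ltNge in sh; rewrite (ltW sh) mul1r.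
apply: (le_trans (phi_sqr s)); rewrite lerDr addr_ge0// mulr_ge0//.
by rewrite mulr_ge0.
Qed.

Lemma risk_integral_bound :
  (\int[P]_w L2norm (fun x => density_hat g n xi h (y w) x - (f x)%:C%C)%R ^+ 2 <=
   ((2 * pi)^-1 * (8 * (K * xi) * C2 ^+ 2 * (2 / (2 * alpha - 3)) + V * (2 / h) +
     C2 ^+ 2 * (2 * (h `^ (2 * alpha - 1) / (2 * alpha - 1)))))%:E)%E.
Proof.
have a1 : 1 < 2 * alpha - 2 by have := alpha_gt; lra.
have a2 : 1 < 2 * alpha by have := alpha_gt; lra.
have KC : 0 <= 8 * (K * xi) * C2 ^+ 2 by rewrite !mulr_ge0// sqr_ge0.
have pi0 : 0 <= (2 * pi)^-1 :> R by rewrite invr_ge0 mulr_ge0// pi_ge0.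
have mpsi2 : measurable_fun setT (fun p => (psi p ^+ 2)%:E).
  by apply/measurable_EFinP; exact: measurable_funX.
have psi2 p : (0 <= (psi p ^+ 2)%:E)%E by rewrite lee_fin sqr_ge0.
apply: (@le_trans _ _ (\int[P]_w (((2 * pi)^-1)%:E * \int[leb]_s (psi (w, s) ^+ 2)%:E))%E).
  apply: ge0_le_integralT => w; first exact: sqre_ge0.
  apply: density_hat_L2_error => //.
  exact: (integrable_cosine_transform_density df f_decay alpha_gt C20).
rewrite ge0_integralZl//; last 2 first.
- exact: (@measurable_fun_fubini_tonelli_F _ _ _ _ _ leb (fun p => (psi p ^+ 2)%:E)).
- by move=> w _; apply: integral_ge0.
rewrite EFinM lee_wpmul2l ?lee_fin//.
rewrite (@fubini_tonelli _ _ _ _ _ P leb (fun p => (psi p ^+ 2)%:E))//.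
have mpow q : measurable_fun setT (power q) by exact: measurable_power.
have mtail a q : measurable_fun setT (fun s : R => (a <= `|s|)%R%:R * power q s).
  apply: measurable_funM => //.
  rewrite (_ : (fun s => _) = (fun s : R => if a <= `|s| then 1 else 0)); last first.
    by apply/funext => s; case: (a <= `|s|).
  by apply: measurable_fun_ifT => //; exact: measurable_fun_ler.
have mI : measurable_fun setT (fun s : R => V * \1_(`[- h^-1, h^-1]) s).
  by apply: measurable_funM => //; apply: measurable_indic; exact: measurable_itv.
have mI' : measurable_fun setT (fun s : R => (V * \1_(`[- h^-1, h^-1]) s)%:E).
  exact/measurable_EFinP.
have mct c a q : measurable_fun setT (fun s : R => (c * ((a <= `|s|)%R%:R * power q s))%:E).
  by apply/measurable_EFinP; apply: measurable_funM => //; exact: mtail.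
have tail0 a q s : 0 <= (a <= `|s|)%R%:R * power q s by rewrite mulr_ge0// powR_ge0.
apply: (@le_trans _ _ (\int[leb]_s (bound s)%:E)%E).
  by apply: ge0_le_integralT => s; [apply: integral_ge0 => w _|exact: psi_second_moment].
under eq_integral do rewrite /bound 2!EFinD.
rewrite ge0_integralD//; last 4 first.
- by move=> s _; rewrite -EFinD lee_fin addr_ge0// mulr_ge0.
- by apply: emeasurable_funD; [exact: (mct _ 0)|exact: mI'].
- by move=> s _; rewrite lee_fin mulr_ge0// sqr_ge0.
- exact: mct.
rewrite ge0_integralD//; last 3 first.
- by move=> s _; rewrite lee_fin mulr_ge0.
- exact: (mct _ 0).
- by move=> s _; rewrite lee_fin mulr_ge0.
rewrite [leRHS]EFinD [X in (_ <= X + _)%E]EFinD.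
apply: leeD; first apply: leeD.
- under eq_integral do rewrite EFinM.
  rewrite ge0_integralZl//; last 2 first.
  + by apply/measurable_EFinP; exact: (mtail 0).
  + by move=> s _; rewrite lee_fin.
  rewrite [leRHS]EFinM lee_wpmul2l ?lee_fin//.
  apply: (le_trans (integral_even_power_tail a1 (lexx 0))).
  rewrite lee_fin addr0 powR1 div1r le_eqVlt; apply/orP; left; apply/eqP.
  by congr (_ / _); ring.
- under eq_integral do rewrite EFinM.
  rewrite ge0_integralZl//; last first.
  + by apply/measurable_EFinP; exact: measurable_indic.
  rewrite integral_indic// setIT /= lebesgue_measure_itv/= lte_fin.
  have hi0 : 0 < h^-1 by rewrite invr_gt0.
  rewrite (_ : - h^-1 < h^-1); last by lra.
  by rewrite -EFinB -EFinM lee_fin; apply: ler_wpM2l => //; lra.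
- under eq_integral do rewrite EFinM.
  rewrite ge0_integralZl//; last 3 first.
  + by apply/measurable_EFinP; exact: (mtail h^-1).
  + by move=> s _; rewrite lee_fin.
  + by rewrite lee_fin sqr_ge0.
  rewrite [leRHS]EFinM lee_wpmul2l ?lee_fin ?sqr_ge0//.
  have hi0 : 0 <= h^-1 by rewrite invr_ge0 ltW.
  apply: (le_trans (integral_even_power_tail a2 hi0)).
  rewrite lee_fin ler_wpM2l// ler_wpM2r ?invr_ge0 ?subr_ge0 ?(ltW a2)//.
  (* The tail beyond [h^-1] is a negative power of [1 + h^-1]; omitting the 1 enlarges it to a power
     of [h]. *)
  have -> : h `^ (2 * alpha - 1) = (h^-1 `^ (2 * alpha - 1))^-1.
    by rewrite -[h^-1]powR_inv1 ?(ltW h0)// -powRrM mulN1r powRN invrK.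
  rewrite -[1 - _]opprB powRN lef_pV2 ?posrE ?powR_gt0 ?invr_gt0// ?ltr_pwDl//.
  apply: ge0_ler_powR; rewrite ?nnegrE ?subr_ge0 ?(ltW a2)//.
    by rewrite addr_ge0.
  by rewrite lerDr.
Qed.

End risk_bound.

(** * Counting neighbours and pairs *)

Section neighbours.
Context {R : realType}.
Variables (g : nat -> R) (n : nat) (xi : R).
Hypothesis n0 : (0 < n)%N.
Hypothesis g_lt : forall j, (j < n)%N -> g j < g j.+1.

Lemma grid_nondecreasing j l : (j <= l)%N -> (l <= n)%N -> g j <= g l.
Proof.
elim: l => [|l IH]; first by rewrite leqn0 => /eqP ->.
rewrite leq_eqVlt => /predU1P[->//|]; rewrite ltnS => jl ln.
by apply: (le_trans (IH jl (ltnW ln))); exact/ltW/g_lt.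
Qed.

(* [min_neighbours] and [max_neighbours] leave out the time of index 0. *)
Lemma nb_neighbours_first :
  (nb_neighbours g n xi 0 <= (nb_neighbours g n xi 1).+1)%N.
Proof.
have n1 : (1 < n.+1)%N by [].
pose A := [pred l : 'I_n.+1 | neighbour g xi 1 l].
(* Any neighbour of the time 0 other than [g 1] lies to the right of [g 1] and is therefore closer
   to it. The point added to the set is the index 1, which is not its own neighbour. *)
rewrite /nb_neighbours; apply: (@leq_trans #|[predU1 Ordinal n1 & A]|); last first.
  by rewrite cardU1 -[X in (_ <= X)%N]add1n leq_add2r leq_b1.
apply: subset_leq_card; apply/fintype.subsetP => l.
rewrite !inE /neighbour => /andP[d0 l0]; rewrite -val_eqE/=.
have [//|l1] := eqVneq (l : nat) 1%N; apply/andP; split => //.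
have l2 : (1 <= l)%N by rewrite lt0n.
have ln : (l <= n)%N by rewrite -ltnS.
have g1l := grid_nondecreasing l2 ln.
have g01 : g 0 <= g 1 by exact/ltW/g_lt.
rewrite ger0_norm ?subr_ge0//.
by move: d0; rewrite ger0_norm ?subr_ge0 ?(le_trans g01)//; lra.
Qed.

End neighbours.

Lemma leq_bigmaxn_seq (x0 : nat) (s : seq nat) (F : nat -> nat) j :
  j \in s -> (F j <= \big[maxn/x0]_(i <- s) F i)%N.
Proof.
elim: s => // i s IH; rewrite inE big_cons => /predU1P[->|/IH js]; first exact: leq_maxl.
exact: leq_trans js (leq_maxr _ _).
Qed.

Lemma bigminn_seq_leq (x0 : nat) (s : seq nat) (F : nat -> nat) j :
  j \in s -> (\big[minn/x0]_(i <- s) F i <= F j)%N.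
Proof.
elim: s => // i s IH; rewrite inE big_cons => /predU1P[->|/IH js]; first exact: geq_minl.
exact: leq_trans (geq_minr _ _) js.
Qed.

Section rates.
Context {R : realType}.
Variables (g : nat -> nat -> R) (xi : nat -> R) (n : nat).
Hypothesis n0 : (0 < n)%N.
Hypothesis g_lt : forall j, (j < n)%N -> g n j < g n j.+1.

Let in_range j : (0 < j)%N -> (j <= n)%N -> j \in index_iota 1 n.+1.
Proof. by move=> j0 jn; rewrite mem_index_iota j0 ltnS. Qed.

(** The factor 2 pays for index 0, which has at most one neighbour more than index 1: a positive
    minimum gives index 1 at least one neighbour to absorb it. *)
Lemma nb_neighbours_le (l : 'I_n.+1) : 0 < min_neighbours g xi n ->
  (nb_neighbours (g n) n (xi n) l)%:R <= 2 * max_neighbours g xi n.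
Proof.
rewrite /min_neighbours /max_neighbours ltr0n => m0.
rewrite -natrM ler_nat; have [l0|l0] := posnP l.
  rewrite l0; apply: (leq_trans (nb_neighbours_first _ n0 g_lt)).
  have h1 := leq_trans m0 (bigminn_seq_leq _ (nb_neighbours (g n) n (xi n)) (in_range (leqnn 1) n0)).
  apply: (@leq_trans (2 * nb_neighbours (g n) n (xi n) 1)).
    by rewrite mul2n -addnn -add1n leq_add2r.
  by rewrite leq_mul2l/=; apply: leq_bigmaxn_seq; exact: in_range.
apply: (@leq_trans (1 * nb_neighbours (g n) n (xi n) l)); first by rewrite mul1n.
apply: leq_mul => //; apply: (@leq_bigmaxn_seq _ _ (nb_neighbours (g n) n (xi n))).
by apply: in_range => //; rewrite -ltnS.
Qed.

(** Dropping index 0 leaves exactly the [n] indices over which the minimum runs. *)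
Lemma nb_pairs_ge : n%:R * min_neighbours g xi n <= (nb_pairs (g n) n (xi n))%:R.
Proof.
rewrite /min_neighbours -natrM ler_nat /nb_pairs big_ord_recl.
apply: leq_trans (leq_addl _ _).
rewrite -{1}[n]card_ord -sum_nat_const; apply: leq_sum => j _.
apply: (@bigminn_seq_leq _ _ (nb_neighbours (g n) n (xi n))).
by apply: in_range => //=; rewrite /bump leq0n add1n.
Qed.

End rates.

Theorem theorem1 (R : realType) (T : R) (g : nat -> nat -> R)
    (T_gt0 : 0 < T) (g_grids : grids T g) (g_steps : quasi_uniform g)
    (alpha C1 C2 : R)
    (alpha_gt : 3 / 2 < alpha) (C1_gt0 : 0 < C1) (C2_gt1 : 1 < C2)
    (c_xi c_h c_max c_min : R * R) :
  exists2 C : R, 0 < C &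
  forall (delta1 delta2 : R) (xi h : nat -> R),
    0 < delta1 -> 0 < delta2 ->
    delta1 + 2 * delta2 <= 1 -> 1 / 2 <= delta1 ->
    (4 * alpha - 2)^-1 <= delta2 ->
    (forall n, (0 < n)%N -> 0 < xi n) ->
    asymp c_xi xi (fun n => n%:R `^ (- delta1)) ->
    asymp c_max (max_neighbours g xi) (min_neighbours g xi) ->
    asymp c_min (min_neighbours g xi) (fun n => n%:R * xi n) ->
    (forall n, (0 < n)%N -> 0 < h n) ->
    h n @[n --> \oo] --> 0 ->
    asymp c_h h (fun n => n%:R `^ (- delta2)) ->
    forall n, (0 < n)%N ->
      (ereal_sup [set r : \bar R | exists2 M : model R,
                    class_P1 T (g n) n alpha C1 C2 M &
                    r = risk (g n) n (xi n) (h n) M]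
       <= (C * n%:R `^ (- (1 / 2)))%:E)%E.
Proof.
pose K := (2 * T + 64) * (1 + C1).
(* The bound of [risk_integral_bound] with each quantity replaced by its constant: [1024] is [512]
   times the 2 of [nb_neighbours_le], and [c_min.1 * c_xi.1] comes from the lower bound on the
   number of pairs. Taking [1 + |C'|] makes positivity immediate. *)
pose C' := (2 * pi)^-1 * (8 * (K * c_xi.2) * C2 ^+ 2 * (2 / (2 * alpha - 3)) +
  (1024 * c_max.2 + 48 / Num.sqrt (c_min.1 * c_xi.1)) * (2 / c_h.1) +
  C2 ^+ 2 * (2 * (c_h.2 `^ (2 * alpha - 1) / (2 * alpha - 1)))).
exists (1 + `|C'|) => [|delta1 delta2 xi h d10 d20 d12 d1 d2 xi0 [xi1 xi2 xiE]
  [ma1 ma2 maE] [mi1 mi2 miE] h0 _ [h1 h2 hE] n n0].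
  by rewrite ltr_pwDl.
have a3 : 0 < 2 * alpha - 3 by lra.
have a1 : 0 < 2 * alpha - 1 by lra.
have a4 : 0 < 4 * alpha - 2 by lra.
(* The exponents of [n] in [n^-1 h^-1], [N^(-1/2) h^-1] and [h^(2 alpha - 1)]. The second uses
   [delta1 + 2 delta2 <= 1] in full, and the third is the lower bound on [delta2]. *)
have exp1 : - 1 + delta2 <= - (1 / 2) by lra.
have exp2 : - (1 - delta1 / 2) + delta2 <= - (1 / 2) by lra.
have exp3 : - (delta2 * (2 * alpha - 1)) <= - (1 / 2).
  have : 1 <= delta2 * (4 * alpha - 2) by rewrite -ler_pdivrMr// div1r.
  by lra.
have C20 : 0 <= C2 by rewrite (le_trans ler01)// ltW.
have K0 : 0 <= K by rewrite /K mulr_ge0// addr_ge0 ?mulr_ge0// ltW.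
have [g0 gn g_lt] := g_grids.1 n n0.
set nu : R := n%:R; have nu1 : 1 <= nu by rewrite ler1n.
have nu0 : 0 < nu by exact: lt_le_trans nu1.
have nup a : 0 < nu `^ a by exact: powR_gt0.
set r := nu `^ (- (1 / 2)); have r0 : 0 <= r by exact: powR_ge0.
have nu_le a : a <= - (1 / 2) -> nu `^ a <= r by move=> ha; exact: ler_powR.
have xin := xi0 n n0; have hn := h0 n n0.
have /andP[xi_lo xi_hi] := xiE n n0; have /andP[h_lo h_hi] := hE n n0.
have /andP[_ ma_hi] := maE n n0; have /andP[mi_lo _] := miE n n0.
rewrite ler_pdivlMr// in xi_lo; rewrite ler_pdivrMr// in xi_hi.
rewrite ler_pdivlMr// in h_lo; rewrite ler_pdivrMr// in h_hi.
have nuxi0 : 0 < nu * xi n by exact: mulr_gt0.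
rewrite ler_pdivlMr// in mi_lo.
set m := min_neighbours g xi n in ma_hi mi_lo.
have m0 : 0 < m by apply: lt_le_trans mi_lo; exact: mulr_gt0.
rewrite ler_pdivrMr// in ma_hi; set mx := max_neighbours g xi n in ma_hi.
pose N : R := (nb_pairs (g n) n (xi n))%:R.
have N_ge : nu * m <= N by exact: nb_pairs_ge.
have N0 : 0 < N by apply: lt_le_trans N_ge; exact: mulr_gt0.
apply: ge_ereal_sup => _ [M [XM UM fM FM] ->].
have [mX incr] := signal_increments (ltW T_gt0) (ltW C1_gt0) XM.
have gT (j : 'I_n.+1) : 0 <= g n j <= T.
  by rewrite -{1}g0 -gn !(grid_nondecreasing g_lt)// -ltnS.
apply: (le_trans (risk_integral_bound UM mX gT K0 incr
  (fun l => nb_neighbours_le n0 g_lt l m0) N0 (ltW xin) hn fM FM alpha_gt C20)).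
rewrite lee_fin; apply: (@le_trans _ _ (C' * r)); last first.
  by rewrite ler_wpM2r// (le_trans (ler_norm _))// lerDr.
have pi0 : 0 <= (2 * pi)^-1 :> R by rewrite invr_ge0 mulr_ge0// pi_ge0.
rewrite /C' -[leRHS]mulrA; apply: ler_wpM2l => //.
rewrite [leRHS]mulrDl [X in _ <= X + _]mulrDl.
have hV : (h n)^-1 <= c_h.1^-1 * nu `^ delta2.
  rewrite -[nu `^ delta2]invrK -powRN -invfM lef_pV2 ?posrE// mulr_gt0//.
apply: lerD; first apply: lerD.
- have xir : xi n <= c_xi.2 * r.
    by rewrite (le_trans xi_hi)// ler_wpM2l ?(ltW xi2)// nu_le// lerN2.
  rewrite [leRHS](_ : _ = 8 * (K * (c_xi.2 * r)) * C2 ^+ 2 * (2 / (2 * alpha - 3))); last by ring.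
  rewrite ler_wpM2r ?divr_ge0 ?(ltW a3)// ler_wpM2r ?sqr_ge0// ler_wpM2l//.
  by rewrite ler_wpM2l.
- set k := c_min.1 * c_xi.1; have k0 : 0 < k by exact: mulr_gt0.
  have sk0 : 0 < Num.sqrt k by rewrite sqrtr_gt0.
  pose e := 1 - delta1 / 2.
  (* There are at least [n] indices with at least a multiple of [n xi] neighbours each, so [N] has
     order at least [n^(2 - delta1)], the square of [n^e]. *)
  have N_ge2 : k * (nu `^ e) ^+ 2 <= N.
    apply: le_trans N_ge; apply: (@le_trans _ _ (nu * (c_min.1 * (nu * xi n)))); last first.
      by rewrite ler_wpM2l// ltW.
    rewrite -powR_mulrn ?powR_ge0// -powRrM (_ : e * 2%:R = 1 + 1 - delta1); last by rewrite /e; field.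
    rewrite powRD; last by apply/implyP => _; rewrite gt_eqF.
    rewrite powRD; last by apply/implyP => _; rewrite gt_eqF.
    rewrite powRr1 ?(ltW nu0)// /k.
    rewrite (_ : _ * _ = (nu * (c_min.1 * nu)) * (c_xi.1 * nu `^ (- delta1))); last by ring.
    rewrite (_ : nu * (c_min.1 * (nu * xi n)) = (nu * (c_min.1 * nu)) * xi n); last by ring.
    by rewrite ler_wpM2l// !mulr_ge0// ltW.
  have sN : Num.sqrt k * nu `^ e <= Num.sqrt N.
    rewrite -[X in _ * X]ger0_norm ?powR_ge0// -sqrtr_sqr -sqrtrM ?(ltW k0)//.
    exact: ler_wsqrtr.
  have V1 : 48 / Num.sqrt N <= 48 / Num.sqrt k * nu `^ (- e).
    rewrite powRN -mulrA -invfM; apply: ler_wpM2l; first exact: ler0n.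
    rewrite lef_pV2 ?posrE ?mulr_gt0//.
    by rewrite (lt_le_trans _ sN)// mulr_gt0.
  have V2 : 512 * (2 * mx / N) <= 1024 * c_max.2 * nu `^ (- 1).
    rewrite powR_inv1 ?(ltW nu0)//.
    have : 2 * mx / N <= 2 * c_max.2 * nu^-1.
      rewrite ler_pdivrMr//; apply: (@le_trans _ _ (2 * (c_max.2 * m))).
        by rewrite ler_wpM2l.
      apply: (@le_trans _ _ (2 * c_max.2 * nu^-1 * (nu * m))).
        by rewrite le_eqVlt; apply/orP; left; apply/eqP; field; rewrite gt_eqF.
      by rewrite ler_wpM2l// !mulr_ge0// ?invr_ge0 ltW.
    rewrite (_ : 1024 * c_max.2 * nu^-1 = 512 * (2 * c_max.2 * nu^-1)); last by ring.
    by apply: ler_wpM2l; exact: ler0n.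
  rewrite -/N -/mx.
  apply: (@le_trans _ _ ((1024 * c_max.2 * nu `^ (- 1) + 48 / Num.sqrt k * nu `^ (- e)) *
     (2 * (c_h.1^-1 * nu `^ delta2)))).
    apply: ler_pM.
    + apply: addr_ge0; first apply: mulr_ge0.
      * exact: ler0n.
      * by apply: divr_ge0; [apply: mulr_ge0; exact: ler0n|exact: ltW].
      * by apply: divr_ge0; [exact: ler0n|exact: sqrtr_ge0].
    + by rewrite divr_ge0// ltW.
    + exact: lerD.
    + by rewrite ler_wpM2l.
  rewrite [leLHS](_ : _ = 2 / c_h.1 * (1024 * c_max.2 * (nu `^ (- 1) * nu `^ delta2) +
    48 / Num.sqrt k * (nu `^ (- e) * nu `^ delta2))); last by ring.
  rewrite [leRHS](_ : _ = 2 / c_h.1 * (1024 * c_max.2 * r + 48 / Num.sqrt k * r)); last by ring.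
  rewrite -!powRD; try by apply/implyP => _; rewrite gt_eqF.
  apply: ler_wpM2l; first by apply: divr_ge0; [exact: ler0n|exact: ltW].
  apply: lerD.
    apply: ler_wpM2l; first by apply: mulr_ge0; [exact: ler0n|exact: ltW].
    by apply: nu_le; exact: exp1.
  apply: ler_wpM2l; first by apply: divr_ge0; [exact: ler0n|exact: ltW].
  by apply: nu_le; exact: exp2.
- have hp : h n `^ (2 * alpha - 1) <= c_h.2 `^ (2 * alpha - 1) * r.
    apply: (@le_trans _ _ ((c_h.2 * nu `^ (- delta2)) `^ (2 * alpha - 1))).
      by apply: ge0_ler_powR; rewrite ?nnegrE ?(ltW a1) ?(ltW hn) ?mulr_ge0 ?powR_ge0 ?(ltW h2).
    rewrite powRM ?powR_ge0 ?(ltW h2)//.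
    by rewrite ler_wpM2l ?powR_ge0// -powRrM nu_le// mulNr.
  rewrite [leRHS](_ : _ = C2 ^+ 2 * (2 * (c_h.2 `^ (2 * alpha - 1) * r / (2 * alpha - 1)))); last by ring.
  by rewrite ler_wpM2l ?sqr_ge0// ler_wpM2l// ler_wpM2r// invr_ge0 ltW.
Qed.
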